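(* Let $p\in\mathbb{N}$ and let $k$ be an integer with $0\le k\le p$; put $\mathcal{N}(u)=u^k\,\overline{u}^{\,p-k}$. Fix an arbitrary sequence $\omega=\{\omega_j\}_{j=1}^\infty\in\mathbb{R}^{\mathbb{N}}$. Then the Cauchy problem $$i\partial_t u+\partial_x^2u=\mathcal{N}(u),\qquad u|_{t=0}=f,\qquad (t,x)\in\mathbb{R}\times\mathbb{R},$$ is locally well-posed in $\mathcal{A}_\omega(\mathbb{R})$ in the following sense. For every $R>0$ there exists $T=T(R)>0$ such that for every $f\in\mathcal{A}_\omega(\mathbb{R})$ with $\|f\|_{\mathcal{A}_\omega(\mathbb{R})}\le R$ there exists a unique $u\in C([-T,T];\mathcal{A}_\omega(\mathbb{R}))$ satisfying $$u(t)=S(t)f-i\int_0^tS(t-t')\,\mathcal{N}(u)(t')\,dt'\qquad\text{for all }t\in[-T,T].$$ Moreover, for every $t\in[-T,T]$ the solution map $f\mapsto u(t)$, from $\{f\in\mathcal{A}_\omega(\mathbb{R}):\|f\|_{\mathcal{A}_\omega(\mathbb{R})}\le R\}$ to $\mathcal{A}_\omega(\mathbb{R})$, is locally Lipschitz continuous.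
   Context: $\mathbb{N}=\{1,2,3,\dots\}$. A continuous function $f:\mathbb{R}\to\mathbb{C}$ is almost periodic, written $f\in AP(\mathbb{R})$, if for every $\varepsilon>0$ there is $L>0$ such that every interval of length $L$ contains a number $\tau$ with $\sup_{x\in\mathbb{R}}|f(x-\tau)-f(x)|<\varepsilon$. For $f\in AP(\mathbb{R})$ the mean value $M(f)=\lim_{L\to\infty}\frac1{2L}\int_{-L}^Lf(x)\,dx$ exists; the Fourier coefficients are $\widehat f(\alpha)=M(fe^{-i\alpha x})$, $\alpha\in\mathbb{R}$, which vanish for all but countably many $\alpha$, and $\sigma(f)=\{\alpha\in\mathbb{R}:\widehat f(\alpha)\neq0\}$. Given $\omega=\{\omega_j\}_{j=1}^\infty\in\mathbb{R}^{\mathbb{N}}$ (no linear independence over $\mathbb{Q}$ is assumed), let $\Omega_\omega=\{\sum_jn_j\omega_j: n_j\in\mathbb{Z},\text{ only finitely many } n_j\ne0\}$, a countable subgroup of $\mathbb{R}$. Define $\mathcal{A}_\omega(\mathbb{R})=\{f\in AP(\mathbb{R}):\sigma(f)\subset\Omega_\omega,\ \|f\|_{\mathcal{A}_\omega(\mathbb{R})}<\infty\}$ with $\|f\|_{\mathcal{A}_\omega(\mathbb{R})}=\sum_{\alpha\in\Omega_\omega}|\widehat f(\alpha)|$. For $f\in\mathcal{A}_\omega(\mathbb{R})$ and $t\in\mathbb{R}$, $S(t)=e^{it\partial_x^2}$ is defined by $(S(t)f)(x)=\sum_{\alpha\in\Omega_\omega}\widehat f(\alpha)e^{-i\alpha^2t}e^{i\alpha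 x}$. The integral $\int_0^tS(t-t')F(t')\,dt'$ denotes the function $x\mapsto\int_0^t\sum_{\alpha\in\Omega_\omega}\widehat F(t',\alpha)e^{-i\alpha^2(t-t')}e^{i\alpha x}\,dt'$, where $\widehat F(t',\alpha)$ is the Fourier coefficient of $F(t')$. *)

(* Defs.v *)
From Stdlib Require Import Reals List ZArith.
From Coquelicot Require Import Coquelicot.

Open Scope R_scope.

(** Conventions: functions of x are of type [R -> C].  Mean values and sums
    over index sets are total operators built on Coquelicot's [iota], exactly
    as Coquelicot's [RInt] is: they denote the limit whenever it exists. *)

Definition cis (theta : R) : C := (cos theta, sin theta).

Definition CInt (f : R -> C) (a b : R) : C :=
  RInt (V := C_R_CompleteNormedModule) f a b.

Definition finite_subset (A : R -> Prop) (l : list R) : Prop :=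
  NoDup l /\ List.Forall A l.

Definition finite_sum {G : AbelianMonoid} (a : R -> G) (l : list R) : G :=
  fold_right (fun alpha s => plus (a alpha) s) zero l.

(** The filter of the finite subsets of [A] directed by inclusion. *)
Definition finite_subsets (A : R -> Prop) : (list R -> Prop) -> Prop :=
  fun P => exists l0, finite_subset A l0 /\
    forall l, finite_subset A l -> incl l0 l -> P l.

Global Instance finite_subsets_filter (A : R -> Prop) :
  ProperFilter (finite_subsets A).
Proof.
constructor.
- intros P (l0 & H0 & H). exists l0. apply H; [exact H0 | apply incl_refl].
- constructor.
  + exists nil. split; [split; constructor | trivial].
  + intros P Q (l1 & [_ F1] & H1) (l2 & [_ F2] & H2).
    exists (nodup Req_EM_T (l1 ++ l2)). split.
    * split; [apply NoDup_nodup |].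
      apply Forall_forall. intros x Hx. apply nodup_In in Hx.
      apply (proj1 (Forall_forall A (l1 ++ l2))); [| exact Hx].
      apply Forall_app; split; assumption.
    * intros l Hl Hi.
      split; [apply H1 | apply H2]; try exact Hl;
      intros x Hx; apply Hi, nodup_In, in_or_app; tauto.
  + intros P Q HPQ (l0 & H0 & H). exists l0. split; [exact H0 |].
    intros l Hl Hi. apply HPQ, H; assumption.
Qed.

Definition is_Csum (A : R -> Prop) (a : R -> C) (s : C) : Prop :=
  filterlim (finite_sum (G := C_AbelianMonoid) a)
    (finite_subsets A) (locally (T := C_UniformSpace) s).

Definition Csum (A : R -> Prop) (a : R -> C) : C :=
  iota (T := C_R_CompleteNormedModule) (is_Csum A a).

(** Sum, in [0, +oo], of a family of nonnegative reals. *)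
Definition sum_nonneg (A : R -> Prop) (a : R -> R) : Rbar :=
  Lub_Rbar (fun r => exists l,
    finite_subset A l /\ r = finite_sum (G := R_AbelianMonoid) a l).

Definition almost_periodic (f : R -> C) : Prop :=
  (forall x, continuous (T := R_UniformSpace) (U := C_UniformSpace) f x) /\
  forall eps, 0 < eps -> exists L, 0 < L /\
    forall a, exists tau, a <= tau <= a + L /\
      Rbar_lt
        (Lub_Rbar (fun r => exists x, r = Cmod (f (x - tau)%R - f x)%C)) eps.

Definition is_mean_value (f : R -> C) (m : C) : Prop :=
  filterlim (fun L => (RtoC (/ (2 * L)) * CInt f (- L) L)%C)
    (Rbar_locally p_infty) (locally (T := C_UniformSpace) m).

Definition mean_value (f : R -> C) : C :=
  iota (T := C_R_CompleteNormedModule) (is_mean_value f).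

Definition fourier (f : R -> C) (alpha : R) : C :=
  mean_value (fun x => (f x * cis (- alpha * x))%C).

Definition spectrum (f : R -> C) (alpha : R) : Prop := fourier f alpha <> 0%C.

(** The sequence omega_1, omega_2, ... is indexed from 0. *)
Definition Omega (omega : nat -> R) (alpha : R) : Prop :=
  exists (n : nat -> Z) (N : nat),
    (forall j, (N < j)%nat -> n j = 0%Z) /\
    alpha = sum_n (fun j => IZR (n j) * omega j) N.

Definition A_norm (omega : nat -> R) (f : R -> C) : Rbar :=
  sum_nonneg (Omega omega) (fun alpha => Cmod (fourier f alpha)).

Definition A_space (omega : nat -> R) (f : R -> C) : Prop :=
  almost_periodic f /\
  (forall alpha, spectrum f alpha -> Omega omega alpha) /\
  Rbar_lt (A_norm omega f) p_infty.

Definition A_ball (omega : nat -> R) (R0 : R) (f : R -> C) : Prop :=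
  A_space omega f /\ Rbar_le (A_norm omega f) R0.

Definition A_dist (omega : nat -> R) (f g : R -> C) : Rbar :=
  A_norm omega (fun x => (f x - g x)%C).

(** u in C([-T,T]; A_omega(R)); only the values of [u] on [-T,T] matter. *)
Definition continuous_into_A (omega : nat -> R) (T : R) (u : R -> R -> C) :
  Prop :=
  (forall t, - T <= t <= T -> A_space omega (u t)) /\
  forall t, - T <= t <= T -> forall eps, 0 < eps -> exists delta, 0 < delta /\
    forall s, - T <= s <= T -> Rabs (s - t) < delta ->
      Rbar_lt (A_dist omega (u s) (u t)) eps.

Definition locally_lipschitz_on (omega : nat -> R) (X : (R -> C) -> Prop)
  (Phi : (R -> C) -> (R -> C)) : Prop :=
  forall f0, X f0 -> exists r K, 0 < r /\ 0 <= K /\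
    forall f g, X f -> X g ->
      Rbar_lt (A_dist omega f f0) r -> Rbar_lt (A_dist omega g f0) r ->
      Rbar_le (A_dist omega (Phi f) (Phi g))
        (Rbar_mult K (A_dist omega f g)).

Definition schrodinger_group (omega : nat -> R) (t : R) (f : R -> C) (x : R) :
  C :=
  Csum (Omega omega)
    (fun alpha =>
       (fourier f alpha * cis (- alpha ^ 2 * t) * cis (alpha * x))%C).

(** x |-> int_0^t S(t - t') F(t') dt', the time integral being taken pointwise
    in x. *)
Definition duhamel (omega : nat -> R) (F : R -> R -> C) (t x : R) : C :=
  CInt (fun t' => schrodinger_group omega (t - t') (F t') x) 0 t.

Definition nonlinearity (p k : nat) (z : C) : C :=
  (z ^ k * Cconj z ^ (p - k))%C.

Definition is_solution (omega : nat -> R) (p k : nat) (T : R) (f : R -> C)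
  (u : R -> R -> C) : Prop :=
  continuous_into_A omega T u /\
  forall t, - T <= t <= T -> forall x,
    u t x = (schrodinger_group omega t f x
             - Ci * duhamel omega (fun t' y => nonlinearity p k (u t' y)) t x)%C.

(* Main.v *)
(** Uniqueness of Fourier expansions makes [A_omega] a Banach algebra of absolutely convergent
    Fourier series on which [S(t)] acts isometrically, so Picard iteration on a short time interval
    solves the Duhamel equation, and a weighted norm gives uniqueness without smallness.

    All norm estimates are statements [A_ball omega r f]. These are subadditive, hold for single
    characters, and are closed under uniform limits, so products, time integrals and limits are
    estimated through trigonometric polynomials and step sums without computing Fourier
    coefficients.

    An almost periodic [f] with vanishing Fourier coefficients is zero: the mean of
    [f(x) exp(-i lam x)] tends to 0 uniformly for [lam] in a compact set, hence so do the
    exponential sums of the samples [f (x0 + j d)] up to an error that vanishes with [d]. Parseval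
    on a finite cyclic group turns this into a small mean square of the autocorrelations of the
    samples, whereas autocorrelations at almost-periods of [f] are bounded below and the density
    of almost-periods among the multiples of [d] is bounded below independently of [d]. *)

Require Import Defs.
From Stdlib Require Import Reals List ZArith Lra Lia Permutation Classical ClassicalEpsilon
  FunctionalExtensionality.
From Coquelicot Require Import Coquelicot.

Open Scope R_scope.

(** * Complex-valued calculus *)

(** Membership in the algebra constrains Fourier coefficients only: neither a sup bound by the norm
    nor [S(0) f = f] is available until coefficients are known to determine the function. That is
    why the uniqueness theorem precedes all algebra. Mean values and sums are total operators, so an
    identity about them has content only once convergence is shown; hence the detour through means
    uniform in the position of the window and through bounds on finite subsums.

    The order of choices shapes the sampling argument: the lower bounds for the energy of the
    samples and for the density of almost-periods must be fixed before the mesh [d], because [d]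
    comes from the smallness that they dictate. Using [2 K] samples but only lags below [K] keeps an
    overlap of at least [K] terms in each correlation.

    The existence time is fitted to the ball of radius [2 R0], whereas a competing solution is only
    known to be continuous and may leave that ball. Its size then forces a larger Lipschitz
    constant, which the weight absorbs without shortening the interval. Paths are extended to all
    times by clamping, so that continuity never needs one-sided versions. *)

Lemma filterlim_C {T : Type} (F : (T -> Prop) -> Prop) {FF : Filter F}
  (f : T -> C) (l : C) :
  filterlim f F (locally (T := C_UniformSpace) l) <->
  forall eps, 0 < eps -> F (fun x => Cmod (f x - l)%C < eps).
Proof.
split.
- intros H eps He.
  pose proof (proj1 (filterlim_locally_ball_norm (K := R_AbsRing)
    (U := C_R_NormedModule) f l) H (mkposreal _ He)) as H1.
  revert H1. apply filter_imp. intros x Hx. rewrite Cmod_norm. exact Hx.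
- intros H.
  apply (proj2 (filterlim_locally_ball_norm (K := R_AbsRing)
    (U := C_R_NormedModule) f l)).
  intros eps. generalize (H eps (cond_pos eps)). apply filter_imp.
  intros x Hx. rewrite Cmod_norm in Hx. exact Hx.
Qed.

Definition contC (f : R -> C) : Prop :=
  forall x, continuous (T := R_UniformSpace) (U := C_UniformSpace) f x.

Lemma continuous_C_eps (f : R -> C) (x : R) :
  continuous (T := R_UniformSpace) (U := C_UniformSpace) f x <->
  forall eps, 0 < eps -> exists delta, 0 < delta /\
    forall y, Rabs (y - x) < delta -> Cmod (f y - f x)%C < eps.
Proof.
unfold continuous. rewrite (filterlim_C (locally (T := R_UniformSpace) x)).
split; intros H eps He; destruct (H eps He) as [d Hd].
- exists d. split; [apply cond_pos | exact Hd].
- destruct Hd as [Hd1 Hd2]. exists (mkposreal d Hd1). exact Hd2.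
Qed.

Lemma Cmod_sub_sym (a b : C) : Cmod (a - b)%C = Cmod (b - a)%C.
Proof. rewrite <- Cmod_opp. f_equal. ring. Qed.

Lemma Cmod_sub_triangle (a b c : C) :
  Cmod (a - c)%C <= Cmod (a - b)%C + Cmod (b - c)%C.
Proof. replace (a - c)%C with ((a - b) + (b - c))%C by ring. apply Cmod_triangle. Qed.

Lemma Cmod_le_add (a b : C) : Cmod a <= Cmod b + Cmod (a - b)%C.
Proof. replace a with (b + (a - b))%C at 1 by ring. apply Cmod_triangle. Qed.

Lemma Cmod_mult_sub (a b c d : C) :
  Cmod (a * b - c * d)%C <= Cmod (a - c)%C * Cmod b + Cmod c * Cmod (b - d)%C.
Proof.
replace (a * b - c * d)%C with ((a - c) * b + c * (b - d))%C by ring.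
rewrite <- !Cmod_mult. apply Cmod_triangle.
Qed.

Lemma Rmult_bound_eps (K eps : R) : 0 <= K -> 0 < eps ->
  exists eta, 0 < eta /\ K * eta < eps.
Proof.
(* Dividing by [K + 1] keeps the witness meaningful when [K = 0]. *)
intros HK He. exists (eps / (K + 1)).
assert (0 < K + 1) by lra. split.
- apply Rdiv_lt_0_compat; lra.
- replace (K * (eps / (K + 1))) with (eps * (K / (K + 1))) by (field; lra).
  rewrite <- (Rmult_1_r eps) at 2. apply Rmult_lt_compat_l; [lra |].
  apply (Rmult_lt_reg_r (K + 1)); [lra |]. field_simplify; lra.
Qed.

Lemma contC_plus (f g : R -> C) : contC f -> contC g -> contC (fun x => f x + g x)%C.
Proof.
intros Hf Hg x. apply continuous_C_eps. intros eps He.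
destruct (proj1 (continuous_C_eps f x) (Hf x) (eps / 2) ltac:(lra)) as [d1 [P1 H1]].
destruct (proj1 (continuous_C_eps g x) (Hg x) (eps / 2) ltac:(lra)) as [d2 [P2 H2]].
exists (Rmin d1 d2). split; [apply Rmin_pos; assumption |]. intros y Hy.
specialize (H1 y (Rlt_le_trans _ _ _ Hy (Rmin_l _ _))).
specialize (H2 y (Rlt_le_trans _ _ _ Hy (Rmin_r _ _))).
replace (f y + g y - (f x + g x))%C with ((f y - f x) + (g y - g x))%C by ring.
pose proof (Cmod_triangle (f y - f x) (g y - g x)). lra.
Qed.

Lemma contC_mult (f g : R -> C) : contC f -> contC g -> contC (fun x => f x * g x)%C.
Proof.
intros Hf Hg x. apply continuous_C_eps. intros eps He.
pose proof (Cmod_ge_0 (f x)). pose proof (Cmod_ge_0 (g x)).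
destruct (Rmult_bound_eps (Cmod (g x) + 1) (eps / 2)) as [e1 [Pe1 He1]]; [lra | lra |].
destruct (Rmult_bound_eps (Cmod (f x)) (eps / 2)) as [e2 [Pe2 He2]]; [lra | lra |].
destruct (proj1 (continuous_C_eps f x) (Hf x) e1 Pe1) as [d1 [P1 H1]].
destruct (proj1 (continuous_C_eps g x) (Hg x) (Rmin e2 1) ltac:(apply Rmin_pos; lra))
  as [d2 [P2 H2]].
exists (Rmin d1 d2). split; [apply Rmin_pos; assumption |]. intros y Hy.
specialize (H1 y (Rlt_le_trans _ _ _ Hy (Rmin_l _ _))).
specialize (H2 y (Rlt_le_trans _ _ _ Hy (Rmin_r _ _))).
pose proof (Rmin_l e2 1). pose proof (Rmin_r e2 1).
eapply Rle_lt_trans; [apply Cmod_mult_sub |].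
pose proof (Cmod_le_add (g y) (g x)).
assert (Cmod (f y - f x) * Cmod (g y) <= e1 * (Cmod (g x) + 1)).
{ apply Rmult_le_compat; try apply Cmod_ge_0; lra. }
assert (Cmod (f x) * Cmod (g y - g x) <= Cmod (f x) * e2).
{ apply Rmult_le_compat_l; lra. }
lra.
Qed.

Lemma contC_const (c : C) : contC (fun _ => c).
Proof. intros x. apply continuous_const. Qed.

Lemma contC_shift (f : R -> C) (a : R) : contC f -> contC (fun x => f (x + a)).
Proof.
intros Hf x. apply continuous_C_eps. intros eps He.
destruct (proj1 (continuous_C_eps f _) (Hf (x + a)) eps He) as [d [P H]].
exists d. split; [exact P |]. intros y Hy. apply H.
replace (y + a - (x + a)) with (y - x) by ring. exact Hy.
Qed.

(** One positive number encodes both data of a neighbourhood: [delta t0] is at most the radius, and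
    its inverse is at least the constant. The gauge form of compactness bounds [delta] below along a
    finite cover, hence its inverse above. Boundedness, uniform continuity and uniformity in
    parameters all reduce to this. *)
Lemma compact_uniform (a b : R) (P : R -> R -> Prop) :
  (forall t C C', C <= C' -> P t C -> P t C') ->
  (forall t0, a <= t0 <= b -> exists eta C, 0 < eta /\
     forall t, a <= t <= b -> Rabs (t - t0) < eta -> P t C) ->
  exists C, forall t, a <= t <= b -> P t C.
Proof.
intros Hmon Hloc.
assert (Hd : forall t0, exists d : posreal, a <= t0 <= b ->
   forall t, a <= t <= b -> Rabs (t - t0) < d -> P t (/ d)).
{ intros t0. destruct (classic (a <= t0 <= b)) as [Ht | Ht].
  - destruct (Hloc t0 Ht) as (eta & C & He & H).
    assert (HC : 0 < Rabs C + 1) by (pose proof (Rabs_pos C); lra).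
    assert (Hp : 0 < Rmin eta (/ (Rabs C + 1))).
    { apply Rmin_pos; [exact He | apply Rinv_0_lt_compat; lra]. }
    exists (mkposreal _ Hp). intros _ t Ht1 Ht2. simpl in *.
    apply (Hmon t C).
    + apply Rle_trans with (Rabs C + 1); [pose proof (Rle_abs C); lra |].
      apply Rle_trans with (/ / (Rabs C + 1)); [rewrite Rinv_inv; lra |].
      apply Rinv_le_contravar; [exact Hp | apply Rmin_r].
    + apply H; [exact Ht1 |]. eapply Rlt_le_trans; [exact Ht2 | apply Rmin_l].
  - exists (mkposreal 1 Rlt_0_1). intros H. contradiction. }
pose (delta := fun t0 => proj1_sig (constructive_indefinite_description _ (Hd t0))).
destruct (compactness_value_1d a b delta) as [d Hcov].
exists (/ d). intros t Ht.
destruct (NNPP _ (Hcov t Ht)) as (t0 & Ht0 & Hclose & Hle).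
apply (Hmon t (/ delta t0)).
- apply Rinv_le_contravar; [apply cond_pos | exact Hle].
- unfold delta in *.
  destruct (constructive_indefinite_description _ (Hd t0)) as [dd Hdd]; simpl in *.
  apply Hdd; assumption.
Qed.

Lemma CInt_correct (f : R -> C) (a b : R) : contC f ->
  is_RInt (V := C_R_CompleteNormedModule) f a b (CInt f a b).
Proof.
intros Hf. apply (RInt_correct (V := C_R_CompleteNormedModule)).
apply (ex_RInt_continuous (V := C_R_CompleteNormedModule)). intros z _. apply Hf.
Qed.

Lemma CInt_unique (f : R -> C) (a b : R) (l : C) :
  is_RInt (V := C_R_CompleteNormedModule) f a b l -> CInt f a b = l.
Proof. apply (is_RInt_unique (V := C_R_CompleteNormedModule)). Qed.

Lemma CInt_plus (f g : R -> C) (a b : R) : contC f -> contC g ->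
  CInt (fun x => f x + g x)%C a b = (CInt f a b + CInt g a b)%C.
Proof.
intros Hf Hg. apply CInt_unique.
apply (is_RInt_plus (V := C_R_NormedModule) f g); apply CInt_correct; assumption.
Qed.

Lemma CInt_pair (f : R -> C) (a b : R) : contC f ->
  is_RInt (fun t => fst (f t)) a b (fst (CInt f a b)) /\
  is_RInt (fun t => snd (f t)) a b (snd (CInt f a b)).
Proof.
intros Hf. split.
- apply (is_RInt_fct_extend_fst (U := R_NormedModule) (V := R_NormedModule)).
  apply CInt_correct, Hf.
- apply (is_RInt_fct_extend_snd (U := R_NormedModule) (V := R_NormedModule)).
  apply CInt_correct, Hf.
Qed.

(** The integral is taken in a real normed module, where [scal] admits real factors only; a complex
    factor has to be treated through real and imaginary parts. *)
Lemma CInt_scal (c : C) (f : R -> C) (a b : R) : contC f ->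
  CInt (fun x => c * f x)%C a b = (c * CInt f a b)%C.
Proof.
intros Hf. apply CInt_unique.
destruct (CInt_pair f a b Hf) as [H1 H2].
apply (is_RInt_fct_extend_pair (U := R_NormedModule) (V := R_NormedModule)).
- apply (is_RInt_minus (V := R_NormedModule) (fun t => fst c * fst (f t))
    (fun t => snd c * snd (f t)));
  apply (is_RInt_scal (V := R_NormedModule)); assumption.
- apply (is_RInt_plus (V := R_NormedModule) (fun t => fst c * snd (f t))
    (fun t => snd c * fst (f t)));
  apply (is_RInt_scal (V := R_NormedModule)); assumption.
Qed.

Lemma CInt_minus (f g : R -> C) (a b : R) : contC f -> contC g ->
  CInt (fun x => f x - g x)%C a b = (CInt f a b - CInt g a b)%C.
Proof.
intros Hf Hg. apply CInt_unique.
apply (is_RInt_minus (V := C_R_NormedModule) f g); apply CInt_correct; assumption.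
Qed.

Lemma CInt_Chasles (f : R -> C) (a b c : R) : contC f ->
  CInt f a c = (CInt f a b + CInt f b c)%C.
Proof.
intros Hf. apply CInt_unique.
apply (is_RInt_Chasles (V := C_R_NormedModule) f a b c); apply CInt_correct, Hf.
Qed.

Lemma CInt_const (c : C) (a b : R) : CInt (fun _ => c) a b = (RtoC (b - a) * c)%C.
Proof.
apply CInt_unique. rewrite <- scal_R_Cmult.
apply (is_RInt_const (V := C_R_NormedModule)).
Qed.

Lemma CInt_swap (f : R -> C) (a b : R) : contC f -> CInt f a b = (- CInt f b a)%C.
Proof.
intros Hf. apply CInt_unique.
apply (is_RInt_swap (V := C_R_NormedModule)). apply CInt_correct, Hf.
Qed.

Lemma CInt_point (f : R -> C) (a : R) : CInt f a a = 0%C.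
Proof. apply CInt_unique. apply (is_RInt_point (V := C_R_NormedModule)). Qed.

Lemma CInt_ext (f g : R -> C) (a b : R) :
  (forall x, Rmin a b < x < Rmax a b -> f x = g x) -> CInt f a b = CInt g a b.
Proof. intros H. apply (RInt_ext (V := C_R_CompleteNormedModule)). exact H. Qed.

Lemma CInt_bound (f : R -> C) (a b M : R) : contC f -> a <= b ->
  (forall x, a <= x <= b -> Cmod (f x) <= M) -> Cmod (CInt f a b) <= (b - a) * M.
Proof.
intros Hf Hab H. rewrite Cmod_norm.
apply (norm_RInt_le_const (V := C_R_NormedModule) f a b); [exact Hab | |].
- intros x Hx. pose proof (H x Hx) as H1. rewrite Cmod_norm in H1. exact H1.
- apply CInt_correct, Hf.
Qed.

Lemma CInt_shift (f : R -> C) (a b s : R) : contC f ->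
  CInt (fun x => f (x + s)) a b = CInt f (a + s) (b + s).
Proof.
intros Hf. apply CInt_unique.
pose proof (CInt_correct f (1 * a + s) (1 * b + s) Hf) as H.
apply (is_RInt_comp_lin (V := C_R_NormedModule)) in H.
rewrite !Rmult_1_l in H.
revert H. apply (is_RInt_ext (V := C_R_NormedModule)). intros x _.
rewrite Rmult_1_l. apply (scal_one (V := C_R_ModuleSpace)).
Qed.

(** * Unimodular exponentials *)

Lemma cis_plus (a b : R) : cis (a + b) = (cis a * cis b)%C.
Proof.
unfold cis, Cmult; simpl. rewrite cos_plus, sin_plus. f_equal; ring.
Qed.

Lemma cis_0 : cis 0 = 1%C.
Proof. unfold cis. rewrite cos_0, sin_0. reflexivity. Qed.

Lemma Cmod_cis (a : R) : Cmod (cis a) = 1.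
Proof.
unfold Cmod, cis; simpl. pose proof (sin2_cos2 a) as H. unfold Rsqr in H.
apply eq_trans with (sqrt 1); [f_equal; lra | apply sqrt_1].
Qed.

Lemma cis_conj (a : R) : Cconj (cis a) = cis (- a).
Proof. unfold cis, Cconj; simpl. rewrite cos_neg, sin_neg. reflexivity. Qed.

Lemma cis_derive (w x : R) :
  is_derive (K := R_AbsRing) (V := C_R_NormedModule) (fun t => cis (w * t)) x
    (Ci * RtoC w * cis (w * x))%C.
Proof.
assert (H1 : is_derive (fun t => cos (w * t)) x (- w * sin (w * x))).
{ auto_derive; [exact I | ring]. }
assert (H2 : is_derive (fun t => sin (w * t)) x (w * cos (w * x))).
{ auto_derive; [exact I | ring]. }
replace (Ci * RtoC w * cis (w * x))%C
  with ((- w * sin (w * x), w * cos (w * x)) : C).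
2:{ unfold Ci, RtoC, cis, Cmult; simpl. f_equal; ring. }
apply (filterdiff_ext_lin _ (fun y : R => (scal y (- w * sin (w * x)), scal y (w * cos (w * x))) : C)).
2:{ intros y. reflexivity. }
unfold cis.
apply (filterdiff_comp_2 (K := R_AbsRing) (T := R_NormedModule) (U := R_NormedModule)
  (V := R_NormedModule) (W := C_R_NormedModule)
  (fun t => cos (w * t)) (fun t => sin (w * t)) (fun a b => (a, b) : C)
  (fun y => scal y (- w * sin (w * x))) (fun y => scal y (w * cos (w * x)))
  (fun a b => (a, b) : C)).
- exact H1.
- exact H2.
- apply (filterdiff_ext_lin _ (fun t : R * R => t : C)).
  + apply (filterdiff_ext (fun t : R * R => t)); [intros [u v]; reflexivity |].
    apply (filterdiff_id (K := R_AbsRing) (V := C_R_NormedModule)).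
  + intros [u v]; reflexivity.
Qed.

Lemma contC_cis (w : R) : contC (fun x => cis (w * x)).
Proof.
intros x. apply (ex_derive_continuous (K := R_AbsRing) (V := C_R_NormedModule)).
eexists. apply cis_derive.
Qed.

(** The chord is the integral of a derivative of modulus one. *)
Lemma cis_lip (a b : R) : Cmod (cis b - cis a)%C <= Rabs (b - a).
Proof.
assert (Hle : forall a b, a <= b -> Cmod (cis b - cis a)%C <= b - a).
{ intros u v Huv.
  assert (Hc : forall x, continuous (T := R_UniformSpace) (U := C_UniformSpace)
    (fun t => Ci * RtoC 1 * cis (1 * t))%C x).
  { apply (contC_mult (fun _ => (Ci * RtoC 1)%C)); [apply contC_const | apply contC_cis]. }
  pose proof (is_RInt_derive (V := C_R_CompleteNormedModule) (fun t => cis (1 * t))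
     (fun t => Ci * RtoC 1 * cis (1 * t))%C u v
     (fun x _ => cis_derive 1 x) (fun x _ => Hc x)) as H.
  apply (norm_RInt_le_const (V := C_R_NormedModule)) with (M := 1) in H; [| exact Huv |].
  - rewrite <- Cmod_norm in H. rewrite !Rmult_1_l in H. rewrite Rmult_1_r in H. exact H.
  - intros x _. rewrite <- Cmod_norm, !Cmod_mult, Cmod_Ci, Cmod_cis, Cmod_R, Rabs_R1. lra. }
destruct (Rle_dec a b) as [H | H].
- rewrite Rabs_pos_eq by lra. apply Hle, H.
- rewrite Cmod_sub_sym, Rabs_minus_sym, Rabs_pos_eq by lra. apply Hle. lra.
Qed.

(** Keeping the factor [Ci * w] on the left avoids a division and includes [w = 0]. *)
Lemma CInt_cis (w a b : R) :
  (Ci * RtoC w * CInt (fun x => cis (w * x)) a b = cis (w * b) - cis (w * a))%C.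
Proof.
rewrite <- (CInt_scal (Ci * RtoC w) (fun x => cis (w * x))) by apply contC_cis.
apply CInt_unique.
apply (is_RInt_derive (V := C_R_CompleteNormedModule) (fun t => cis (w * t))).
- intros x _. apply cis_derive.
- intros x _. apply (contC_mult (fun _ => (Ci * RtoC w)%C)).
  + apply contC_const.
  + apply contC_cis.
Qed.

Lemma cis_PI : cis PI = (-1)%C.
Proof. unfold cis. rewrite cos_PI, sin_PI. reflexivity. Qed.

Lemma cis_2PI_nat (n : nat) : cis (2 * PI * INR n) = 1%C.
Proof.
induction n as [| n IH].
- simpl INR. rewrite Rmult_0_r. apply cis_0.
- rewrite S_INR.
  replace (2 * PI * (INR n + 1)) with (2 * PI * INR n + (PI + PI)) by ring.
  rewrite !cis_plus, IH, cis_PI. ring.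
Qed.

Lemma cis_2PI_Z (n : Z) : cis (2 * PI * IZR n) = 1%C.
Proof.
destruct (Z_le_gt_dec 0 n) as [H | H].
- rewrite <- (Z2Nat.id n H), <- INR_IZR_INZ. apply cis_2PI_nat.
- replace (2 * PI * IZR n) with (- (2 * PI * INR (Z.to_nat (- n)))).
  + rewrite <- cis_conj, cis_2PI_nat. unfold Cconj, RtoC; simpl. f_equal. ring.
  + rewrite INR_IZR_INZ, Z2Nat.id by lia. rewrite opp_IZR. ring.
Qed.

Lemma cis_pow (a : R) (n : nat) : (cis a ^ n)%C = cis (a * INR n).
Proof.
induction n as [| n IH].
- simpl. rewrite Rmult_0_r, cis_0. reflexivity.
- rewrite S_INR. replace (a * (INR n + 1)) with (a + a * INR n) by ring.
  rewrite cis_plus, <- IH. reflexivity.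
Qed.

Lemma cis_neq_1 (a : R) : 0 < a < 2 * PI -> cis a <> 1%C.
Proof.
intros Ha H. unfold cis, RtoC in H. injection H as H1 H2.
replace a with (2 * (a / 2)) in H1 by field.
rewrite cos_2a_sin in H1.
assert (0 < sin (a / 2)) by (apply sin_gt_0; lra).
nra.
Qed.

(** * Almost periodic functions and their means *)

Definition bohr (f : R -> C) : Prop :=
  contC f /\
  forall eps, 0 < eps -> exists L, 0 < L /\
    forall a, exists tau, a <= tau <= a + L /\
      forall x, Cmod (f (x - tau)%R - f x)%C <= eps.

Lemma almost_periodic_bohr (f : R -> C) : almost_periodic f <-> bohr f.
Proof.
split; intros [Hc H]; (split; [exact Hc |]); intros eps He.
- destruct (H eps He) as (L & HL & HL2). exists L. split; [exact HL |].
  intros a. destruct (HL2 a) as (tau & Ht & Hlt). exists tau. split; [exact Ht |].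
  intros x.
  destruct (Lub_Rbar_correct
    (fun r => exists x, r = Cmod (f (x - tau)%R - f x)%C)) as [Hub _].
  specialize (Hub _ (ex_intro _ x eq_refl)).
  apply (Rbar_lt_le _ _ (Rbar_le_lt_trans _ _ _ Hub Hlt)).
(* Half of [eps], because a pointwise bound controls the supremum only non-strictly. *)
- destruct (H (eps / 2) ltac:(lra)) as (L & HL & HL2). exists L. split; [exact HL |].
  intros a. destruct (HL2 a) as (tau & Ht & Hle). exists tau. split; [exact Ht |].
  apply Rbar_le_lt_trans with (Finite (eps / 2)); [| simpl; lra].
  apply (proj2 (Lub_Rbar_correct
    (fun r => exists x, r = Cmod (f (x - tau)%R - f x)%C))).
  intros r [x ->]. apply Hle.
Qed.

Lemma contC_bounded (f : R -> C) (a b : R) : contC f ->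
  exists B, forall x, a <= x <= b -> Cmod (f x) <= B.
Proof.
intros Hf. apply (compact_uniform a b (fun x B => Cmod (f x) <= B)).
- intros; lra.
- intros t0 _.
  destruct (proj1 (continuous_C_eps f t0) (Hf t0) 1 Rlt_0_1) as (d & Hd & H).
  exists d, (Cmod (f t0) + 1). split; [exact Hd |]. intros t _ Ht.
  specialize (H t Ht). pose proof (Cmod_le_add (f t) (f t0)). lra.
Qed.

Lemma contC_uniform (f : R -> C) (a b eps : R) : contC f -> 0 < eps ->
  exists d, 0 < d /\ forall x y, a <= x <= b -> Rabs (y - x) < d ->
    Cmod (f y - f x)%C <= eps.
Proof.
intros Hf He.
(* [K] is the reciprocal of a modulus of continuity: the property must weaken as the constant grows.
   Only [x] is confined to the interval, not [y]. *)
destruct (compact_uniform a b (fun x K => 0 < K /\ forall y, Rabs (y - x) * K < 1 ->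
   Cmod (f y - f x)%C <= eps)) as [K HK].
- intros t C C' HC [H1 H2]. split; [lra |]. intros y Hy. apply H2.
  pose proof (Rabs_pos (y - t)). nra.
- intros t0 _.
  destruct (proj1 (continuous_C_eps f t0) (Hf t0) (eps / 2) ltac:(lra)) as (d & Hd & H).
  exists (d / 2), (2 / d). split; [lra |]. intros t _ Ht.
  assert (HK : 0 < 2 / d) by (apply Rdiv_lt_0_compat; lra).
  split; [exact HK |]. intros y Hy.
  assert (Rabs (y - t) < d / 2).
  { apply (Rmult_lt_reg_r (2 / d)); [exact HK |]. field_simplify; lra. }
  assert (Rabs (y - t0) < d).
  { replace (y - t0) with ((y - t) + (t - t0)) by ring.
    pose proof (Rabs_triang (y - t) (t - t0)). lra. }
  pose proof (H y H1). pose proof (H t ltac:(lra)) as H3.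
  pose proof (Cmod_sub_triangle (f y) (f t0) (f t)) as H4.
  rewrite (Cmod_sub_sym (f t0) (f t)) in H4. lra.
- destruct (Rlt_dec 0 K) as [HK0 | HK0].
  + exists (/ K). split; [apply Rinv_0_lt_compat, HK0 |].
    intros x y Hx Hy. apply (HK x Hx).
    apply (Rmult_lt_compat_r K) in Hy; [| exact HK0]. rewrite Rinv_l in Hy; lra.
  (* The predicate contains [0 < K], so a nonpositive [K] means that the interval is empty. *)
  + exists 1. split; [lra |]. intros x y Hx. destruct (HK x Hx). lra.
Qed.

(** An almost-period in [[x - L, x]] carries [x] into [[0, L]], where continuity gives a bound. *)
Lemma bohr_bounded (f : R -> C) : bohr f -> exists B, 0 < B /\ forall x, Cmod (f x) <= B.
Proof.
intros [Hc H]. destruct (H 1 Rlt_0_1) as (L & HL & HL2).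
destruct (contC_bounded f 0 L Hc) as [B HB].
exists (Rabs B + 1). split; [pose proof (Rabs_pos B); lra |]. intros x.
destruct (HL2 (x - L)) as (tau & Ht & Hx).
specialize (HB (x - tau) ltac:(lra)). specialize (Hx x).
pose proof (Cmod_le_add (f x) (f (x - tau))). rewrite Cmod_sub_sym in Hx.
pose proof (Rle_abs B). lra.
Qed.

(** The same almost-period moves both points; only the first needs to land in [[0, L]], since
    [contC_uniform] leaves the second one free. *)
Lemma bohr_uniform (f : R -> C) (eps : R) : bohr f -> 0 < eps ->
  exists d, 0 < d /\ forall x y, Rabs (y - x) < d -> Cmod (f y - f x)%C <= eps.
Proof.
intros [Hc H] He. destruct (H (eps / 3) ltac:(lra)) as (L & HL & HL2).
destruct (contC_uniform f 0 L (eps / 3) Hc ltac:(lra)) as (d & Hd & Hu).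
exists d. split; [exact Hd |]. intros x y Hxy.
destruct (HL2 (x - L)) as (tau & Ht & Hx).
pose proof (Hu (x - tau) (y - tau) ltac:(lra)
   ltac:(replace (y - tau - (x - tau)) with (y - x) by ring; exact Hxy)).
pose proof (Hx x). pose proof (Hx y) as H2. rewrite Cmod_sub_sym in H2.
pose proof (Cmod_sub_triangle (f y) (f (y - tau)) (f x)).
pose proof (Cmod_sub_triangle (f (y - tau)) (f (x - tau)) (f x)). lra.
Qed.

(** Bochner's criterion: the set of translates is totally bounded. *)
Definition ap (f : R -> C) : Prop :=
  contC f /\
  forall eps, 0 < eps -> exists l : list R, forall a, exists b, In b l /\
    forall x, Cmod (f (x + a)%R - f (x + b)%R)%C <= eps.

Lemma grid (L d : R) : 0 < d ->
  exists l : list R, forall r, 0 <= r <= L -> exists b, In b l /\ Rabs (r - b) < d.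
Proof.
intros Hd. destruct (Rle_dec 0 L) as [HL | HL].
2:{ exists nil. intros r Hr. lra. }
destruct (nfloor_ex (L / d)) as [n Hn].
{ apply Rdiv_le_0_compat; lra. }
exists (map (fun j => INR j * d) (seq 0 (S n))). intros r Hr.
destruct (nfloor_ex (r / d)) as [j Hj].
{ apply Rdiv_le_0_compat; lra. }
exists (INR j * d). split.
- apply in_map_iff. exists j. split; [reflexivity |]. apply in_seq.
  assert (INR j < INR (S n)).
  { rewrite S_INR. apply Rle_lt_trans with (r / d); [lra |].
    apply Rle_lt_trans with (L / d); [| lra].
    apply Rmult_le_compat_r; [apply Rlt_le, Rinv_0_lt_compat; lra | lra]. }
  apply INR_lt in H. lia.
- replace (r - INR j * d) with ((r / d - INR j) * d) by (field; lra).
  rewrite Rabs_pos_eq; nra.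
Qed.

(** Modulo an almost-period every shift lies in [[0, L]], and uniform continuity lets a finite grid
    represent all shifts there. *)
Lemma bohr_ap (f : R -> C) : bohr f -> ap f.
Proof.
intros Hf. pose proof Hf as [Hc H]. split; [exact Hc |]. intros eps He.
destruct (H (eps / 2) ltac:(lra)) as (L & HL & HL2).
destruct (bohr_uniform f (eps / 2) Hf ltac:(lra)) as (d & Hd & Hu).
destruct (grid L d Hd) as [l Hl]. exists l. intros a.
destruct (HL2 (a - L)) as (tau & Ht & Hx).
destruct (Hl (a - tau) ltac:(lra)) as (b & Hb & Hbd).
exists b. split; [exact Hb |]. intros x.
pose proof (Hx (x + a)) as H1. rewrite Cmod_sub_sym in H1.
pose proof (Hu (x + b) (x + a - tau)
  ltac:(replace (x + a - tau - (x + b)) with (a - tau - b) by ring; exact Hbd)).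
pose proof (Cmod_sub_triangle (f (x + a)) (f (x + a - tau)) (f (x + b))). lra.
Qed.

Lemma list_bound (l : list R) : exists m, 0 < m /\ forall b, In b l -> Rabs b <= m.
Proof.
induction l as [| c l [m [Hm IH]]].
- exists 1. split; [lra | intros b []].
- exists (Rmax m (Rabs c)). split.
  + eapply Rlt_le_trans; [exact Hm | apply Rmax_l].
  + intros b [-> | Hb]; [apply Rmax_r |].
    eapply Rle_trans; [apply IH, Hb | apply Rmax_l].
Qed.

(** If all representatives lie in [[-m, m]] and [b] represents the shift [-(c + m)], then
    [b + c + m] is an almost-period in [[c, c + 2 m]]. *)
Lemma ap_bohr (f : R -> C) : ap f -> bohr f.
Proof.
intros [Hc H]. split; [exact Hc |]. intros eps He.
destruct (H eps He) as [l Hl]. destruct (list_bound l) as (m & Hm & Hml).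
exists (2 * m). split; [lra |]. intros c.
destruct (Hl (- (c + m))) as (b & Hb & Hx).
exists (b + c + m). pose proof (Hml b Hb) as Hbm. apply Rabs_le_between in Hbm.
split; [lra |]. intros x. specialize (Hx (x - b)).
replace (x - b + - (c + m)) with (x - (b + c + m)) in Hx by ring.
replace (x - b + b) with x in Hx by ring. exact Hx.
Qed.

Lemma ap_iff (f : R -> C) : almost_periodic f <-> ap f.
Proof.
rewrite almost_periodic_bohr. split; [apply bohr_ap | apply ap_bohr].
Qed.

Lemma list_representatives {A B : Type} (P : A -> B -> Prop) (l : list A) :
  exists l' : list B, forall i a, In i l -> P i a -> exists b, In b l' /\ P i b.
Proof.
induction l as [| i l [l' IH]].
- exists nil. intros i a [].
- destruct (classic (exists b, P i b)) as [[b Hb] | Hn].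
  + exists (b :: l'). intros j a [<- | Hj] Ha.
    * exists b. split; [left; reflexivity | exact Hb].
    * destruct (IH j a Hj Ha) as (c & Hc & Hc2). exists c. split; [right; exact Hc | exact Hc2].
  + exists l'. intros j a [<- | Hj] Ha.
    * exfalso. apply Hn. exists a. exact Ha.
    * apply (IH j a Hj Ha).
Qed.

(** Sums and products need representatives common to two functions, which Bohr's form does not give
    directly. Here the pairs of representatives split the shifts into finitely many classes, and one
    member of each nonempty class replaces its pair, at the cost of doubling the tolerance. *)
Lemma ap_common (f g : R -> C) (eps : R) : ap f -> ap g -> 0 < eps ->
  exists l : list R, forall a, exists b, In b l /\
    forall x, Cmod (f (x + a)%R - f (x + b)%R)%C <= eps /\
              Cmod (g (x + a)%R - g (x + b)%R)%C <= eps.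
Proof.
intros [_ Hf] [_ Hg] He.
destruct (Hf (eps / 2) ltac:(lra)) as [l1 H1].
destruct (Hg (eps / 2) ltac:(lra)) as [l2 H2].
destruct (list_representatives (fun (p : R * R) a =>
  (forall x, Cmod (f (x + a)%R - f (x + fst p)%R)%C <= eps / 2) /\
  (forall x, Cmod (g (x + a)%R - g (x + snd p)%R)%C <= eps / 2)) (list_prod l1 l2))
  as [l Hl].
exists l. intros a.
destruct (H1 a) as (b1 & Hb1 & Hx1). destruct (H2 a) as (b2 & Hb2 & Hx2).
destruct (Hl (b1, b2) a) as (b & Hb & Hxb1 & Hxb2).
- apply in_prod; assumption.
- split; assumption.
- exists b. split; [exact Hb |]. simpl in *. intros x. split.
  + pose proof (Hx1 x). pose proof (Hxb1 x) as H3. rewrite Cmod_sub_sym in H3.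
    pose proof (Cmod_sub_triangle (f (x + a)) (f (x + b1)) (f (x + b))). lra.
  + pose proof (Hx2 x). pose proof (Hxb2 x) as H3. rewrite Cmod_sub_sym in H3.
    pose proof (Cmod_sub_triangle (g (x + a)) (g (x + b2)) (g (x + b))). lra.
Qed.

Lemma ap_bounded (f : R -> C) : ap f -> exists B, 0 < B /\ forall x, Cmod (f x) <= B.
Proof. intros H. apply bohr_bounded, ap_bohr, H. Qed.

Lemma ap_plus (f g : R -> C) : ap f -> ap g -> ap (fun x => f x + g x)%C.
Proof.
intros Hf Hg. split; [apply contC_plus; [apply Hf | apply Hg] |]. intros eps He.
destruct (ap_common f g (eps / 2) Hf Hg ltac:(lra)) as [l Hl].
exists l. intros a. destruct (Hl a) as (b & Hb & Hx). exists b. split; [exact Hb |].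
intros x. destruct (Hx x).
replace (f (x + a)%R + g (x + a)%R - (f (x + b)%R + g (x + b)%R))%C
  with ((f (x + a)%R - f (x + b)%R) + (g (x + a)%R - g (x + b)%R))%C by ring.
eapply Rle_trans; [apply Cmod_triangle | lra].
Qed.

Lemma ap_mult (f g : R -> C) : ap f -> ap g -> ap (fun x => f x * g x)%C.
Proof.
intros Hf Hg. split; [apply contC_mult; [apply Hf | apply Hg] |]. intros eps He.
destruct (ap_bounded f Hf) as (B1 & HB1 & Hf1).
destruct (ap_bounded g Hg) as (B2 & HB2 & Hg1).
destruct (Rmult_bound_eps (B1 + B2) eps ltac:(lra) He) as (eta & He1 & He2).
destruct (ap_common f g eta Hf Hg He1) as [l Hl].
exists l. intros a. destruct (Hl a) as (b & Hb & Hx). exists b. split; [exact Hb |].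
intros x. destruct (Hx x) as [H1 H2].
eapply Rle_trans; [apply Cmod_mult_sub |].
pose proof (Hf1 (x + b)). pose proof (Hg1 (x + a)).
assert (Cmod (f (x + a)%R - f (x + b)%R) * Cmod (g (x + a)%R) <= eta * B2)
  by (apply Rmult_le_compat; try apply Cmod_ge_0; assumption).
assert (Cmod (f (x + b)%R) * Cmod (g (x + a)%R - g (x + b)%R) <= B1 * eta)
  by (apply Rmult_le_compat; try apply Cmod_ge_0; assumption).
lra.
Qed.

Lemma ap_limit (f : R -> C) :
  (forall eps, 0 < eps -> exists g, ap g /\ forall x, Cmod (f x - g x)%C <= eps) -> ap f.
Proof.
intros H. split.
- intros x. apply continuous_C_eps. intros eps He.
  destruct (H (eps / 4) ltac:(lra)) as (g & [Hg _] & Hfg).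
  destruct (proj1 (continuous_C_eps g x) (Hg x) (eps / 4) ltac:(lra)) as (d & Hd & Hy).
  exists d. split; [exact Hd |]. intros y Hxy. specialize (Hy y Hxy).
  pose proof (Hfg x) as H1. rewrite Cmod_sub_sym in H1. pose proof (Hfg y).
  pose proof (Cmod_sub_triangle (f y) (g y) (f x)).
  pose proof (Cmod_sub_triangle (g y) (g x) (f x)). lra.
- intros eps He. destruct (H (eps / 3) ltac:(lra)) as (g & [_ Hg] & Hfg).
  destruct (Hg (eps / 3) ltac:(lra)) as [l Hl]. exists l. intros a.
  destruct (Hl a) as (b & Hb & Hx). exists b. split; [exact Hb |]. intros x.
  specialize (Hx x). pose proof (Hfg (x + a)). pose proof (Hfg (x + b)) as H1.
  rewrite Cmod_sub_sym in H1.
  pose proof (Cmod_sub_triangle (f (x + a)) (g (x + a)) (f (x + b))).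
  pose proof (Cmod_sub_triangle (g (x + a)) (g (x + b)) (f (x + b))). lra.
Qed.

Lemma ap_const (c : C) : ap (fun _ => c).
Proof.
split; [apply contC_const |]. intros eps He. exists (0 :: nil). intros a. exists 0.
split; [left; reflexivity |]. intros x.
replace (c - c)%C with (RtoC 0) by ring. rewrite Cmod_0. lra.
Qed.

Lemma ap_cis (w : R) : ap (fun x => cis (w * x)).
Proof.
destruct (Req_dec w 0) as [-> | Hw].
{ apply (ap_limit _). intros eps He. exists (fun _ => 1%C). split; [apply ap_const |].
  intros x. rewrite Rmult_0_l, cis_0. replace (1 - 1)%C with (RtoC 0) by ring.
  rewrite Cmod_0. lra. }
apply bohr_ap. split; [apply contC_cis |]. intros eps He.
pose proof PI_RGT_0 as Hpi. pose proof (Rabs_pos_lt w Hw) as Hw2.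
assert (Hp : 0 < 2 * PI / Rabs w) by (apply Rdiv_lt_0_compat; lra).
exists (2 * PI / Rabs w). split; [exact Hp |]. intros a.
(* [up] selects the first multiple of the period beyond [a], which is at most one period away. *)
destruct (archimed (a / (2 * PI / Rabs w))) as [H1 H2].
set (k := up (a / (2 * PI / Rabs w))) in *.
exists (IZR k * (2 * PI / Rabs w)).
assert (E : a = a / (2 * PI / Rabs w) * (2 * PI / Rabs w)) by (field; lra).
split.
- rewrite E at 1 2. split; nra.
- intros x.
  assert (Hk : cis (- (w * (IZR k * (2 * PI / Rabs w)))) = 1%C).
  { destruct (Rle_dec 0 w) as [Hs | Hs].
    - rewrite (Rabs_pos_eq w) by lra.
      replace (- (w * (IZR k * (2 * PI / w)))) with (2 * PI * IZR (- k))
        by (rewrite opp_IZR; field; lra).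
      apply cis_2PI_Z.
    - rewrite (Rabs_left w) by lra.
      replace (- (w * (IZR k * (2 * PI / - w)))) with (2 * PI * IZR k) by (field; lra).
      apply cis_2PI_Z. }
  replace (w * (x - IZR k * (2 * PI / Rabs w)))
    with (w * x + - (w * (IZR k * (2 * PI / Rabs w)))) by ring.
  rewrite cis_plus, Hk. replace (cis (w * x) * 1 - cis (w * x))%C with (RtoC 0) by ring.
  rewrite Cmod_0. lra.
Qed.

Lemma ap_ext (f g : R -> C) : (forall x, f x = g x) -> ap f -> ap g.
Proof.
intros E H. apply ap_limit. intros eps He. exists f. split; [exact H |]. intros x.
rewrite E. replace (g x - g x)%C with (RtoC 0) by ring. rewrite Cmod_0. lra.
Qed.

Lemma ap_scal (c : C) (f : R -> C) : ap f -> ap (fun x => c * f x)%C.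
Proof. intros H. apply (ap_mult (fun _ => c)); [apply ap_const | exact H]. Qed.

Lemma ap_minus (f g : R -> C) : ap f -> ap g -> ap (fun x => f x - g x)%C.
Proof.
intros Hf Hg. apply ap_ext with (fun x => f x + (-1) * g x)%C; [intros x; ring |].
apply ap_plus; [exact Hf | apply ap_scal, Hg].
Qed.

(** Stronger than the symmetric limit in [is_mean_value]: uniformity in the left end [a] allows long
    intervals to be cut into blocks of a fixed length. Multiplying by [L] instead of dividing makes
    the errors of the blocks additive. *)
Definition uniform_mean (f : R -> C) (m : C) : Prop :=
  forall eps, 0 < eps -> exists L0, 0 < L0 /\
    forall L a, L0 <= L -> Cmod (CInt f a (a + L) - RtoC L * m)%C <= eps * L.

Lemma uniform_mean_is_mean_value (f : R -> C) (m : C) :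
  uniform_mean f m -> is_mean_value f m.
Proof.
intros H. apply (proj2 (filterlim_C (Rbar_locally p_infty) _ m)). intros eps He.
destruct (H (eps / 2) ltac:(lra)) as (L0 & HL0 & HL). exists L0. intros L HLL.
specialize (HL (2 * L) (- L) ltac:(lra)). replace (- L + 2 * L) with L in HL by ring.
assert (E : (RtoC (/ (2 * L)) * CInt f (- L) L - m)%C
  = (RtoC (/ (2 * L)) * (CInt f (- L) L - RtoC (2 * L) * m))%C).
{ assert (E1 : (RtoC (/ (2 * L)) * RtoC (2 * L) = 1)%C)
    by (rewrite <- RtoC_mult, Rinv_l; [reflexivity | lra]).
  transitivity (RtoC (/ (2 * L)) * CInt f (- L) L
     - (RtoC (/ (2 * L)) * RtoC (2 * L)) * m)%C; [rewrite E1 |]; ring. }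
rewrite E, Cmod_mult, Cmod_R, Rabs_pos_eq by (apply Rlt_le, Rinv_0_lt_compat; lra).
apply Rle_lt_trans with (/ (2 * L) * (eps / 2 * (2 * L))).
- apply Rmult_le_compat_l; [apply Rlt_le, Rinv_0_lt_compat; lra | exact HL].
- field_simplify; lra.
Qed.

Lemma is_mean_value_unique (f : R -> C) (m : C) :
  is_mean_value f m -> mean_value f = m.
Proof.
intros H. unfold mean_value, is_mean_value.
apply (iota_filterlim_locally (K := R_AbsRing) (V := C_R_CompleteNormedModule)
  (F := Rbar_locally p_infty)).
exact H.
Qed.

Lemma uniform_mean_value (f : R -> C) (m : C) : uniform_mean f m -> mean_value f = m.
Proof. intros H. apply is_mean_value_unique, uniform_mean_is_mean_value, H. Qed.

Lemma CInt_blocks (f : R -> C) (L K : R) (v : C) : contC f ->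
  (forall a, Cmod (CInt f a (a + L) - v)%C <= K) ->
  forall n a, Cmod (CInt f a (a + INR n * L) - RtoC (INR n) * v)%C <= INR n * K.
Proof.
intros Hc H n. induction n as [| n IH]; intros a.
- simpl INR. replace (a + 0 * L) with a by ring. rewrite CInt_point.
  replace (0 - 0 * v)%C with (RtoC 0) by ring. rewrite Cmod_0. lra.
- rewrite S_INR, RtoC_plus.
  replace (a + (INR n + 1) * L) with (a + INR n * L + L) by ring.
  rewrite (CInt_Chasles f a (a + INR n * L) _ Hc).
  specialize (IH a). specialize (H (a + INR n * L)).
  replace (CInt f a (a + INR n * L) + CInt f (a + INR n * L) (a + INR n * L + L)
     - (RtoC (INR n) + RtoC 1) * v)%C
  with ((CInt f a (a + INR n * L) - RtoC (INR n) * v) +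
        (CInt f (a + INR n * L) (a + INR n * L + L) - v))%C by ring.
  eapply Rle_trans; [apply Cmod_triangle | lra].
Qed.

Lemma CInt_bound_all (f : R -> C) (a b B : R) : contC f ->
  (forall x, Cmod (f x) <= B) -> Cmod (CInt f a b) <= Rabs (b - a) * B.
Proof.
intros Hc HB. destruct (Rle_dec a b) as [H | H].
- rewrite Rabs_pos_eq by lra. apply CInt_bound; auto.
- rewrite CInt_swap, Cmod_opp, Rabs_minus_sym, Rabs_pos_eq by (lra || assumption).
  apply CInt_bound; auto; lra.
Qed.

(** An almost-period aligns the two windows up to a displacement of at most [l]. The two end pieces
    cost [2 * l * B] whatever the length [L], and the aligned windows differ by [eps / 2] per unit
    length; the threshold makes the end pieces cost no more than that. *)
Lemma bohr_CInt_shift (f : R -> C) (eps : R) : bohr f -> 0 < eps ->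
  exists L0, 0 < L0 /\ forall L a b, L0 <= L ->
    Cmod (CInt f a (a + L) - CInt f b (b + L))%C <= eps * L.
Proof.
intros Hf He. pose proof Hf as [Hc H].
destruct (bohr_bounded f Hf) as (B & HB & HfB).
destruct (H (eps / 2) ltac:(lra)) as (l & Hl & Htau).
exists (4 * l * B / eps).
split; [apply Rdiv_lt_0_compat; [| lra]; nra |]. intros L a b HL.
assert (HLp : 4 * l * B <= eps * L).
{ apply (Rmult_le_compat_r eps) in HL; [| lra].
  unfold Rdiv in HL. rewrite Rmult_assoc, Rinv_l in HL; lra. }
assert (HL0 : 0 <= L).
{ eapply Rle_trans; [| exact HL]. apply Rdiv_le_0_compat; [| lra]. nra. }
destruct (Htau (a - b - l)) as (tau & Ht & Hx).
set (s := a - tau).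
assert (E1 : CInt f b (b + L) = (CInt f b s + CInt f s (s + L) - CInt f (b + L) (s + L))%C).
{ rewrite (CInt_Chasles f b s (b + L) Hc), (CInt_Chasles f s (s + L) (b + L) Hc).
  rewrite (CInt_swap f (s + L) (b + L) Hc). ring. }
assert (E2 : CInt f s (s + L) = CInt (fun x => f (x + - tau)) a (a + L)).
{ rewrite CInt_shift by exact Hc. unfold s. f_equal; ring. }
assert (Hc2 : contC (fun x => f (x + - tau))) by (apply contC_shift, Hc).
assert (H1 : Cmod (CInt f a (a + L) - CInt f s (s + L))%C <= L * (eps / 2)).
{ rewrite E2, <- CInt_minus by assumption.
  replace (L * (eps / 2)) with ((a + L - a) * (eps / 2)) by ring.
  apply CInt_bound; [| lra |].
  - intros x. apply (continuous_minus (V := C_R_NormedModule) f); [apply Hc | apply Hc2].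
  - intros x _. rewrite Cmod_sub_sym. apply Hx. }
assert (H2 : Cmod (CInt f b s) <= l * B).
{ eapply Rle_trans; [apply (CInt_bound_all f _ _ B Hc HfB) |].
  apply Rmult_le_compat_r; [lra |]. apply Rabs_le. unfold s. lra. }
assert (H3 : Cmod (CInt f (b + L) (s + L)) <= l * B).
{ eapply Rle_trans; [apply (CInt_bound_all f _ _ B Hc HfB) |].
  apply Rmult_le_compat_r; [lra |]. apply Rabs_le. unfold s. lra. }
rewrite E1.
replace (CInt f a (a + L) - (CInt f b s + CInt f s (s + L) - CInt f (b + L) (s + L)))%C
  with ((CInt f a (a + L) - CInt f s (s + L)) + (- CInt f b s + CInt f (b + L) (s + L)))%C
  by ring.
pose proof (Cmod_triangle (CInt f a (a + L) - CInt f s (s + L))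
  (- CInt f b s + CInt f (b + L) (s + L))).
pose proof (Cmod_triangle (- CInt f b s) (CInt f (b + L) (s + L))) as H4.
rewrite Cmod_opp in H4. lra.
Qed.

(** The average over a single window of length [L1] serves as approximate mean: the window
    [[a, a + L]] is cut into blocks of length [L1], each comparable with that window, plus a
    remainder of bounded cost. *)
Lemma bohr_approx_mean (f : R -> C) (eps : R) : bohr f -> 0 < eps ->
  exists w L0, 0 < L0 /\ forall L a, L0 <= L ->
    Cmod (CInt f a (a + L) - RtoC L * w)%C <= eps * L.
Proof.
intros Hf He. pose proof Hf as [Hc _].
destruct (bohr_bounded f Hf) as (B & HB & HfB).
destruct (bohr_CInt_shift f (eps / 2) Hf ltac:(lra)) as (L1 & HL1 & Hsh).
set (v := CInt f 0 (0 + L1)).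
exists (RtoC (/ L1) * v)%C, (4 * L1 * B / eps).
split; [apply Rdiv_lt_0_compat; [| lra]; nra |].
intros L a HL.
assert (HLp : 4 * L1 * B <= eps * L).
{ apply (Rmult_le_compat_r eps) in HL; [| lra].
  unfold Rdiv in HL. rewrite Rmult_assoc, Rinv_l in HL; lra. }
assert (HL0 : 0 <= L).
{ eapply Rle_trans; [| exact HL]. apply Rdiv_le_0_compat; [| lra]. nra. }
destruct (nfloor_ex (L / L1)) as [n Hn].
{ apply Rdiv_le_0_compat; lra. }
assert (EL : L = L / L1 * L1) by (field; lra).
assert (Hn2 : 0 <= L - INR n * L1 <= L1).
{ generalize dependent (L / L1). intros q Hq ->. nra. }
assert (Hv : Cmod v <= L1 * B).
{ replace (L1 * B) with ((0 + L1 - 0) * B) by ring.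
  apply CInt_bound; auto; lra. }
pose proof (CInt_blocks f L1 (eps / 2 * L1) v Hc
  (fun a => Hsh L1 a 0 (Rle_refl _)) n a) as Hb.
rewrite (CInt_Chasles f a (a + INR n * L1) (a + L) Hc).
assert (H2 : Cmod (CInt f (a + INR n * L1) (a + L)) <= L1 * B).
{ eapply Rle_trans; [apply (CInt_bound_all f _ _ B Hc HfB) |].
  apply Rmult_le_compat_r; [lra |]. apply Rabs_le. lra. }
assert (H3 : Cmod (RtoC (INR n) * v - RtoC L * (RtoC (/ L1) * v))%C <= L1 * B).
{ replace (RtoC (INR n) * v - RtoC L * (RtoC (/ L1) * v))%C
    with (RtoC (INR n - L / L1) * v)%C
    by (unfold Rdiv; rewrite RtoC_minus, RtoC_mult; ring).
  rewrite Cmod_mult, Cmod_R.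
  assert (Rabs (INR n - L / L1) <= 1) by (apply Rabs_le; lra).
  pose proof (Cmod_ge_0 v). pose proof (Rabs_pos (INR n - L / L1)). nra. }
replace (CInt f a (a + INR n * L1) + CInt f (a + INR n * L1) (a + L)
   - RtoC L * (RtoC (/ L1) * v))%C
with ((CInt f a (a + INR n * L1) - RtoC (INR n) * v) +
   (CInt f (a + INR n * L1) (a + L) + (RtoC (INR n) * v - RtoC L * (RtoC (/ L1) * v))))%C
  by ring.
eapply Rle_trans; [apply Cmod_triangle |].
pose proof (Cmod_triangle (CInt f (a + INR n * L1) (a + L))
  (RtoC (INR n) * v - RtoC L * (RtoC (/ L1) * v))).
assert (INR n * (eps / 2 * L1) <= eps / 2 * L) by nra.
lra.
Qed.

(** The averages over [[0, L]] are Cauchy because all long ones are near the same approximate mean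
    [w]. Their limit is then near [w] too, and uniformity in the position is inherited from [w]. *)
Lemma bohr_uniform_mean (f : R -> C) : bohr f -> exists m, uniform_mean f m.
Proof.
intros Hf.
assert (Hdiv : forall L w eps, 0 < L ->
  Cmod (CInt f 0 (0 + L) - RtoC L * w)%C <= eps * L ->
  Cmod (RtoC (/ L) * CInt f 0 (0 + L) - w)%C <= eps).
{ intros L w eps HL H.
  assert (E1 : (RtoC (/ L) * RtoC L = 1)%C)
    by (rewrite <- RtoC_mult, Rinv_l; [reflexivity | lra]).
  replace (RtoC (/ L) * CInt f 0 (0 + L) - w)%C
    with (RtoC (/ L) * CInt f 0 (0 + L) - (RtoC (/ L) * RtoC L) * w)%C
    by (rewrite E1; ring).
  replace (RtoC (/ L) * CInt f 0 (0 + L) - (RtoC (/ L) * RtoC L) * w)%C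
    with (RtoC (/ L) * (CInt f 0 (0 + L) - RtoC L * w))%C by ring.
  assert (0 < / L) by (apply Rinv_0_lt_compat, HL).
  rewrite Cmod_mult, Cmod_R, Rabs_pos_eq by lra.
  replace eps with (/ L * (eps * L)) by (field; lra).
  apply Rmult_le_compat_l; lra. }
destruct (proj1 (filterlim_locally_cauchy (U := C_R_CompleteNormedModule)
  (F := Rbar_locally p_infty) (fun L => RtoC (/ L) * CInt f 0 (0 + L))%C)) as [m Hm].
{ intros eps. destruct (bohr_approx_mean f (eps / 4) Hf) as (w & L0 & HL0 & Hw).
  { destruct eps; simpl; lra. }
  exists (fun L => L0 <= L). split; [exists L0; intros; lra |].
  intros u v Hu Hv.
  apply (norm_compat1 (V := C_R_NormedModule)). rewrite <- Cmod_norm.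
  pose proof (Hdiv u w _ ltac:(lra) (Hw u 0 Hu)) as H1.
  pose proof (Hdiv v w _ ltac:(lra) (Hw v 0 Hv)).
  rewrite Cmod_sub_sym in H1.
  pose proof (Cmod_sub_triangle (RtoC (/ v) * CInt f 0 (0 + v)) w
    (RtoC (/ u) * CInt f 0 (0 + u))).
  pose proof (cond_pos eps).
  apply Rle_lt_trans with (Cmod
    ((RtoC (/ v) * CInt f 0 (0 + v)) - (RtoC (/ u) * CInt f 0 (0 + u)))%C).
  { apply Rle_refl. }
  lra. }
exists m. intros eps He.
destruct (bohr_approx_mean f (eps / 4) Hf ltac:(lra)) as (w & L0 & HL0 & Hw).
exists L0. split; [exact HL0 |]. intros L a HL.
assert (Hwm : Cmod (w - m)%C <= eps / 2).
{ pose proof (proj1 (filterlim_C (Rbar_locally p_infty) _ m) Hm (eps / 4) ltac:(lra))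
    as [M HM].
  pose proof (Rmax_l M L0). pose proof (Rmax_r M L0).
  specialize (HM (Rmax M L0 + 1) ltac:(lra)).
  pose proof (Hdiv (Rmax M L0 + 1) w _ ltac:(lra) (Hw (Rmax M L0 + 1) 0 ltac:(lra))) as H1.
  rewrite Cmod_sub_sym in H1.
  pose proof (Cmod_sub_triangle w
    (RtoC (/ (Rmax M L0 + 1)) * CInt f 0 (0 + (Rmax M L0 + 1))) m). lra. }
replace (CInt f a (a + L) - RtoC L * m)%C
  with ((CInt f a (a + L) - RtoC L * w) + RtoC L * (w - m))%C by ring.
eapply Rle_trans; [apply Cmod_triangle |].
rewrite Cmod_mult, Cmod_R, Rabs_pos_eq by lra.
pose proof (Hw L a HL). nra.
Qed.

(** * Fourier coefficients of almost periodic functions *)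

Definition demod (f : R -> C) (alpha : R) (x : R) : C := (f x * cis (- alpha * x))%C.

Lemma ap_demod (f : R -> C) (alpha : R) : ap f -> ap (demod f alpha).
Proof. intros H. apply ap_mult; [exact H | apply ap_cis]. Qed.

(** [fourier] is a value chosen by [iota]; existence of the uniform mean is what makes it a limit
    and gives it properties. *)
Lemma fourier_uniform (f : R -> C) (alpha : R) : ap f ->
  uniform_mean (demod f alpha) (fourier f alpha).
Proof.
intros H. destruct (bohr_uniform_mean _ (ap_bohr _ (ap_demod f alpha H))) as [m Hm].
unfold fourier. change (fun x => (f x * cis (- alpha * x))%C) with (demod f alpha).
rewrite (uniform_mean_value _ _ Hm). exact Hm.
Qed.

Lemma fourier_unique (f : R -> C) (alpha : R) (c : C) :
  uniform_mean (demod f alpha) c -> fourier f alpha = c.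
Proof. apply uniform_mean_value. Qed.

Lemma uniform_mean_plus (f g : R -> C) (a b : C) : contC f -> contC g ->
  uniform_mean f a -> uniform_mean g b -> uniform_mean (fun x => f x + g x)%C (a + b)%C.
Proof.
intros Cf Cg Hf Hg eps He.
destruct (Hf (eps / 2) ltac:(lra)) as (L1 & HL1 & H1).
destruct (Hg (eps / 2) ltac:(lra)) as (L2 & HL2 & H2).
exists (Rmax L1 L2). split; [eapply Rlt_le_trans; [exact HL1 | apply Rmax_l] |].
intros L x HL. rewrite CInt_plus by assumption.
specialize (H1 L x (Rle_trans _ _ _ (Rmax_l _ _) HL)).
specialize (H2 L x (Rle_trans _ _ _ (Rmax_r _ _) HL)).
replace (CInt f x (x + L) + CInt g x (x + L) - RtoC L * (a + b))%C
  with ((CInt f x (x + L) - RtoC L * a) + (CInt g x (x + L) - RtoC L * b))%C by ring.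
eapply Rle_trans; [apply Cmod_triangle | lra].
Qed.

Lemma uniform_mean_scal (c : C) (f : R -> C) (a : C) : contC f ->
  uniform_mean f a -> uniform_mean (fun x => c * f x)%C (c * a)%C.
Proof.
intros Cf Hf eps He.
destruct (Rmult_bound_eps (Cmod c) eps (Cmod_ge_0 c) He) as (eta & H1 & H2).
destruct (Hf eta H1) as (L1 & HL1 & H3). exists L1. split; [exact HL1 |].
intros L x HL. rewrite CInt_scal by assumption. specialize (H3 L x HL).
replace (c * CInt f x (x + L) - RtoC L * (c * a))%C
  with (c * (CInt f x (x + L) - RtoC L * a))%C by ring.
rewrite Cmod_mult. pose proof (Cmod_ge_0 c).
apply Rle_trans with (Cmod c * (eta * L)); [apply Rmult_le_compat_l; assumption |].
nra.
Qed.

Lemma uniform_mean_ext (f g : R -> C) (a : C) : (forall x, f x = g x) ->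
  uniform_mean f a -> uniform_mean g a.
Proof.
intros E H eps He. destruct (H eps He) as (L0 & HL0 & H1). exists L0.
split; [exact HL0 |]. intros L x HL.
rewrite <- (CInt_ext f g) by (intros; apply E). auto.
Qed.

Lemma uniform_mean_cis (w : R) : w <> 0 -> uniform_mean (fun x => cis (w * x)) 0%C.
Proof.
intros Hw eps He. pose proof (Rabs_pos_lt w Hw) as Hw2.
exists (2 / (Rabs w * eps)). split; [apply Rdiv_lt_0_compat; nra |]. intros L a HL.
replace (CInt (fun x => cis (w * x)) a (a + L) - RtoC L * 0)%C
  with (CInt (fun x => cis (w * x)) a (a + L)) by ring.
apply (Rmult_le_reg_l (Rabs w)); [exact Hw2 |].
assert (E : Rabs w * Cmod (CInt (fun x => cis (w * x)) a (a + L))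
  = Cmod (cis (w * (a + L)) - cis (w * a))%C).
{ rewrite <- CInt_cis, !Cmod_mult, Cmod_Ci, Cmod_R. ring. }
rewrite E.
assert (2 <= Rabs w * (eps * L)).
{ apply (Rmult_le_compat_r (Rabs w * eps)) in HL; [| nra].
  unfold Rdiv in HL. rewrite Rmult_assoc, Rinv_l in HL; [lra |].
  apply Rgt_not_eq. nra. }
pose proof (Cmod_triangle (cis (w * (a + L))) (- cis (w * a))) as H2.
rewrite Cmod_opp, !Cmod_cis in H2. unfold Cminus. lra.
Qed.

Lemma uniform_mean_const (c : C) : uniform_mean (fun _ => c) c.
Proof.
intros eps He. exists 1. split; [lra |]. intros L a HL. rewrite CInt_const.
replace (a + L - a) with L by ring.
replace (RtoC L * c - RtoC L * c)%C with (RtoC 0) by ring. rewrite Cmod_0. nra.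
Qed.

Lemma fourier_ext (f g : R -> C) (alpha : R) : (forall x, f x = g x) ->
  fourier f alpha = fourier g alpha.
Proof.
intros E. replace g with f; [reflexivity |].
apply functional_extensionality. exact E.
Qed.

Lemma fourier_plus (f g : R -> C) (alpha : R) : ap f -> ap g ->
  fourier (fun x => f x + g x)%C alpha = (fourier f alpha + fourier g alpha)%C.
Proof.
intros Hf Hg. apply fourier_unique.
apply (uniform_mean_ext (fun x => demod f alpha x + demod g alpha x)%C).
- intros x. unfold demod. ring.
- apply uniform_mean_plus; try apply ap_demod; try apply fourier_uniform; assumption.
Qed.

Lemma fourier_scal (c : C) (f : R -> C) (alpha : R) : ap f ->
  fourier (fun x => c * f x)%C alpha = (c * fourier f alpha)%C.
Proof.
intros Hf. apply fourier_unique.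
apply (uniform_mean_ext (fun x => c * demod f alpha x)%C).
- intros x. unfold demod. ring.
- apply uniform_mean_scal; try apply ap_demod; try apply fourier_uniform; assumption.
Qed.

Lemma fourier_minus (f g : R -> C) (alpha : R) : ap f -> ap g ->
  fourier (fun x => f x - g x)%C alpha = (fourier f alpha - fourier g alpha)%C.
Proof.
intros Hf Hg.
rewrite (fourier_ext _ (fun x => f x + (-1) * g x)%C) by (intros x; ring).
rewrite fourier_plus, fourier_scal; [ring | | |]; try assumption. apply ap_scal, Hg.
Qed.

Lemma fourier_cis_same (alpha : R) : fourier (fun x => cis (alpha * x)) alpha = 1%C.
Proof.
apply fourier_unique. apply (uniform_mean_ext (fun _ => 1%C)).
- intros x. unfold demod. rewrite <- cis_plus.
  replace (alpha * x + - alpha * x) with 0 by ring. symmetry. apply cis_0.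
- apply uniform_mean_const.
Qed.

Lemma fourier_cis_diff (alpha beta : R) : alpha <> beta ->
  fourier (fun x => cis (alpha * x)) beta = 0%C.
Proof.
intros H. apply fourier_unique.
apply (uniform_mean_ext (fun x => cis ((alpha - beta) * x))).
- intros x. unfold demod. rewrite <- cis_plus. f_equal. ring.
- apply uniform_mean_cis. lra.
Qed.

(** Applied to differences, this lets coefficients pass to uniform limits. *)
Lemma fourier_bound (f : R -> C) (alpha B : R) : ap f ->
  (forall x, Cmod (f x) <= B) -> Cmod (fourier f alpha) <= B.
Proof.
intros Hf HB. apply le_epsilon. intros eps He.
destruct (fourier_uniform f alpha Hf eps He) as (L & HL & H).
specialize (H L 0 (Rle_refl _)).
assert (H1 : Cmod (CInt (demod f alpha) 0 (0 + L)) <= L * B).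
{ replace (L * B) with ((0 + L - 0) * B) by ring. apply CInt_bound; [| lra |].
  - apply ap_demod, Hf.
  - intros x _. unfold demod. rewrite Cmod_mult, Cmod_cis, Rmult_1_r. apply HB. }
pose proof (Cmod_le_add (RtoC L * fourier f alpha) (CInt (demod f alpha) 0 (0 + L))) as H2.
rewrite Cmod_sub_sym, Cmod_mult, Cmod_R, Rabs_pos_eq in H2 by lra.
apply (Rmult_le_reg_l L); lra.
Qed.

(** * Autocorrelations of finite sequences *)

Fixpoint csum (n : nat) (f : nat -> C) : C :=
  match n with O => 0%C | S m => (csum m f + f m)%C end.

Fixpoint rsum (n : nat) (f : nat -> R) : R :=
  match n with O => 0 | S m => rsum m f + f m end.

Lemma csum_ext (n : nat) (f g : nat -> C) :
  (forall i, (i < n)%nat -> f i = g i) -> csum n f = csum n g.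
Proof.
intros H. induction n as [| n IH]; [reflexivity |]. simpl.
rewrite IH by (intros; apply H; lia). rewrite H by lia. reflexivity.
Qed.

Lemma csum_scal (n : nat) (c : C) (f : nat -> C) :
  csum n (fun i => c * f i)%C = (c * csum n f)%C.
Proof. induction n as [| n IH]; simpl; [ring | rewrite IH; ring]. Qed.

Lemma csum_scal_r (n : nat) (c : C) (f : nat -> C) :
  csum n (fun i => f i * c)%C = (csum n f * c)%C.
Proof. induction n as [| n IH]; simpl; [ring | rewrite IH; ring]. Qed.

Lemma csum_plus (n : nat) (f g : nat -> C) :
  csum n (fun i => f i + g i)%C = (csum n f + csum n g)%C.
Proof. induction n as [| n IH]; simpl; [ring | rewrite IH; ring]. Qed.

Lemma csum_0 (n : nat) : csum n (fun _ => 0%C) = 0%C.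
Proof. induction n as [| n IH]; simpl; [reflexivity | rewrite IH; ring]. Qed.

Lemma csum_swap (n m : nat) (f : nat -> nat -> C) :
  csum n (fun i => csum m (f i)) = csum m (fun j => csum n (fun i => f i j)).
Proof.
induction n as [| n IH]; simpl; [symmetry; apply csum_0 |].
rewrite IH, <- csum_plus. reflexivity.
Qed.

Lemma csum_conj (n : nat) (f : nat -> C) :
  Cconj (csum n f) = csum n (fun i => Cconj (f i)).
Proof.
induction n as [| n IH]; simpl.
- unfold Cconj, RtoC; simpl. f_equal. ring.
- rewrite <- IH. unfold Cconj, Cplus; simpl. f_equal. ring.
Qed.

Lemma csum_single (n k : nat) (f : nat -> C) :
  csum n (fun i => if Nat.eq_dec k i then f i else 0%C)
  = if lt_dec k n then f k else 0%C.
Proof.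
induction n as [| n IH]; simpl; [reflexivity |]. rewrite IH.
destruct (lt_dec k n), (Nat.eq_dec k n), (lt_dec k (S n)); try lia; subst; ring.
Qed.

Lemma rsum_le (n : nat) (f g : nat -> R) :
  (forall i, (i < n)%nat -> f i <= g i) -> rsum n f <= rsum n g.
Proof.
intros H. induction n as [| n IH]; simpl; [lra |].
pose proof (IH (fun i Hi => H i ltac:(lia))). pose proof (H n ltac:(lia)). lra.
Qed.

Lemma rsum_ext (n : nat) (f g : nat -> R) :
  (forall i, (i < n)%nat -> f i = g i) -> rsum n f = rsum n g.
Proof.
intros H. induction n as [| n IH]; [reflexivity |]. simpl.
rewrite IH by (intros; apply H; lia). rewrite H by lia. reflexivity.
Qed.

Lemma rsum_plus (n : nat) (f g : nat -> R) :
  rsum n (fun i => f i + g i) = rsum n f + rsum n g.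
Proof. induction n as [| n IH]; simpl; [ring | rewrite IH; ring]. Qed.

Lemma rsum_scal (n : nat) (c : R) (f : nat -> R) :
  rsum n (fun i => c * f i) = c * rsum n f.
Proof. induction n as [| n IH]; simpl; [ring | rewrite IH; ring]. Qed.

Lemma rsum_const (n : nat) (c : R) : rsum n (fun _ => c) = INR n * c.
Proof.
induction n as [| n IH]; [simpl; ring |]. rewrite S_INR. simpl rsum. rewrite IH. ring.
Qed.

Lemma rsum_ge_0 (n : nat) (f : nat -> R) :
  (forall i, (i < n)%nat -> 0 <= f i) -> 0 <= rsum n f.
Proof.
intros H. pose proof (rsum_le n (fun _ => 0) f H) as H1. rewrite rsum_const in H1. lra.
Qed.

Lemma rsum_S_left (n : nat) (f : nat -> R) :
  rsum (S n) f = f O + rsum n (fun i => f (S i)).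
Proof. induction n as [| n IH]; simpl in *; [ring | rewrite IH; ring]. Qed.

Lemma rsum_le_length (n m : nat) (f : nat -> R) : (n <= m)%nat ->
  (forall i, 0 <= f i) -> rsum n f <= rsum m f.
Proof.
intros H Hf. induction H as [| m H IH]; [lra |]. simpl. pose proof (Hf m). lra.
Qed.

Lemma rsum_truncate (n m : nat) (f : nat -> R) : (n <= m)%nat ->
  rsum m (fun i => if lt_dec i n then f i else 0) = rsum n f.
Proof.
intros H. induction H as [| m H IH].
- assert (E : forall k, (k <= n)%nat ->
    rsum k (fun i => if lt_dec i n then f i else 0) = rsum k f).
  { induction k as [| k IH]; intros Hk; simpl; [reflexivity |].
    rewrite IH by lia. destruct (lt_dec k n); [reflexivity | lia]. }
  apply E. lia.
- simpl. rewrite IH. destruct (lt_dec m n); [lia | ring].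
Qed.

Lemma Cmod_csum (n : nat) (f : nat -> C) : Cmod (csum n f) <= rsum n (fun i => Cmod (f i)).
Proof.
induction n as [| n IH]; simpl; [rewrite Cmod_0; lra |].
eapply Rle_trans; [apply Cmod_triangle | lra].
Qed.

Lemma csum_RtoC (n : nat) (f : nat -> R) :
  csum n (fun i => RtoC (f i)) = RtoC (rsum n f).
Proof. induction n as [| n IH]; simpl; [reflexivity | rewrite IH, RtoC_plus; reflexivity]. Qed.

Lemma Re_csum (n : nat) (f : nat -> C) : Re (csum n f) = rsum n (fun i => Re (f i)).
Proof. induction n as [| n IH]; simpl; [reflexivity | rewrite <- IH; reflexivity]. Qed.

(** * Orthogonality and Parseval at equally spaced nodes *)

Definition dft_node (M n : nat) : R := 2 * PI * INR n / INR M - PI.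

Definition dft_mean (M : nat) (phi : R -> C) : C :=
  (RtoC (/ INR M) * csum M (fun n => phi (dft_node M n)))%C.

(** The shift by [PI] in the nodes is made for this: exponential sums are controlled for angles in
    [[-PI, PI]] only. *)
Lemma dft_node_bound (M n : nat) : (n < M)%nat -> - PI <= dft_node M n <= PI.
Proof.
intros H. unfold dft_node. pose proof PI_RGT_0 as Hpi.
assert (HM : 0 < INR M) by (apply lt_0_INR; lia).
assert (H1 : 0 <= INR n / INR M <= 1).
{ split; [apply Rdiv_le_0_compat; [apply pos_INR | exact HM] |].
  apply Rle_div_l; [exact HM |]. rewrite Rmult_1_l. apply le_INR. lia. }
replace (2 * PI * INR n / INR M) with (2 * PI * (INR n / INR M)) by (field; lra).
nra.
Qed.

Lemma geometric_csum (z : C) (n : nat) :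
  ((z - 1) * csum n (fun i => z ^ i) = z ^ n - 1)%C.
Proof. induction n as [| n IH]; simpl; [ring |]. rewrite Cmult_plus_distr_l, IH. ring. Qed.

(** A geometric sum over the roots of unity. The bound on [k] excludes aliasing: a nonzero multiple
    of [M] would also have mean of modulus one. The shift of the nodes contributes only a constant
    phase. *)
Lemma dft_mean_cis (M : nat) (k : Z) : (Z.abs k < Z.of_nat M)%Z ->
  dft_mean M (fun t => cis (IZR k * t)) = if Z.eq_dec k 0 then 1%C else 0%C.
Proof.
intros Hk. pose proof PI_RGT_0 as Hpi. unfold dft_mean.
assert (HM : 0 < INR M) by (apply lt_0_INR; lia).
destruct (Z.eq_dec k 0) as [-> | Hk0].
- rewrite (csum_ext M _ (fun _ => RtoC 1)).
  2:{ intros i _. rewrite Rmult_0_l. apply cis_0. }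
  rewrite csum_RtoC, rsum_const, <- RtoC_mult. f_equal. field. lra.
- set (z := cis (2 * PI * IZR k / INR M)).
  rewrite (csum_ext M _ (fun i => cis (- (IZR k * PI)) * z ^ i)%C).
  2:{ intros i _. unfold z. rewrite cis_pow, <- cis_plus. f_equal. unfold dft_node.
      field. lra. }
  rewrite (csum_scal M _ (fun i => z ^ i)%C).
  assert (Hz : z <> 1%C).
  { unfold z. destruct (Z_lt_le_dec 0 k) as [Hp | Hp].
    - apply cis_neq_1.
      assert (0 < IZR k < INR M).
      { rewrite INR_IZR_INZ. split; apply IZR_lt; lia. }
      split; [apply Rdiv_lt_0_compat; nra |].
      apply Rlt_div_l; [exact HM |]. nra.
    (* Negative frequencies reduce to positive ones by conjugation. *)
    - intros H. apply (f_equal Cconj) in H. rewrite cis_conj in H.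
      apply (cis_neq_1 (2 * PI * IZR (- k) / INR M)).
      + assert (0 < IZR (- k) < INR M).
        { rewrite INR_IZR_INZ. split; apply IZR_lt; lia. }
        split; [apply Rdiv_lt_0_compat; nra |].
        apply Rlt_div_l; [exact HM |]. nra.
      + replace (2 * PI * IZR (- k) / INR M) with (- (2 * PI * IZR k / INR M))
          by (rewrite opp_IZR; field; lra).
        rewrite H. unfold Cconj, RtoC; simpl. f_equal. ring. }
  assert (HzM : (z ^ M = 1)%C).
  { unfold z. rewrite cis_pow.
    replace (2 * PI * IZR k / INR M * INR M) with (2 * PI * IZR k) by (field; lra).
    apply cis_2PI_Z. }
  assert (Hs : csum M (fun i => z ^ i)%C = 0%C).
  { pose proof (geometric_csum z M) as G. rewrite HzM in G.
    replace (1 - 1)%C with (RtoC 0) in G by ring.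
    destruct (Ceq_dec (csum M (fun i => z ^ i)%C) 0%C) as [E | E]; [exact E |].
    exfalso. refine (Cmult_neq_0 _ _ _ E G). intros E1. apply Hz.
    apply (proj2 (Ceq_minus z 1%C)). exact E1. }
  rewrite Hs. ring.
Qed.

Lemma dft_mean_ext (M : nat) (f g : R -> C) : (forall t, f t = g t) ->
  dft_mean M f = dft_mean M g.
Proof. intros H. unfold dft_mean. f_equal. apply csum_ext. intros; apply H. Qed.

Lemma dft_mean_csum (M n : nat) (f : nat -> R -> C) :
  dft_mean M (fun t => csum n (fun i => f i t)) = csum n (fun i => dft_mean M (f i)).
Proof. unfold dft_mean. rewrite csum_swap, csum_scal. reflexivity. Qed.

Lemma dft_mean_scal (M : nat) (c : C) (f : R -> C) :
  dft_mean M (fun t => c * f t)%C = (c * dft_mean M f)%C.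
Proof. unfold dft_mean. rewrite csum_scal. ring. Qed.

Definition trig_sum (N : nat) (a : nat -> C) (t : R) : C :=
  csum N (fun j => a j * cis (INR j * t))%C.

Lemma trig_sum_conj (N : nat) (a : nat -> C) (t : R) :
  Cconj (trig_sum N a t) = csum N (fun j => Cconj (a j) * cis (- (INR j) * t))%C.
Proof.
unfold trig_sum. rewrite csum_conj. apply csum_ext. intros i _.
rewrite Cmult_conj, cis_conj. repeat f_equal. ring.
Qed.

Lemma Cmod2_RtoC (z : C) : RtoC (Cmod z ^ 2) = (z * Cconj z)%C.
Proof. rewrite <- Cmod2_conj. reflexivity. Qed.

(** In the expanded square the frequencies [i - j] are smaller than [M] in absolute value, so only
    the diagonal survives averaging. *)
Lemma dft_parseval (M N : nat) (a : nat -> C) : (N <= M)%nat ->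
  / INR M * rsum M (fun n => Cmod (trig_sum N a (dft_node M n)) ^ 2)
  = rsum N (fun j => Cmod (a j) ^ 2).
Proof.
intros HNM. apply RtoC_inj. rewrite RtoC_mult, <- !csum_RtoC.
rewrite (csum_ext M _ (fun n => (fun t =>
   csum N (fun i => csum N (fun j => (a i * Cconj (a j)) *
     cis (IZR (Z.of_nat i - Z.of_nat j) * t))))%C (dft_node M n))).
2:{ intros n _. rewrite Cmod2_RtoC, trig_sum_conj. unfold trig_sum.
    rewrite <- csum_scal_r. apply csum_ext. intros i _.
    rewrite <- csum_scal. apply csum_ext. intros j _.
    rewrite minus_IZR, <- !INR_IZR_INZ.
    replace ((INR i - INR j) * dft_node M n)
      with (INR i * dft_node M n + - INR j * dft_node M n) by ring.
    rewrite cis_plus. ring. }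
change (dft_mean M (fun t => csum N (fun i => csum N (fun j => (a i * Cconj (a j)) *
     cis (IZR (Z.of_nat i - Z.of_nat j) * t))%C))
   = csum N (fun j => RtoC (Cmod (a j) ^ 2))).
rewrite dft_mean_csum. apply csum_ext. intros i Hi.
rewrite dft_mean_csum.
rewrite (csum_ext N _ (fun j => if Nat.eq_dec i j then (a i * Cconj (a j))%C else 0%C)).
- rewrite csum_single. destruct (lt_dec i N); [| lia]. rewrite Cmod2_RtoC. reflexivity.
- intros j Hj. rewrite dft_mean_scal, dft_mean_cis by lia.
  destruct (Nat.eq_dec i j), (Z.eq_dec (Z.of_nat i - Z.of_nat j) 0); try lia; ring.
Qed.

Definition autocorr (N : nat) (a : nat -> C) (t : nat) : C :=
  csum N (fun j => if lt_dec (t + j) N then (a (t + j)%nat * Cconj (a j))%C else 0%C).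

(** With [P = conj (trig_sum N (conj a))] and [Q] the trigonometric sum of the
    conjugated autocorrelations, [sum |r_t|^2] is the mean of [Q |P|^2], so
    [|Q| |P| m <= (|Q|^2 + m^2 |P|^2) / 2] and Parseval give the bound. *)
Lemma autocorr_bound (N : nat) (a : nat -> C) (m : R) : 0 <= m ->
  (forall t, - PI <= t <= PI ->
     Cmod (csum N (fun j => a j * cis (- (INR j) * t))%C) <= m) ->
  rsum N (fun t => Cmod (autocorr N a t) ^ 2) <= m ^ 2 * rsum N (fun j => Cmod (a j) ^ 2).
Proof.
intros Hm HP.
destruct (Nat.eq_dec N 0) as [-> | HN]; [simpl; lra |].
(* The frequencies [s + j - i] lie between [-(N - 1)] and [2 N - 2]; with [2 N] nodes none is
   aliased to zero, so the cyclic average sees the correlation without wrap-around. *)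
set (M := (2 * N)%nat).
set (b := fun j => Cconj (a j)).
set (r := fun t => Cconj (autocorr N a t)).
assert (HbP : forall t, Cconj (trig_sum N b t) = csum N (fun j => a j * cis (- (INR j) * t))%C).
{ intros t. rewrite trig_sum_conj. apply csum_ext. intros j _. unfold b.
  rewrite Cconj_conj. reflexivity. }
assert (HMpos : 0 < INR M) by (apply lt_0_INR; unfold M; lia).
assert (Hid : dft_mean M (fun t => trig_sum N r t *
    (Cconj (trig_sum N b t) * trig_sum N b t))%C
  = RtoC (rsum N (fun t => Cmod (autocorr N a t) ^ 2))).
{ rewrite (dft_mean_ext M _ (fun t => csum N (fun s => csum N (fun j => csum N (fun i =>
     (r s * a i * b j) * cis (IZR (Z.of_nat s + Z.of_nat j - Z.of_nat i) * t)))))%C).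
  2:{ intros t. rewrite HbP. unfold trig_sum at 1. rewrite <- csum_scal_r.
      apply csum_ext. intros s _. rewrite Cmult_assoc, Cmult_comm.
      unfold trig_sum. rewrite <- csum_scal_r. apply csum_ext. intros j _.
      rewrite <- csum_scal, <- csum_scal. apply csum_ext. intros i _.
      rewrite minus_IZR, plus_IZR, <- !INR_IZR_INZ.
      replace ((INR s + INR j - INR i) * t)
        with ((INR s * t + INR j * t) + - INR i * t) by ring.
      rewrite !cis_plus. ring. }
  rewrite dft_mean_csum, <- csum_RtoC. apply csum_ext. intros s Hs.
  rewrite dft_mean_csum. rewrite Cmod2_RtoC, Cmult_comm.
  change (Cconj (autocorr N a s)) with (r s).
  unfold autocorr. rewrite <- csum_scal. apply csum_ext. intros j Hj.
  rewrite dft_mean_csum.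
  rewrite (csum_ext N _ (fun i => if Nat.eq_dec (s + j) i then (r s * a i * b j)%C else 0%C)).
  - rewrite csum_single. destruct (lt_dec (s + j) N); unfold b; ring.
  - intros i Hi. rewrite dft_mean_scal, dft_mean_cis by (unfold M; lia).
    destruct (Nat.eq_dec (s + j) i), (Z.eq_dec (Z.of_nat s + Z.of_nat j - Z.of_nat i) 0);
      try lia; ring. }
assert (Hrho : 0 <= rsum N (fun t => Cmod (autocorr N a t) ^ 2)).
{ apply rsum_ge_0. intros i _. apply pow2_ge_0. }
pose proof (dft_parseval M N r ltac:(unfold M; lia)) as HQ.
pose proof (dft_parseval M N b ltac:(unfold M; lia)) as HB.
set (rho := rsum N (fun t => Cmod (autocorr N a t) ^ 2)) in *.
assert (Er : rsum N (fun j => Cmod (r j) ^ 2) = rho).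
{ apply rsum_ext. intros i _. unfold r. rewrite Cmod_conj. reflexivity. }
assert (Eb : rsum N (fun j => Cmod (b j) ^ 2) = rsum N (fun j => Cmod (a j) ^ 2)).
{ apply rsum_ext. intros i _. unfold b. rewrite Cmod_conj. reflexivity. }
rewrite Er in HQ. rewrite Eb in HB.
assert (Hle : rho <= / INR M * rsum M (fun n =>
   / 2 * Cmod (trig_sum N r (dft_node M n)) ^ 2
   + / 2 * m ^ 2 * Cmod (trig_sum N b (dft_node M n)) ^ 2)).
{ rewrite <- (Rabs_pos_eq rho Hrho), <- Cmod_R, <- Hid. unfold dft_mean.
  rewrite Cmod_mult, Cmod_R, Rabs_pos_eq by (apply Rlt_le, Rinv_0_lt_compat, HMpos).
  apply Rmult_le_compat_l; [apply Rlt_le, Rinv_0_lt_compat, HMpos |].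
  eapply Rle_trans; [apply Cmod_csum |]. apply rsum_le. intros n Hn.
  rewrite !Cmod_mult.
  pose proof (HP _ (dft_node_bound M n Hn)) as H1. rewrite <- HbP in H1.
  set (q := Cmod (trig_sum N r (dft_node M n))).
  rewrite Cmod_conj in *.
  set (p := Cmod (trig_sum N b (dft_node M n))) in *.
  assert (0 <= q) by apply Cmod_ge_0. assert (0 <= p) by apply Cmod_ge_0.
  assert (q * (p * p) <= q * (m * p)) by (apply Rmult_le_compat_l; nra).
  pose proof (pow2_ge_0 (q - m * p)). nra. }
rewrite rsum_plus, !rsum_scal in Hle.
rewrite Rmult_plus_distr_l in Hle.
replace (/ INR M * (/ 2 * rsum M (fun i => Cmod (trig_sum N r (dft_node M i)) ^ 2)))
  with (/ 2 * rho) in Hle by (rewrite <- HQ; ring).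
replace (/ INR M * (/ 2 * m ^ 2 * rsum M (fun i => Cmod (trig_sum N b (dft_node M i)) ^ 2)))
  with (/ 2 * m ^ 2 * rsum N (fun j => Cmod (a j) ^ 2)) in Hle by (rewrite <- HB; ring).
lra.
Qed.

(** * Counting almost-periods on an arithmetic progression *)

Definition indicator (P : Prop) : R := if excluded_middle_informative P then 1 else 0.

Lemma indicator_bound (P : Prop) : 0 <= indicator P <= 1.
Proof. unfold indicator. destruct (excluded_middle_informative P); lra. Qed.

Lemma indicator_true (P : Prop) : P -> indicator P = 1.
Proof. intros H. unfold indicator. destruct (excluded_middle_informative P); [reflexivity | tauto]. Qed.

Lemma indicator_false (P : Prop) : ~ P -> indicator P = 0.
Proof. intros H. unfold indicator. destruct (excluded_middle_informative P); [tauto | reflexivity]. Qed.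

Lemma indicator_le (P Q : Prop) : (P -> Q) -> indicator P <= indicator Q.
Proof.
intros H. unfold indicator.
destruct (excluded_middle_informative P), (excluded_middle_informative Q);
  (lra || (exfalso; auto)).
Qed.

(** Subtracting the first element of [D] sends the rest of [D], and that element itself, injectively
    into [G], without leaving the range of counting. *)
Lemma count_differences (K : nat) (D G : nat -> Prop) :
  (forall s t, D s -> D (s + t)%nat -> G t) ->
  rsum K (fun t => indicator (D t)) <= rsum K (fun t => indicator (G t)).
Proof.
revert D. induction K as [| K IH]; intros D H; [simpl; lra |].
destruct (classic (D O)) as [H0 | H0].
- apply rsum_le. intros t _. apply indicator_le. intros Ht. apply (H O t H0 Ht).
(* With [0] absent from [D], the set moves one step to the left and the range shrinks by one; the
   differences are unchanged. *)
- rewrite rsum_S_left, indicator_false, Rplus_0_l by exact H0.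
  eapply Rle_trans.
  + apply (IH (fun t => D (S t))). intros s t H1 H2. apply (H (S s) t H1 H2).
  + simpl. pose proof (indicator_bound (G K)). lra.
Qed.

(** A union bound, by removing from [E] the class of one list entry at a time. *)
Lemma count_cover {A : Type} (K : nat) (X : R) (D : A -> nat -> Prop) (l : list A) :
  (forall b, rsum K (fun t => indicator (D b t)) <= X) ->
  forall E : nat -> Prop, (forall t, E t -> exists b, In b l /\ D b t) ->
  rsum K (fun t => indicator (E t)) <= INR (length l) * X.
Proof.
intros HX. induction l as [| c l IH]; intros E HE.
- rewrite Rmult_0_l. apply Rle_trans with (rsum K (fun _ => 0)).
  + apply rsum_le. intros t _. rewrite indicator_false; [lra |].
    intros Ht. destruct (HE t Ht) as (b & [] & _).
  + rewrite rsum_const. lra.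
- change (length (c :: l)) with (S (length l)). rewrite S_INR.
  specialize (IH (fun t => E t /\ ~ D c t)).
  assert (H1 : rsum K (fun t => indicator (E t)) <=
     rsum K (fun t => indicator (D c t) + indicator (E t /\ ~ D c t))).
  { apply rsum_le. intros t _. unfold indicator.
    destruct (excluded_middle_informative (E t)), (excluded_middle_informative (D c t)),
      (excluded_middle_informative (E t /\ ~ D c t)); (lra || (exfalso; tauto)). }
  rewrite rsum_plus in H1. specialize (HX c).
  assert (H2 : rsum K (fun t => indicator (E t /\ ~ D c t)) <= INR (length l) * X).
  { apply IH. intros t [Ht Hn]. destruct (HE t Ht) as (b & [-> | Hb] & Hd); [tauto |].
    exists b. tauto. }
  lra.
Qed.

Definition almost_period (f : R -> C) (eps s : R) : Prop :=
  forall x, Cmod (f (x + s)%R - f x)%C <= eps.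

(** The density bound [1 / n] does not depend on the mesh [d]. *)
Lemma almost_period_density (f : R -> C) (eps : R) : ap f -> 0 < eps ->
  exists n, 1 <= n /\ forall d K,
    INR K <= n * rsum K (fun t => indicator (almost_period f eps (INR t * d))).
Proof.
intros [_ Hf] He. destruct (Hf (eps / 2) ltac:(lra)) as [l Hl].
exists (INR (length l) + 1). split; [pose proof (pos_INR (length l)); lra |].
intros d K.
(* Times are classified by the representative [b] of their translate. Two times in one class differ
   by an almost-period, so no class is more numerous than the almost-periods, and the classes cover
   all times. *)
pose (D := fun b (t : nat) => forall x, Cmod (f (x + INR t * d)%R - f (x + b)%R)%C <= eps / 2).
set (X := rsum K (fun t => indicator (almost_period f eps (INR t * d)))).
assert (HD : forall b, rsum K (fun t => indicator (D b t)) <= X).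
{ intros b. apply count_differences. intros s t Hs Ht x.
  specialize (Hs (x - INR s * d)). specialize (Ht (x - INR s * d)).
  rewrite plus_INR in Ht.
  replace (x - INR s * d + (INR s + INR t) * d) with (x + INR t * d) in Ht by ring.
  replace (x - INR s * d + INR s * d) with x in Hs by ring.
  rewrite Cmod_sub_sym in Hs.
  pose proof (Cmod_sub_triangle (f (x + INR t * d)) (f (x - INR s * d + b)) (f x)). lra. }
pose proof (count_cover K X D l HD (fun _ => True) (fun t _ => Hl (INR t * d))) as H.
assert (HX : 0 <= X) by (apply rsum_ge_0; intros; apply indicator_bound).
rewrite (rsum_ext K _ (fun _ => 1)), rsum_const in H.
- lra.
- intros t _. apply indicator_true. exact I.
Qed.

(** * Uniqueness of Fourier expansions *)

(** A block length good for [lam0] remains good for nearby [lam], since over one block the phase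
    drifts by at most [|lam - lam0| * L1]. Compactness of the frequency range then gives a common
    length. *)
Lemma demod_uniformly_small (f : R -> C) (kappa Lam : R) : ap f ->
  (forall alpha, fourier f alpha = 0%C) -> 0 < kappa ->
  exists L0, 0 < L0 /\ forall L a lam, L0 <= L -> - Lam <= lam <= Lam ->
    Cmod (CInt (demod f lam) a (a + L)) <= kappa * L.
Proof.
intros Hf H0 Hk. destruct (ap_bounded f Hf) as (B & HB & HfB).
assert (Hdc : forall lam, contC (demod f lam)) by (intros; apply ap_demod, Hf).
assert (HdB : forall lam x, Cmod (demod f lam x) <= B).
{ intros lam x. unfold demod. rewrite Cmod_mult, Cmod_cis, Rmult_1_r. apply HfB. }
destruct (compact_uniform (- Lam) Lam (fun lam L0 => 0 < L0 /\ forall L a, L0 <= L ->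
    Cmod (CInt (demod f lam) a (a + L)) <= kappa * L)) as [L0 HL0].
- intros t C C' HC [H1 H2]. split; [lra |]. intros L a HL. apply H2. lra.
- intros lam0 _.
  destruct (fourier_uniform f lam0 Hf (kappa / 4) ltac:(lra)) as (L1 & HL1 & HI).
  rewrite H0 in HI.
  assert (HLB : 0 < 4 * L1 * B) by nra.
  (* The radius limits the phase drift to a cost of [kappa / 4] per unit length; the length makes
     the incomplete last block cost at most [kappa / 2 * L]. *)
  exists (kappa / (4 * L1 * B)), (2 * B * L1 / kappa).
  split; [apply Rdiv_lt_0_compat; lra |]. intros lam _ Hlam.
  split; [apply Rdiv_lt_0_compat; nra |]. intros L a HL.
  assert (HLk : 2 * B * L1 <= kappa * L).
  { apply (Rmult_le_compat_r kappa) in HL; [| lra].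
    unfold Rdiv in HL. rewrite Rmult_assoc, Rinv_l in HL; lra. }
  assert (HLpos : 0 <= L).
  { eapply Rle_trans; [| exact HL]. apply Rdiv_le_0_compat; [nra | lra]. }
  assert (Hblock : forall b, Cmod (CInt (demod f lam) b (b + L1) - 0)%C <= kappa / 2 * L1).
  { intros b. specialize (HI L1 b (Rle_refl _)).
    (* The offset phase is frozen at the start [b] of the block: [x] itself is unbounded, whereas
       [x - b] is at most [L1], and a constant factor of modulus one leaves the integral as small as
       before. *)
    set (w := cis (- (lam - lam0) * b)).
    assert (Hd : Cmod (CInt (demod f lam) b (b + L1)
       - CInt (fun x => w * demod f lam0 x)%C b (b + L1))%C <= (b + L1 - b) * (kappa / 4)).
    { rewrite <- CInt_minus.
      2: apply Hdc. 2: apply (contC_mult (fun _ => w)); [apply contC_const | apply Hdc].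
      apply CInt_bound; [| lra |].
      - intros x. apply (continuous_minus (V := C_R_NormedModule) (demod f lam)).
        + apply Hdc.
        + apply (contC_mult (fun _ => w)); [apply contC_const | apply Hdc].
      - intros x Hx. unfold demod, w.
        replace (- lam * x) with (- lam0 * x + - (lam - lam0) * x) by ring.
        rewrite cis_plus.
        replace (f x * (cis (- lam0 * x) * cis (- (lam - lam0) * x))
           - cis (- (lam - lam0) * b) * (f x * cis (- lam0 * x)))%C
          with (f x * cis (- lam0 * x) *
            (cis (- (lam - lam0) * x) - cis (- (lam - lam0) * b)))%C by ring.
        rewrite !Cmod_mult, Cmod_cis, Rmult_1_r.
        pose proof (cis_lip (- (lam - lam0) * b) (- (lam - lam0) * x)) as Hl.
        replace (- (lam - lam0) * x - - (lam - lam0) * b) with (- (lam - lam0) * (x - b))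
          in Hl by ring.
        rewrite Rabs_mult, Rabs_Ropp, (Rabs_pos_eq (x - b)) in Hl by lra.
        apply Rle_trans with (B * (kappa / (4 * L1 * B) * L1)).
        + apply Rmult_le_compat; try apply Cmod_ge_0; [apply HfB |].
          eapply Rle_trans; [exact Hl |].
          apply Rmult_le_compat; [apply Rabs_pos | lra | lra | lra].
        + right. field. lra. }
    rewrite (CInt_scal w (demod f lam0)) in Hd by apply Hdc.
    replace (CInt (demod f lam0) b (b + L1) - RtoC L1 * 0)%C
      with (CInt (demod f lam0) b (b + L1)) in HI by ring.
    replace (CInt (demod f lam) b (b + L1) - 0)%C
      with (CInt (demod f lam) b (b + L1)) by ring.
    pose proof (Cmod_le_add (CInt (demod f lam) b (b + L1))
       (w * CInt (demod f lam0) b (b + L1))) as H2.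
    rewrite Cmod_mult in H2. unfold w in H2 at 1. rewrite Cmod_cis in H2. lra. }
  destruct (nfloor_ex (L / L1)) as [n Hn].
  { apply Rdiv_le_0_compat; lra. }
  assert (EL : L = L / L1 * L1) by (field; lra).
  assert (Hn2 : 0 <= L - INR n * L1 <= L1).
  { generalize dependent (L / L1). intros q Hq ->. nra. }
  pose proof (CInt_blocks (demod f lam) L1 _ 0%C (Hdc lam) Hblock n a) as Hb.
  replace (CInt (demod f lam) a (a + INR n * L1) - RtoC (INR n) * 0)%C
    with (CInt (demod f lam) a (a + INR n * L1)) in Hb by ring.
  rewrite (CInt_Chasles _ a (a + INR n * L1) (a + L) (Hdc lam)).
  eapply Rle_trans; [apply Cmod_triangle |].
  assert (H2 : Cmod (CInt (demod f lam) (a + INR n * L1) (a + L)) <= L1 * B).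
  { eapply Rle_trans; [apply (CInt_bound_all _ _ _ B (Hdc lam) (HdB lam)) |].
    apply Rmult_le_compat_r; [lra |]. apply Rabs_le. lra. }
  assert (INR n * (kappa / 2 * L1) <= kappa / 2 * L) by nra.
  lra.
(* For negative [Lam] the frequency range is empty and nothing is known of the sign of [L0]. *)
- exists (Rmax L0 1). split.
  + eapply Rlt_le_trans; [| apply Rmax_r]. lra.
  + intros L a lam HL Hlam. apply (HL0 lam Hlam).
    eapply Rle_trans; [apply Rmax_l | exact HL].
Qed.

(** The modulus is [2 |sin (theta / 2)|]. For [0 <= y <= 2] the cubic Taylor bound
    [y - y^3 / 6 <= sin y] gives [sin y >= y / 3], applied to half of the angle. *)
Lemma cis_sub_1_lower (theta : R) : - PI <= theta <= PI ->
  Rabs theta / 3 <= Cmod (cis theta - 1)%C.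
Proof.
intros Ht. pose proof PI_4 as Hpi. pose proof PI_RGT_0.
assert (Hs : Rabs theta / 6 <= Rabs (sin (theta / 2))).
{ assert (Hpos : forall x, 0 <= x <= PI -> x / 6 <= sin (x / 2)).
  { intros x Hx. pose proof (pre_sin_bound (x / 2) 0 ltac:(lra) ltac:(lra)) as [H1 _].
    unfold sin_approx, sin_term in H1. simpl in H1.
    eapply Rle_trans; [| exact H1].
    assert (x / 2 <= 2) by lra.
    assert ((x / 2) * ((x / 2) * (x / 2)) <= (x / 2) * 4).
    { apply Rmult_le_compat_l; [lra |]. nra. }
    lra. }
  destruct (Rle_dec 0 theta) as [Hp | Hp].
  - rewrite Rabs_pos_eq by lra. eapply Rle_trans; [apply Hpos; lra | apply Rle_abs].
  - rewrite Rabs_left by lra. eapply Rle_trans; [apply Hpos; lra |].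
    replace (- theta / 2) with (- (theta / 2)) by field. rewrite sin_neg.
    rewrite <- Rabs_Ropp. apply Rle_abs. }
apply Rsqr_incr_0_var; [| apply Cmod_ge_0].
rewrite !Rsqr_pow2, Cmod2_alt.
replace theta with (2 * (theta / 2)) at 2 3 by field.
unfold cis. simpl Re. simpl Im. rewrite cos_2a_sin, sin_2a.
pose proof (sin2_cos2 (theta / 2)) as Hsc. unfold Rsqr in Hsc.
set (s := sin (theta / 2)) in *. set (c := cos (theta / 2)) in *.
replace ((1 - 2 * s * s + - (1)) ^ 2 + (2 * s * c + - 0) ^ 2)
  with (4 * (s * s) * (s * s + c * c)) by ring.
rewrite Hsc. pose proof (Rabs_pos theta).
replace (s * s) with (Rabs s * Rabs s) by (rewrite <- Rabs_mult; apply Rabs_pos_eq; nra).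
nra.
Qed.

(** The transform of a single cell stays away from zero on this band, so it can be divided out to
    pass from integrals to sums of samples. *)
Lemma CInt_cell_lower (lam d : R) : 0 < d -> - PI <= lam * d <= PI ->
  d / 3 <= Cmod (CInt (fun x => cis (- lam * x)) 0 d).
Proof.
intros Hd Hl. destruct (Req_dec lam 0) as [-> | Hlam].
- rewrite (CInt_ext _ (fun _ => 1%C)).
  + rewrite CInt_const, Cmod_mult, Cmod_1, Cmod_R, Rabs_pos_eq; lra.
  + intros x _. replace (- 0 * x) with 0 by ring. apply cis_0.
- pose proof (Rabs_pos_lt lam Hlam).
  apply (Rmult_le_reg_l (Rabs lam)); [assumption |].
  replace (Rabs lam * Cmod (CInt (fun x => cis (- lam * x)) 0 d))
    with (Cmod (cis (- lam * d) - 1)).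
  2:{ rewrite <- (Rabs_Ropp lam), <- cis_0. replace 0 with (- lam * 0) at 1 by ring.
      rewrite <- CInt_cis, !Cmod_mult, Cmod_Ci, Cmod_R. ring. }
  replace (Rabs lam * (d / 3)) with (Rabs (- lam * d) / 3)
    by (rewrite Rabs_mult, Rabs_Ropp, (Rabs_pos_eq d) by lra; field).
  apply cis_sub_1_lower. lra.
Qed.

(** With [f] frozen at the left end of each cell, the integral factors exactly into the transform of
    one cell, a phase, and an exponential sum of samples; freezing costs [d * eta] per cell. *)
Lemma CInt_cells (f : R -> C) (lam d eta x0 : R) (N : nat) : contC f -> 0 < d ->
  (forall x y, Rabs (y - x) <= d -> Cmod (f y - f x)%C <= eta) ->
  Cmod (CInt (demod f lam) x0 (x0 + INR N * d)
    - CInt (fun x => cis (- lam * x)) 0 d * cis (- lam * x0)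
      * csum N (fun j => f (x0 + INR j * d)%R * cis (- INR j * (lam * d)))%C)%C
  <= INR N * (d * eta).
Proof.
intros Hc Hd Hu.
assert (Hdc : contC (demod f lam)) by (apply contC_mult; [exact Hc | apply contC_cis]).
set (E := CInt (fun x => cis (- lam * x)) 0 d).
induction N as [| N IH].
- simpl INR. simpl csum. rewrite Rmult_0_l, Rplus_0_r, CInt_point.
  replace (0 - E * cis (- lam * x0) * 0)%C with (RtoC 0) by ring. rewrite Cmod_0. lra.
- set (y := x0 + INR N * d) in *.
  replace (x0 + INR (S N) * d) with (y + d) by (rewrite S_INR; unfold y; ring).
  rewrite (CInt_Chasles _ x0 y (y + d) Hdc). simpl csum. fold y.
  assert (Hcell : CInt (fun x => f y * cis (- lam * x))%C y (y + d)
    = (E * cis (- lam * x0) * (f y * cis (- INR N * (lam * d))))%C).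
  { rewrite (CInt_scal (f y) (fun x => cis (- lam * x))) by apply contC_cis.
    replace (CInt (fun x => cis (- lam * x)) y (y + d)) with (cis (- lam * y) * E)%C.
    - replace (- lam * y) with (- lam * x0 + - INR N * (lam * d)) by (unfold y; ring).
      rewrite cis_plus. ring.
    - unfold E. rewrite <- (CInt_scal (cis (- lam * y)) (fun x => cis (- lam * x)))
        by apply contC_cis.
      pose proof (CInt_shift (fun x => cis (- lam * x)) 0 d y (contC_cis _)) as Hs.
      rewrite Rplus_0_l, (Rplus_comm d y) in Hs. rewrite <- Hs.
      apply CInt_ext. intros x _. rewrite <- cis_plus. f_equal. ring. }
  assert (H2 : Cmod (CInt (demod f lam) y (y + d)
     - CInt (fun x => f y * cis (- lam * x))%C y (y + d))%C <= (y + d - y) * eta).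
  { assert (Hc2 : contC (fun x => f y * cis (- lam * x))%C)
      by (apply (contC_mult (fun _ => f y)); [apply contC_const | apply contC_cis]).
    rewrite <- CInt_minus by assumption.
    apply CInt_bound; [| lra |].
    - intros x. apply (continuous_minus (V := C_R_NormedModule) (demod f lam));
        [apply Hdc | apply Hc2].
    - intros x Hx. unfold demod.
      replace (f x * cis (- lam * x) - f y * cis (- lam * x))%C
        with ((f x - f y) * cis (- lam * x))%C by ring.
      rewrite Cmod_mult, Cmod_cis, Rmult_1_r. apply Hu. apply Rabs_le. lra. }
  rewrite Hcell in H2. rewrite S_INR.
  match goal with |- Cmod (?A + ?B - ?F * (?S + ?G))%C <= _ =>
    replace (A + B - F * (S + G))%C with ((A - F * S) + (B - F * G))%C by ring end.
  eapply Rle_trans; [apply Cmod_triangle |]. lra.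
Qed.

(** The angle [theta] corresponds to the frequency [theta / d], which runs over the compact band
    [[-PI / d, PI / d]]. The small integral and the freezing error each contribute [xi / 6 * N * d];
    division by the lower bound [d / 3] leaves [xi * N]. *)
Lemma samples_uniformly_small (f : R -> C) (xi : R) : ap f ->
  (forall alpha, fourier f alpha = 0%C) -> 0 < xi ->
  exists d N0, 0 < d /\ forall N x0 theta, (N0 <= N)%nat -> - PI <= theta <= PI ->
    Cmod (csum N (fun j => f (x0 + INR j * d)%R * cis (- INR j * theta))%C) <= xi * INR N.
Proof.
intros Hf H0 Hxi.
destruct (bohr_uniform f (xi / 6) (ap_bohr f Hf) ltac:(lra)) as (d' & Hd' & Hu).
(* The modulus [d'] is strict, while a closed cell needs a non-strict one. *)
set (d := d' / 2). assert (Hd : 0 < d) by (unfold d; lra).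
destruct (demod_uniformly_small f (xi / 6) (PI / d) Hf H0 ltac:(lra)) as (L0 & HL0 & HI).
destruct (nfloor_ex (L0 / d)) as [n Hn].
{ apply Rdiv_le_0_compat; lra. }
exists d, (S n). split; [exact Hd |]. intros N x0 theta HN Hth.
assert (HNL : L0 <= INR N * d).
{ apply le_INR in HN. rewrite S_INR in HN.
  replace L0 with (L0 / d * d) by (field; lra). nra. }
assert (Hlam : - (PI / d) <= theta / d <= PI / d).
{ assert (0 < / d) by (apply Rinv_0_lt_compat, Hd). unfold Rdiv. split; nra. }
pose proof (HI (INR N * d) x0 (theta / d) HNL Hlam) as H1.
pose proof (CInt_cells f (theta / d) d (xi / 6) x0 N (proj1 Hf) Hd) as H2.
replace (theta / d * d) with theta in H2 by (field; lra).
specialize (H2 ltac:(intros x y Hxy; apply Hu; unfold d in *; lra)).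
pose proof (CInt_cell_lower (theta / d) d Hd
  ltac:(replace (theta / d * d) with theta by (field; lra); exact Hth)) as H3.
set (S0 := csum N (fun j => f (x0 + INR j * d)%R * cis (- INR j * theta))%C) in *.
set (E := CInt (fun x => cis (- (theta / d) * x)) 0 d) in *.
rewrite Cmod_sub_sym in H2.
pose proof (Cmod_le_add (E * cis (- (theta / d) * x0) * S0)
  (CInt (demod f (theta / d)) x0 (x0 + INR N * d))) as H4.
rewrite !Cmod_mult, Cmod_cis, Rmult_1_r in H4.
pose proof (Cmod_ge_0 S0).
assert (H5 : d / 3 * Cmod S0 <= Cmod E * Cmod S0) by (apply Rmult_le_compat_r; assumption).
apply (Rmult_le_reg_l (d / 3)); [lra |]. lra.
Qed.

(** Whenever [j * d] is an almost-period to within half of [|f x0|], the sample has modulus at least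
    that half. The constant [c] precedes [d], which is fixed later in terms of [c]. *)
Lemma samples_energy (f : R -> C) (x0 : R) : ap f -> 0 < Cmod (f x0) ->
  exists c, 0 < c /\ forall d K,
    c * INR K <= rsum K (fun j => Cmod (f (x0 + INR j * d)%R) ^ 2).
Proof.
intros Hf H0. set (c0 := Cmod (f x0)) in *.
destruct (almost_period_density f (c0 / 2) Hf ltac:(lra)) as (n & Hn & Hcount).
exists ((c0 / 2) ^ 2 / n).
assert (Hc2 : 0 < (c0 / 2) ^ 2) by (apply pow_lt; lra).
split; [apply Rdiv_lt_0_compat; lra |]. intros d K.
apply Rle_trans with ((c0 / 2) ^ 2 * rsum K (fun t =>
  indicator (almost_period f (c0 / 2) (INR t * d)))).
- replace ((c0 / 2) ^ 2 / n * INR K) with ((c0 / 2) ^ 2 * (INR K / n)) by (field; lra).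
  apply Rmult_le_compat_l; [lra |]. apply Rle_div_l; [lra |].
  rewrite Rmult_comm. apply Hcount.
- rewrite <- rsum_scal. apply rsum_le. intros j _. unfold indicator.
  destruct (excluded_middle_informative (almost_period f (c0 / 2) (INR j * d))) as [Hp | Hp].
  + specialize (Hp x0). rewrite Cmod_sub_sym in Hp.
    pose proof (Cmod_le_add (f x0) (f (x0 + INR j * d))). fold c0 in H.
    rewrite Rmult_1_r. apply pow_incr. lra.
  + rewrite Rmult_0_r. apply pow2_ge_0.
Qed.

(** For a lag at most [K], every [j < K] keeps its partner inside the window of length [2 K], so the
    whole energy of the first half is present; replacing the partner by [a j] costs at most
    [eps * B] for each index. *)
Lemma autocorr_lower (a : nat -> C) (K t : nat) (B eps : R) : (t <= K)%nat ->
  (forall j, Cmod (a j) <= B) -> (forall j, Cmod (a (t + j)%nat - a j)%C <= eps) ->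
  rsum K (fun j => Cmod (a j) ^ 2) - INR (2 * K) * (eps * B)
  <= Cmod (autocorr (2 * K) a t).
Proof.
intros Ht HB Heps.
assert (He : 0 <= eps) by (eapply Rle_trans; [apply Cmod_ge_0 | apply (Heps O)]).
assert (HB0 : 0 <= B) by (eapply Rle_trans; [apply Cmod_ge_0 | apply (HB O)]).
eapply Rle_trans; [| apply (Rle_trans _ _ _ (Rle_abs _) (re_le_Cmod _))].
unfold autocorr. rewrite Re_csum.
rewrite <- (rsum_truncate K (2 * K) _ ltac:(lia)).
rewrite <- rsum_const.
replace (rsum (2 * K) (fun i => if lt_dec i K then Cmod (a i) ^ 2 else 0)
   - rsum (2 * K) (fun _ => eps * B))
 with (rsum (2 * K) (fun i => (if lt_dec i K then Cmod (a i) ^ 2 else 0) + (-1) * (eps * B))).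
2:{ rewrite rsum_plus, rsum_scal. ring. }
apply rsum_le. intros j Hj.
destruct (lt_dec (t + j) (2 * K)) as [Hl | Hl].
- replace (a (t + j)%nat * Cconj (a j))%C
    with (a j * Cconj (a j) + (a (t + j)%nat - a j) * Cconj (a j))%C by ring.
  rewrite <- Cmod2_RtoC.
  replace (Re (RtoC (Cmod (a j) ^ 2) + (a (t + j)%nat - a j) * Cconj (a j))%C)
    with (Cmod (a j) ^ 2 + Re ((a (t + j)%nat - a j) * Cconj (a j))%C) by reflexivity.
  pose proof (re_le_Cmod ((a (t + j)%nat - a j) * Cconj (a j))%C) as H1.
  rewrite Cmod_mult, Cmod_conj in H1.
  assert (H2 : Cmod (a (t + j)%nat - a j)%C * Cmod (a j) <= eps * B)
    by (apply Rmult_le_compat; try apply Cmod_ge_0; auto).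
  pose proof (Rabs_le_between (Re ((a (t + j)%nat - a j) * Cconj (a j))%C) (eps * B)) as H3.
  assert (H4 : Rabs (Re ((a (t + j)%nat - a j) * Cconj (a j))%C) <= eps * B) by lra.
  apply H3 in H4. pose proof (pow2_ge_0 (Cmod (a j))).
  destruct (lt_dec j K); lra.
- destruct (lt_dec j K); [lia |]. simpl Re. nra.
Qed.

(** The constants are chosen in the order energy [c1], tolerance [eps], density [n], smallness [xi],
    mesh [d], each depending on the previous ones. Both estimates for the sum of squared
    correlations are of order [K^3], so only the constants decide. *)
Theorem ap_fourier_zero (f : R -> C) : ap f ->
  (forall alpha, fourier f alpha = 0%C) -> forall x, f x = 0%C.
Proof.
intros Hf H0 x0. apply Cmod_eq_0. apply NNPP. intros Hne.
assert (Hpos : 0 < Cmod (f x0)) by (pose proof (Cmod_ge_0 (f x0)); lra).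
destruct (ap_bounded f Hf) as (B & HB & HfB).
destruct (samples_energy f x0 Hf Hpos) as (c1 & Hc1 & Henergy).
(* Makes the loss [2 K * eps * B] equal to half of the energy bound [c1 * K]. *)
set (eps := c1 / (4 * B)).
assert (Heps : 0 < eps) by (apply Rdiv_lt_0_compat; lra).
destruct (almost_period_density f eps Hf Heps) as (n & Hn & Hcount).
(* Makes the lower estimate exceed the upper one by the factor [2 n]. *)
set (xi := c1 / (8 * B * n)).
assert (HBn : 0 < 8 * B * n) by (apply Rmult_lt_0_compat; lra).
assert (Hxi : 0 < xi) by (apply Rdiv_lt_0_compat; lra).
destruct (samples_uniformly_small f xi Hf H0 Hxi) as (d & N0 & Hd & Hsmall).
(* The successor gives [0 < K] as well as [N0 <= 2 K]. *)
set (K := S N0). set (a := fun j : nat => f (x0 + INR j * d)).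
assert (HK : 0 < INR K) by (apply lt_0_INR; unfold K; lia).
assert (HN : INR (2 * K) = 2 * INR K) by (rewrite mult_INR; simpl; ring).
pose proof (autocorr_bound (2 * K) a (xi * INR (2 * K)) ltac:(rewrite HN; nra)
  (fun t Ht => Hsmall (2 * K)%nat x0 t ltac:(unfold K; lia) Ht)) as Hup.
assert (HaB : rsum (2 * K) (fun j => Cmod (a j) ^ 2) <= INR (2 * K) * B ^ 2).
{ rewrite <- rsum_const. apply rsum_le. intros j _. apply pow_incr.
  split; [apply Cmod_ge_0 | apply HfB]. }
assert (Hlow : (c1 * INR K / 2) ^ 2 * (INR K / n)
  <= rsum (2 * K) (fun t => Cmod (autocorr (2 * K) a t) ^ 2)).
{ apply Rle_trans with (rsum K (fun t => Cmod (autocorr (2 * K) a t) ^ 2)).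
  2:{ apply rsum_le_length; [lia |]. intros; apply pow2_ge_0. }
  apply Rle_trans with ((c1 * INR K / 2) ^ 2 *
    rsum K (fun t => indicator (almost_period f eps (INR t * d)))).
  { apply Rmult_le_compat_l; [apply pow2_ge_0 |]. apply Rle_div_l; [lra |].
    rewrite Rmult_comm. apply Hcount. }
  rewrite <- rsum_scal. apply rsum_le. intros t Ht. unfold indicator.
  destruct (excluded_middle_informative (almost_period f eps (INR t * d))) as [Hp | Hp].
  - rewrite Rmult_1_r. apply pow_incr. split; [nra |].
    eapply Rle_trans; [| apply (autocorr_lower a K t B eps)]; [| lia | |].
    + specialize (Henergy d K). fold a in Henergy.
      change (fun j => Cmod (f (x0 + INR j * d)) ^ 2) with (fun j => Cmod (a j) ^ 2) in Henergy.
      rewrite HN. replace (2 * INR K * (eps * B)) with (c1 * INR K / 2); [lra |].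
      unfold eps. field. lra.
    + intros j. apply HfB.
    + intros j. unfold a. rewrite plus_INR.
      replace (x0 + (INR t + INR j) * d) with (x0 + INR j * d + INR t * d) by ring.
      apply Hp.
  - rewrite Rmult_0_r. apply pow2_ge_0. }
rewrite HN in *.
assert (Hfin : (c1 * INR K / 2) ^ 2 * (INR K / n)
  <= (xi * (2 * INR K)) ^ 2 * (2 * INR K * B ^ 2)).
{ eapply Rle_trans; [exact Hlow |]. eapply Rle_trans; [exact Hup |].
  apply Rmult_le_compat_l; [apply pow2_ge_0 | exact HaB]. }
(* With [X = c1^2 K^3 / (8 n^2) > 0] the two estimates read [2 n X <= X], which is absurd as
   [n >= 1]. *)
replace ((c1 * INR K / 2) ^ 2 * (INR K / n))
  with (2 * n * (c1 ^ 2 * INR K ^ 3 / (8 * n ^ 2))) in Hfin by (field; lra).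
replace ((xi * (2 * INR K)) ^ 2 * (2 * INR K * B ^ 2))
  with (c1 ^ 2 * INR K ^ 3 / (8 * n ^ 2)) in Hfin by (unfold xi; field; lra).
assert (0 < c1 ^ 2 * INR K ^ 3 / (8 * n ^ 2)).
{ apply Rdiv_lt_0_compat.
  - apply Rmult_lt_0_compat; apply pow_lt; assumption.
  - apply Rmult_lt_0_compat; [lra | apply pow_lt; lra]. }
nra.
Qed.

(** * The Wiener-type algebra *)

Notation sumC := (finite_sum (G := C_AbelianMonoid)).
Notation sumR := (finite_sum (G := R_AbelianMonoid)).

Section FiniteSum.
Context {G : AbelianMonoid}.

Lemma finite_sum_perm (a : R -> G) (l l' : list R) : Permutation l l' ->
  finite_sum a l = finite_sum a l'.
Proof.
intros H. induction H as [| x l l' H IH | x y l | l l' l'' H1 IH1 H2 IH2]; simpl.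
- reflexivity.
- rewrite IH. reflexivity.
- rewrite !plus_assoc. f_equal. apply plus_comm.
- congruence.
Qed.

Lemma finite_sum_app (a : R -> G) (l l' : list R) :
  finite_sum a (l ++ l') = plus (finite_sum a l) (finite_sum a l').
Proof.
induction l as [| x l IH]; simpl.
- symmetry. apply plus_zero_l.
- rewrite IH. apply plus_assoc.
Qed.

Lemma finite_sum_ext (a b : R -> G) (l : list R) :
  (forall x, In x l -> a x = b x) -> finite_sum a l = finite_sum b l.
Proof.
intros H. induction l as [| x l IH]; simpl; [reflexivity |].
rewrite H by (left; reflexivity). rewrite IH; [reflexivity |].
intros y Hy. apply H. right. exact Hy.
Qed.

End FiniteSum.

Definition diff_list (l l0 : list R) : list R :=
  filter (fun x => if in_dec Req_EM_T x l0 then false else true) l.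

Definition inter_list (l l0 : list R) : list R :=
  filter (fun x => if in_dec Req_EM_T x l0 then true else false) l.

Lemma in_diff_list (l l0 : list R) (x : R) : In x (diff_list l l0) <-> In x l /\ ~ In x l0.
Proof.
unfold diff_list. rewrite filter_In. destruct (in_dec Req_EM_T x l0); intuition congruence.
Qed.

Lemma in_inter_list (l l0 : list R) (x : R) : In x (inter_list l l0) <-> In x l /\ In x l0.
Proof.
unfold inter_list. rewrite filter_In. destruct (in_dec Req_EM_T x l0); intuition congruence.
Qed.

Lemma finite_subset_iff (A : R -> Prop) (l : list R) :
  finite_subset A l <-> NoDup l /\ forall x, In x l -> A x.
Proof. unfold finite_subset. rewrite Forall_forall. reflexivity. Qed.

Lemma diff_list_subset (A : R -> Prop) (l l0 : list R) :
  finite_subset A l -> finite_subset A (diff_list l l0).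
Proof.
rewrite !finite_subset_iff. intros [H1 H2]. split; [apply NoDup_filter, H1 |].
intros x Hx. apply in_diff_list in Hx. apply H2, Hx.
Qed.

Lemma inter_list_subset (A : R -> Prop) (l l0 : list R) :
  finite_subset A l -> finite_subset A (inter_list l l0).
Proof.
rewrite !finite_subset_iff. intros [H1 H2]. split; [apply NoDup_filter, H1 |].
intros x Hx. apply in_inter_list in Hx. apply H2, Hx.
Qed.

Lemma finite_sum_diff {G : AbelianMonoid} (a : R -> G) (l l0 : list R) :
  NoDup l -> NoDup l0 -> incl l0 l ->
  finite_sum a l = plus (finite_sum a l0) (finite_sum a (diff_list l l0)).
Proof.
intros H1 H2 Hi. rewrite <- finite_sum_app. apply finite_sum_perm.
apply NoDup_Permutation; [exact H1 | |].
- apply NoDup_app; [exact H2 | apply NoDup_filter, H1 |].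
  intros x Hx Hd. apply in_diff_list in Hd. tauto.
- intros x. rewrite in_app_iff, in_diff_list.
  destruct (in_dec Req_EM_T x l0) as [Hx | Hx]; [specialize (Hi x Hx) |]; tauto.
Qed.

Lemma finite_sum_inter {G : AbelianMonoid} (a : R -> G) (l l0 : list R) :
  finite_sum a l = plus (finite_sum a (inter_list l l0)) (finite_sum a (diff_list l l0)).
Proof.
induction l as [| x l IH]; simpl.
- symmetry. apply plus_zero_l.
- unfold inter_list, diff_list in *. simpl.
  destruct (in_dec Req_EM_T x l0); simpl; rewrite IH.
  + apply plus_assoc.
  + rewrite !plus_assoc. f_equal. apply plus_comm.
Qed.

Lemma finite_subset_union (A : R -> Prop) (l1 l2 : list R) :
  finite_subset A l1 -> finite_subset A l2 ->
  exists l, finite_subset A l /\ incl l1 l /\ incl l2 l.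
Proof.
rewrite !finite_subset_iff. intros [_ H1] [_ H2].
exists (nodup Req_EM_T (l1 ++ l2)). rewrite finite_subset_iff. repeat split.
- apply NoDup_nodup.
- intros x Hx. apply nodup_In, in_app_iff in Hx. destruct Hx; auto.
- intros x Hx. apply nodup_In, in_app_iff. tauto.
- intros x Hx. apply nodup_In, in_app_iff. tauto.
Qed.

Lemma sumR_cons (a : R -> R) (x : R) (l : list R) : sumR a (x :: l) = a x + sumR a l.
Proof. reflexivity. Qed.

Lemma sumR_nil (a : R -> R) : sumR a nil = 0.
Proof. reflexivity. Qed.

Lemma sumR_le (a b : R -> R) (l : list R) : (forall x, In x l -> a x <= b x) ->
  sumR a l <= sumR b l.
Proof.
intros H. induction l as [| x l IH]; simpl; [unfold zero; simpl; lra |].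
apply Rplus_le_compat; [apply H; left; reflexivity |].
apply IH. intros y Hy. apply H. right. exact Hy.
Qed.

Lemma sumR_ge_0 (a : R -> R) (l : list R) : (forall x, In x l -> 0 <= a x) -> 0 <= sumR a l.
Proof.
intros H. induction l as [| x l IH]; simpl; [unfold zero; simpl; lra |].
apply Rplus_le_le_0_compat; [apply H; left; reflexivity |].
apply IH. intros y Hy. apply H. right. exact Hy.
Qed.

Lemma sumR_plus (a b : R -> R) (l : list R) :
  sumR (fun x => a x + b x) l = sumR a l + sumR b l.
Proof.
induction l as [| x l IH]; simpl; [unfold zero; simpl; lra |]. rewrite IH. unfold plus; simpl. ring.
Qed.

Lemma sumR_scal (c : R) (a : R -> R) (l : list R) :
  sumR (fun x => c * a x) l = c * sumR a l.
Proof.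
induction l as [| x l IH]; simpl; [unfold zero; simpl; lra |]. rewrite IH. unfold plus; simpl. ring.
Qed.

Lemma sumR_const (c : R) (l : list R) : sumR (fun _ => c) l = INR (length l) * c.
Proof.
induction l as [| x l IH]; [simpl; unfold zero; simpl; lra |].
change (length (x :: l)) with (S (length l)). rewrite S_INR. simpl. rewrite IH.
unfold plus; simpl. ring.
Qed.

Lemma sumR_incl (a : R -> R) (l l' : list R) : NoDup l -> NoDup l' -> incl l l' ->
  (forall x, In x l' -> 0 <= a x) -> sumR a l <= sumR a l'.
Proof.
intros H1 H2 Hi Ha. rewrite (finite_sum_diff a l' l H2 H1 Hi).
assert (0 <= sumR a (diff_list l' l)).
{ apply sumR_ge_0. intros x Hx. apply in_diff_list in Hx. apply Ha, Hx. }
unfold plus; simpl. lra.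
Qed.

Lemma Cmod_sumC (a : R -> C) (l : list R) : Cmod (sumC a l) <= sumR (fun x => Cmod (a x)) l.
Proof.
induction l as [| x l IH]; simpl.
- change (Cmod 0%C <= 0). rewrite Cmod_0. lra.
- eapply Rle_trans; [apply Cmod_triangle |]. apply Rplus_le_compat_l, IH.
Qed.

(** The list [l0] attains the supremum of the finite sums up to [eps]; a disjoint list appended to
    it still cannot exceed the supremum. *)
Lemma summable_tail (A : R -> Prop) (b : R -> R) (r eps : R) :
  (forall l, finite_subset A l -> sumR b l <= r) -> 0 < eps ->
  exists l0, finite_subset A l0 /\ forall l, finite_subset A l ->
    (forall x, In x l -> ~ In x l0) -> sumR b l <= eps.
Proof.
intros Hr He.
assert (Hnil : finite_subset A nil) by (split; constructor).
destruct (completeness (fun s => exists l, finite_subset A l /\ s = sumR b l)) as [m [Hub Hlub]].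
- exists r. intros s (l & Hl & ->). apply Hr, Hl.
- exists (sumR b nil), nil. split; [exact Hnil | reflexivity].
- assert (Hex : exists l0, finite_subset A l0 /\ m - eps < sumR b l0).
  { apply NNPP. intros Hn. assert (H : m <= m - eps); [| lra].
    apply Hlub. intros s (l & Hl & ->). apply Rnot_lt_le. intros Hlt.
    apply Hn. exists l. split; assumption. }
  destruct Hex as (l0 & Hl0 & Hgt). exists l0. split; [exact Hl0 |].
  intros l Hl Hdisj.
  assert (H : sumR b (l0 ++ l) <= m).
  { apply Hub. exists (l0 ++ l). split; [| reflexivity].
    apply finite_subset_iff in Hl0, Hl. apply finite_subset_iff. split.
    - apply NoDup_app; [apply Hl0 | apply Hl |]. intros x H1 H2. exact (Hdisj x H2 H1).
    - intros x Hx. apply in_app_iff in Hx. destruct Hx; [apply Hl0 | apply Hl]; assumption. }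
  rewrite finite_sum_app in H. unfold plus in H; simpl in H. lra.
Qed.

Lemma sumC_dominated_diff (A : R -> Prop) (a : R -> C) (b : R -> R) (eps : R) (l0 l l' : list R) :
  (forall x, A x -> Cmod (a x) <= b x) ->
  (forall l, finite_subset A l -> (forall x, In x l -> ~ In x l0) -> sumR b l <= eps) ->
  finite_subset A l -> finite_subset A l' -> incl l0 l -> incl l l' ->
  Cmod (sumC a l' - sumC a l)%C <= eps.
Proof.
intros Hab Htail Hl Hl' H0 Hi.
pose proof (proj1 (finite_subset_iff A l) Hl) as [N1 A1].
pose proof (proj1 (finite_subset_iff A l') Hl') as [N2 A2].
rewrite (finite_sum_diff a l' l N2 N1 Hi).
replace (plus (sumC a l) (sumC a (diff_list l' l)) - sumC a l)%C
  with (sumC a (diff_list l' l)).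
2:{ change (sumC a (diff_list l' l)
      = ((sumC a l : C) + (sumC a (diff_list l' l) : C) - (sumC a l : C))%C).
    generalize (sumC a l : C), (sumC a (diff_list l' l) : C). intros u v.
    change (v = (u + v - u)%C :> C). ring. }
eapply Rle_trans; [apply Cmod_sumC |].
eapply Rle_trans; [apply (sumR_le _ b) |].
- intros x Hx. apply in_diff_list in Hx. apply Hab, A2, Hx.
- apply Htail; [apply diff_list_subset, Hl' |].
  intros x Hx Hx0. apply in_diff_list in Hx. apply (proj2 Hx), H0, Hx0.
Qed.

Lemma finite_subsets_above (A : R -> Prop) (P : list R -> Prop) (l : list R) :
  finite_subsets A P -> finite_subset A l ->
  exists l', finite_subset A l' /\ incl l l' /\ P l'.
Proof.
intros (l0 & Hl0 & H) Hl. destruct (finite_subset_union A l l0 Hl Hl0) as (l' & H1 & H2 & H3).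
exists l'. auto.
Qed.

Lemma is_Csum_unique (A : R -> Prop) (a : R -> C) (s : C) : is_Csum A a s -> Csum A a = s.
Proof.
intros H. unfold Csum, is_Csum.
apply (iota_filterlim_locally (K := R_AbsRing) (V := C_R_CompleteNormedModule)
  (F := finite_subsets A)).
exact H.
Qed.

(** Bounded sums of moduli make the net of finite sums Cauchy, so the total operator [Csum] really
    is its limit. *)
Lemma Csum_correct (A : R -> Prop) (a : R -> C) (r : R) :
  (forall l, finite_subset A l -> sumR (fun x => Cmod (a x)) l <= r) ->
  is_Csum A a (Csum A a).
Proof.
intros Hr.
assert (Hex : exists s : C_R_CompleteNormedModule,
  filterlim (sumC a) (finite_subsets A) (locally s)).
{ apply (proj1 (filterlim_locally_cauchy (U := C_R_CompleteNormedModule)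
    (F := finite_subsets A) (sumC a))).
  intros eps. destruct (summable_tail A _ r (eps / 4) Hr) as (l0 & Hl0 & Htail).
  { destruct eps; simpl; lra. }
  exists (fun l => finite_subset A l /\ incl l0 l). split.
  - exists l0. split; [exact Hl0 |]. auto.
  - intros u v [Hu Hu0] [Hv Hv0].
    apply (norm_compat1 (V := C_R_NormedModule)). rewrite <- Cmod_norm.
    destruct (finite_subset_union A u v Hu Hv) as (w & Hw & Huw & Hvw).
    pose proof (sumC_dominated_diff A a _ _ l0 u w (fun x _ => Rle_refl _) Htail Hu Hw Hu0 Huw).
    pose proof (sumC_dominated_diff A a _ _ l0 v w (fun x _ => Rle_refl _) Htail Hv Hw Hv0 Hvw) as H1.
    rewrite Cmod_sub_sym in H1.
    pose proof (Cmod_sub_triangle (sumC a v) (sumC a w) (sumC a u)).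
    pose proof (cond_pos eps).
    apply Rle_lt_trans with (Cmod (sumC a v - sumC a u)%C); [apply Rle_refl | lra]. }
destruct Hex as [s Hs]. rewrite (is_Csum_unique A a s Hs). exact Hs.
Qed.

Lemma Csum_approx (A : R -> Prop) (a : R -> C) (b : R -> R) (r eps : R) (l0 l : list R) :
  (forall x, A x -> Cmod (a x) <= b x) ->
  (forall l, finite_subset A l -> sumR b l <= r) ->
  (forall l, finite_subset A l -> (forall x, In x l -> ~ In x l0) -> sumR b l <= eps) ->
  finite_subset A l -> incl l0 l -> Cmod (Csum A a - sumC a l)%C <= eps.
Proof.
intros Hab Hr Htail Hl Hi.
assert (Hs : is_Csum A a (Csum A a)).
{ apply (Csum_correct A a r). intros l1 Hl1. eapply Rle_trans; [| apply (Hr l1 Hl1)].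
  apply sumR_le. intros x Hx. apply Hab. apply finite_subset_iff in Hl1. apply Hl1, Hx. }
apply le_epsilon. intros e He.
pose proof (proj1 (filterlim_C (finite_subsets A) (sumC a) (Csum A a)) Hs e He) as HF.
destruct (finite_subsets_above A _ l HF Hl) as (l' & Hl' & Hll & Hd).
pose proof (sumC_dominated_diff A a b eps l0 l l' Hab Htail Hl Hl' Hi Hll).
rewrite Cmod_sub_sym in Hd.
pose proof (Cmod_sub_triangle (Csum A a) (sumC a l') (sumC a l)). lra.
Qed.

(** The working form of the norm: extended reals disappear in favour of real bounds on finite sums,
    which survive sums and limits termwise. *)
Lemma A_ball_iff (omega : nat -> R) (r : R) (f : R -> C) :
  A_ball omega r f <->
  ap f /\ (forall alpha, ~ Omega omega alpha -> fourier f alpha = 0%C) /\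
  (forall l, finite_subset (Omega omega) l ->
     sumR (fun alpha => Cmod (fourier f alpha)) l <= r).
Proof.
unfold A_ball, A_space, A_norm, sum_nonneg.
set (E := fun s => exists l, finite_subset (Omega omega) l /\
  s = sumR (fun alpha => Cmod (fourier f alpha)) l).
destruct (Lub_Rbar_correct E) as [Hub Hlub].
rewrite ap_iff. split.
- intros [[H1 [H2 H3]] H4]. split; [exact H1 |]. split.
  + intros alpha Ha. apply NNPP. intros Hn. apply Ha, H2. exact Hn.
  + intros l Hl.
    apply (Rbar_le_trans (Finite (sumR (fun alpha => Cmod (fourier f alpha)) l))
      (Lub_Rbar E) (Finite r)); [| exact H4].
    apply Hub. exists l. split; [exact Hl | reflexivity].
- intros (H1 & H2 & H3).
  assert (Hr : Rbar_le (Lub_Rbar E) r).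
  { apply Hlub. intros s (l & Hl & ->). apply H3, Hl. }
  repeat split; try exact Hr; try apply H1.
  + intros alpha Ha. apply NNPP. intros Hn. apply Ha, H2, Hn.
  + apply (Rbar_le_lt_trans _ _ _ Hr). exact I.
Qed.

Lemma Cmod_minus_1 : Cmod (-1)%C = 1.
Proof. rewrite Cmod_R, Rabs_left; lra. Qed.

Section Wiener.
Context (omega : nat -> R).
Notation Om := (Omega omega).
Notation ball := (A_ball omega).

Lemma ball_ap (r : R) (f : R -> C) : ball r f -> ap f.
Proof. intros H. apply A_ball_iff in H. apply H. Qed.

Lemma ball_ext (r : R) (f g : R -> C) : (forall x, f x = g x) -> ball r f -> ball r g.
Proof.
intros E. replace g with f; [tauto |]. apply functional_extensionality. exact E.
Qed.

Lemma ball_mono (r s : R) (f : R -> C) : r <= s -> ball r f -> ball s f.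
Proof.
rewrite !A_ball_iff. intros Hrs (H1 & H2 & H3). split; [exact H1 | split; [exact H2 |]].
intros l Hl. specialize (H3 l Hl). lra.
Qed.

Lemma ball_nonneg (r : R) (f : R -> C) : ball r f -> 0 <= r.
Proof.
rewrite A_ball_iff. intros (_ & _ & H). apply (H nil). split; constructor.
Qed.

Lemma ball_plus (r s : R) (f g : R -> C) : ball r f -> ball s g ->
  ball (r + s) (fun x => f x + g x)%C.
Proof.
rewrite !A_ball_iff. intros (F1 & F2 & F3) (G1 & G2 & G3).
split; [apply ap_plus; assumption | split].
- intros alpha Ha. rewrite fourier_plus, F2, G2 by assumption. ring.
- intros l Hl. specialize (F3 l Hl). specialize (G3 l Hl).
  eapply Rle_trans; [apply (sumR_le _ (fun alpha =>
    Cmod (fourier f alpha) + Cmod (fourier g alpha))) |].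
  + intros alpha _. rewrite fourier_plus by assumption. apply Cmod_triangle.
  + rewrite sumR_plus. lra.
Qed.

Lemma ball_scal (c : C) (r : R) (f : R -> C) : ball r f ->
  ball (Cmod c * r) (fun x => c * f x)%C.
Proof.
rewrite !A_ball_iff. intros (F1 & F2 & F3).
split; [apply ap_scal; assumption | split].
- intros alpha Ha. rewrite fourier_scal, F2 by assumption. ring.
- intros l Hl. specialize (F3 l Hl).
  rewrite (finite_sum_ext _ (fun alpha => Cmod c * Cmod (fourier f alpha))).
  + rewrite sumR_scal. apply Rmult_le_compat_l; [apply Cmod_ge_0 | exact F3].
  + intros alpha _. rewrite fourier_scal, Cmod_mult by assumption. reflexivity.
Qed.

Lemma ball_minus (r s : R) (f g : R -> C) : ball r f -> ball s g ->
  ball (r + s) (fun x => f x - g x)%C.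
Proof.
intros Hf Hg. apply (ball_ext _ (fun x => f x + (-1) * g x)%C); [intros x; ring |].
apply ball_plus; [exact Hf |].
apply (ball_scal (-1)%C) in Hg.
rewrite Cmod_minus_1, Rmult_1_l in Hg. exact Hg.
Qed.

Lemma ball_sub_triangle (r s : R) (f g h : R -> C) :
  ball r (fun x => f x - g x)%C -> ball s (fun x => g x - h x)%C ->
  ball (r + s) (fun x => f x - h x)%C.
Proof.
intros H1 H2. eapply ball_ext; [| apply (ball_plus _ _ _ _ H1 H2)].
intros x. simpl. ring.
Qed.

Lemma ball_sub_sym (r : R) (f g : R -> C) :
  ball r (fun x => f x - g x)%C -> ball r (fun x => g x - f x)%C.
Proof.
intros H. apply (ball_scal (-1)%C) in H.
rewrite Cmod_minus_1, Rmult_1_l in H.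
eapply ball_ext; [| exact H]. intros x. simpl. ring.
Qed.

Lemma ball_zero (r : R) : 0 <= r -> ball r (fun _ => 0%C).
Proof.
intros Hr.
assert (E : forall alpha, fourier (fun _ => 0%C) alpha = 0%C).
{ intros alpha. rewrite (fourier_ext _ (fun x => 0 * 0)%C) by (intros; ring).
  rewrite (fourier_scal 0%C (fun _ => 0%C)) by apply ap_const. ring. }
apply A_ball_iff. split; [apply ap_const | split].
- intros; apply E.
- intros l _. rewrite (finite_sum_ext _ (fun _ => 0)).
  + rewrite sumR_const. lra.
  + intros alpha _. rewrite E. apply Cmod_0.
Qed.

Lemma ball_char (c : C) (alpha : R) : Om alpha -> ball (Cmod c) (fun x => c * cis (alpha * x))%C.
Proof.
intros Ha.
assert (E : forall beta, fourier (fun x => c * cis (alpha * x))%C beta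
   = if Req_EM_T alpha beta then c else 0%C).
{ intros beta. rewrite (fourier_scal c (fun x => cis (alpha * x))) by apply ap_cis.
  destruct (Req_EM_T alpha beta) as [<- | Hn].
  - rewrite fourier_cis_same. ring.
  - rewrite fourier_cis_diff by exact Hn. ring. }
apply A_ball_iff. split; [apply ap_scal, ap_cis | split].
- intros beta Hb. rewrite E. destruct (Req_EM_T alpha beta) as [-> | Hn]; [tauto | reflexivity].
- intros l [Hl _]. rewrite (finite_sum_ext _ (fun beta =>
    if Req_EM_T alpha beta then Cmod c else 0)).
  2:{ intros beta _. rewrite E. destruct (Req_EM_T alpha beta); [reflexivity | apply Cmod_0]. }
  pose proof (Cmod_ge_0 c).
  assert (Hz : forall l, ~ In alpha l ->
    sumR (fun beta => if Req_EM_T alpha beta then Cmod c else 0) l = 0).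
  { induction l0 as [| b l0 IH]; intros Hn; [reflexivity |]. rewrite sumR_cons.
    destruct (Req_EM_T alpha b) as [-> | Hb]; [exfalso; apply Hn; left; reflexivity |].
    rewrite IH by (intros H1; apply Hn; right; exact H1). apply Rplus_0_l. }
  (* Absence of duplicates matters here: [alpha] contributes at most once. *)
  induction Hl as [| b l Hb Hl IH]; [exact H |]. rewrite sumR_cons.
  destruct (Req_EM_T alpha b) as [-> | Hn].
  + rewrite Hz by exact Hb. lra.
  + lra.
Qed.

Lemma ball_limit (r : R) (f : R -> C) :
  (forall eps, 0 < eps -> exists g, ball (r + eps) g /\ forall x, Cmod (f x - g x)%C <= eps) ->
  ball r f.
Proof.
intros H.
assert (Hf : ap f).
{ apply ap_limit. intros eps He. destruct (H eps He) as (g & Hg & Hx).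
  exists g. split; [apply (ball_ap _ _ Hg) | exact Hx]. }
assert (Hdiff : forall g eps alpha, ap g -> (forall x, Cmod (f x - g x)%C <= eps) ->
  Cmod (fourier f alpha - fourier g alpha)%C <= eps).
{ intros g eps alpha Hg Hx. rewrite <- fourier_minus by assumption.
  apply fourier_bound; [apply ap_minus; assumption | exact Hx]. }
apply A_ball_iff. split; [exact Hf | split].
- intros alpha Ha. apply Cmod_eq_0. apply Rle_antisym; [| apply Cmod_ge_0].
  apply le_epsilon. intros eps He. destruct (H eps He) as (g & Hg & Hx).
  pose proof (Hdiff g eps alpha (ball_ap _ _ Hg) Hx) as H1.
  apply A_ball_iff in Hg. rewrite (proj1 (proj2 Hg) alpha Ha) in H1.
  replace (fourier f alpha - 0)%C with (fourier f alpha) in H1 by ring. lra.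
- intros l Hl. apply le_epsilon. intros eps He.
  pose proof (pos_INR (length l)).
  (* The tolerance is chosen after [l]: one [e] for each coefficient and one for the slack in the
     radius. *)
  destruct (Rmult_bound_eps (INR (length l) + 1) eps ltac:(lra) He) as (e & He1 & He2).
  destruct (H e He1) as (g & Hg & Hx).
  pose proof (proj1 (A_ball_iff _ _ _) Hg) as (_ & _ & Hs). specialize (Hs l Hl).
  eapply Rle_trans; [apply (sumR_le _ (fun alpha => Cmod (fourier g alpha) + e)) |].
  + intros alpha _. eapply Rle_trans; [apply (Cmod_le_add _ (fourier g alpha)) |].
    apply Rplus_le_compat_l. apply Hdiff; [apply (ball_ap _ _ Hg) | exact Hx].
  + rewrite sumR_plus, sumR_const. lra.
Qed.

Lemma ball_closed (r : R) (f : R -> C) :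
  (forall eps, 0 < eps -> ball (r + eps) f) -> ball r f.
Proof.
intros H. apply ball_limit. intros eps He. exists f. split; [apply H, He |].
intros x. replace (f x - f x)%C with (RtoC 0) by ring. rewrite Cmod_0. lra.
Qed.

(** * Trigonometric polynomials and absolutely convergent series *)

Definition trig_poly (c : R -> C) (l : list R) (x : R) : C :=
  sumC (fun alpha => c alpha * cis (alpha * x))%C l.

Lemma trig_poly_nil (c : R -> C) (x : R) : trig_poly c nil x = 0%C.
Proof. reflexivity. Qed.

Lemma trig_poly_cons (c : R -> C) (a : R) (l : list R) (x : R) :
  trig_poly c (a :: l) x = (c a * cis (a * x) + trig_poly c l x)%C.
Proof. reflexivity. Qed.

Lemma trig_poly_ball (c : R -> C) (l : list R) : (forall x, In x l -> Om x) ->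
  ball (sumR (fun x => Cmod (c x)) l) (trig_poly c l).
Proof.
intros Hl. induction l as [| a l IH].
- apply ball_zero. simpl. apply Rle_refl.
- apply (ball_plus (Cmod (c a)) _ (fun x => c a * cis (a * x))%C).
  + apply ball_char, Hl. left. reflexivity.
  + apply IH. intros x Hx. apply Hl. right. exact Hx.
Qed.

Lemma trig_poly_ap (c : R -> C) (l : list R) : ap (trig_poly c l).
Proof.
induction l as [| a l IH]; [apply ap_const |].
apply (ap_plus (fun x => c a * cis (a * x))%C); [apply ap_scal, ap_cis | exact IH].
Qed.

Lemma trig_poly_fourier (c : R -> C) (l : list R) (beta : R) : NoDup l ->
  fourier (trig_poly c l) beta = if in_dec Req_EM_T beta l then c beta else 0%C.
Proof.
intros Hl. induction Hl as [| a l Ha Hl IH].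
- apply fourier_unique. apply (uniform_mean_ext (fun _ => 0%C)).
  + intros x. unfold demod. rewrite trig_poly_nil. ring.
  + apply uniform_mean_const.
- rewrite (fourier_ext _ (fun x => c a * cis (a * x) + trig_poly c l x)%C) by reflexivity.
  rewrite (fourier_plus (fun x => c a * cis (a * x))%C)
    by (apply trig_poly_ap || (apply ap_scal, ap_cis)).
  rewrite (fourier_scal (c a) (fun x => cis (a * x))) by apply ap_cis.
  rewrite IH.
  destruct (Req_dec a beta) as [-> | Hn].
  + rewrite fourier_cis_same. destruct (in_dec Req_EM_T beta l); [tauto |].
    destruct (in_dec Req_EM_T beta (beta :: l)) as [H | H]; [ring |].
    exfalso. apply H. left. reflexivity.
  + rewrite fourier_cis_diff by exact Hn.
    destruct (in_dec Req_EM_T beta l), (in_dec Req_EM_T beta (a :: l)) as [H | H];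
      try ring; exfalso; simpl in H; tauto.
Qed.

Lemma trig_poly_bound (c : R -> C) (l : list R) (x : R) :
  Cmod (trig_poly c l x) <= sumR (fun x => Cmod (c x)) l.
Proof.
eapply Rle_trans; [apply Cmod_sumC |]. apply sumR_le. intros y _.
rewrite Cmod_mult, Cmod_cis. lra.
Qed.

Definition fourier_series (c : R -> C) (x : R) : C :=
  Csum Om (fun alpha => c alpha * cis (alpha * x))%C.

Lemma fourier_series_approx (c : R -> C) (r eps : R) (l0 l : list R) :
  (forall l, finite_subset Om l -> sumR (fun x => Cmod (c x)) l <= r) ->
  (forall l, finite_subset Om l -> (forall x, In x l -> ~ In x l0) ->
     sumR (fun x => Cmod (c x)) l <= eps) ->
  finite_subset Om l -> incl l0 l ->
  forall x, Cmod (fourier_series c x - trig_poly c l x)%C <= eps.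
Proof.
intros Hr Htail Hl Hi x.
apply (Csum_approx Om _ (fun x => Cmod (c x)) r eps l0 l); try assumption.
intros y _. rewrite Cmod_mult, Cmod_cis. lra.
Qed.

(** Partial sums stay in the ball and converge uniformly, and coefficients are continuous for
    uniform convergence, so both claims are inherited from trigonometric polynomials. *)
Lemma fourier_series_ball (c : R -> C) (r : R) :
  (forall l, finite_subset Om l -> sumR (fun x => Cmod (c x)) l <= r) ->
  ball r (fourier_series c) /\
  forall alpha, Om alpha -> fourier (fourier_series c) alpha = c alpha.
Proof.
intros Hr.
assert (Hb : ball r (fourier_series c)).
{ apply ball_limit. intros eps He.
  destruct (summable_tail Om _ r eps Hr He) as (l0 & Hl0 & Htail).
  exists (trig_poly c l0). split.
  - apply (ball_mono (sumR (fun x => Cmod (c x)) l0)).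
    + specialize (Hr l0 Hl0). lra.
    + apply trig_poly_ball. apply finite_subset_iff in Hl0. apply Hl0.
  - apply (fourier_series_approx c r eps l0 l0 Hr Htail Hl0 (incl_refl _)). }
split; [exact Hb |]. intros alpha Ha.
apply (proj2 (Ceq_minus _ _)). apply Cmod_eq_0. apply Rle_antisym; [| apply Cmod_ge_0].
apply le_epsilon. intros eps He.
destruct (summable_tail Om _ r eps Hr He) as (l0 & Hl0 & Htail).
(* The partial sum must contain [alpha] for its coefficient there to be [c alpha] already. *)
destruct (finite_subset_union Om l0 (alpha :: nil) Hl0) as (l & Hl & Hi & Hia).
{ apply finite_subset_iff. split; [repeat constructor; intros [] |].
  intros x [<- | []]. exact Ha. }
rewrite Rplus_0_l. replace (c alpha) with (fourier (trig_poly c l) alpha).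
- rewrite <- fourier_minus by (apply (ball_ap _ _ Hb) || apply trig_poly_ap).
  apply fourier_bound.
  + apply ap_minus; [apply (ball_ap _ _ Hb) | apply trig_poly_ap].
  + apply (fourier_series_approx c r eps l0 l Hr Htail Hl Hi).
- rewrite trig_poly_fourier by apply Hl.
  destruct (in_dec Req_EM_T alpha l) as [H | H]; [reflexivity |].
  exfalso. apply H, Hia. left. reflexivity.
Qed.

(** The point where the uniqueness theorem enters: all coefficients of the difference vanish, on
    [Om] by hypothesis and elsewhere by the spectral condition. *)
Lemma ball_fourier_ext (r s : R) (f g : R -> C) : ball r f -> ball s g ->
  (forall alpha, Om alpha -> fourier f alpha = fourier g alpha) -> forall x, f x = g x.
Proof.
intros Hf Hg E x.
assert (Hz : forall x, (f x - g x)%C = 0%C).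
{ apply ap_fourier_zero.
  - apply ap_minus; [apply (ball_ap _ _ Hf) | apply (ball_ap _ _ Hg)].
  - intros alpha. rewrite fourier_minus by (apply (ball_ap _ _ Hf) || apply (ball_ap _ _ Hg)).
    apply A_ball_iff in Hf, Hg. destruct (classic (Om alpha)) as [Ha | Ha].
    + rewrite E by exact Ha. ring.
    + rewrite (proj1 (proj2 Hf) alpha Ha), (proj1 (proj2 Hg) alpha Ha). ring. }
apply (proj2 (Ceq_minus _ _)). apply Hz.
Qed.

(** The series has the coefficients of [f], hence is [f]. This turns information on coefficients
    into information on values. *)
Lemma ball_series (r : R) (f : R -> C) : ball r f ->
  forall x, f x = fourier_series (fourier f) x.
Proof.
intros Hf. pose proof (proj1 (A_ball_iff _ _ _) Hf) as (_ & _ & Hs).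
destruct (fourier_series_ball (fourier f) r Hs) as [Hb Hc].
apply (ball_fourier_ext r r); [exact Hf | exact Hb |]. intros alpha Ha.
symmetry. apply Hc, Ha.
Qed.

Lemma ball_approx (r eps : R) (f : R -> C) : ball r f -> 0 < eps ->
  exists l, finite_subset Om l /\
    (forall x, Cmod (f x - trig_poly (fourier f) l x)%C <= eps) /\
    ball eps (fun x => f x - trig_poly (fourier f) l x)%C.
Proof.
intros Hf He. pose proof (proj1 (A_ball_iff _ _ _) Hf) as (Hap & Hsp & Hs).
destruct (summable_tail Om _ r eps Hs He) as (l & Hl & Htail).
exists l. split; [exact Hl |]. split.
- intros x. rewrite (ball_series r f Hf x) at 1.
  apply (fourier_series_approx _ r eps l l Hs Htail Hl (incl_refl _)).
- pose proof (trig_poly_ap (fourier f) l) as Hta.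
  pose proof (proj1 (finite_subset_iff _ _) Hl) as [Hnd Hin].
  assert (E : forall alpha, fourier (fun x => f x - trig_poly (fourier f) l x)%C alpha
    = if in_dec Req_EM_T alpha l then 0%C else fourier f alpha).
  { intros alpha. rewrite fourier_minus, trig_poly_fourier by assumption.
    destruct (in_dec Req_EM_T alpha l); ring. }
  apply A_ball_iff. split; [apply ap_minus; assumption | split].
  + intros alpha Ha. rewrite E, (Hsp alpha Ha). destruct (in_dec Req_EM_T alpha l); reflexivity.
  + intros l' Hl'. rewrite (finite_sum_inter _ l' l).
    assert (E1 : sumR (fun alpha => Cmod (fourier (fun x => f x - trig_poly (fourier f) l x)%C alpha))
      (inter_list l' l) = 0).
    { rewrite (finite_sum_ext _ (fun _ => 0)); [rewrite sumR_const; apply Rmult_0_r |].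
      intros alpha Ha. apply in_inter_list in Ha. rewrite E.
      destruct (in_dec Req_EM_T alpha l); [apply Cmod_0 | tauto]. }
    rewrite E1. change (plus 0 ?y) with (0 + y). rewrite Rplus_0_l.
    rewrite (finite_sum_ext _ (fun alpha => Cmod (fourier f alpha))).
    * apply Htail; [apply diff_list_subset, Hl' |].
      intros x Hx. apply in_diff_list in Hx. apply Hx.
    * intros alpha Ha. apply in_diff_list in Ha. rewrite E.
      destruct (in_dec Req_EM_T alpha l); [tauto | reflexivity].
Qed.

Lemma trig_poly_fourier_ball (r : R) (f : R -> C) (l : list R) : ball r f ->
  finite_subset Om l -> ball r (trig_poly (fourier f) l).
Proof.
intros Hf Hl. apply A_ball_iff in Hf.
apply (ball_mono (sumR (fun x => Cmod (fourier f x)) l)); [apply Hf, Hl |].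
apply trig_poly_ball. apply finite_subset_iff in Hl. apply Hl.
Qed.

(** Follows from approximation by partial sums of the series of [f], so it rests on uniqueness. It
    yields pointwise limits from convergence in norm. *)
Lemma ball_sup (r : R) (f : R -> C) : ball r f -> forall x, Cmod (f x) <= r.
Proof.
intros Hf x. apply le_epsilon. intros eps He.
destruct (ball_approx r eps f Hf He) as (l & Hl & Hx & _).
pose proof (Cmod_le_add (f x) (trig_poly (fourier f) l x)). specialize (Hx x).
pose proof (trig_poly_bound (fourier f) l x).
apply A_ball_iff in Hf. pose proof (proj2 (proj2 Hf) l Hl). lra.
Qed.

(** * The frequency group; products and conjugates *)

Lemma sum_n_stationary (a : nat -> R) (N : nat) : (forall j, (N < j)%nat -> a j = 0) ->
  forall M, (N <= M)%nat -> sum_n a M = sum_n a N.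
Proof.
intros H M HM. induction HM as [| M HM IH]; [reflexivity |].
rewrite sum_Sn, IH, H by lia. apply Rplus_0_r.
Qed.

Lemma Omega_0 : Om 0.
Proof.
exists (fun _ => 0%Z), O. split; [reflexivity |]. rewrite sum_O. ring.
Qed.

Lemma Omega_plus (a b : R) : Om a -> Om b -> Om (a + b).
Proof.
intros (n & N & Hn & ->) (m & M & Hm & ->).
exists (fun j => (n j + m j)%Z), (Nat.max N M). split.
- intros j Hj. rewrite Hn, Hm by lia. reflexivity.
- rewrite <- (sum_n_stationary _ N) with (M := Nat.max N M)
    by (lia || (intros j Hj; rewrite Hn by exact Hj; apply Rmult_0_l)).
  rewrite <- (sum_n_stationary (fun j => IZR (m j) * omega j) M) with (M := Nat.max N M)
    by (lia || (intros j Hj; rewrite Hm by exact Hj; apply Rmult_0_l)).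
  rewrite <- (sum_n_plus (G := R_AbelianMonoid)). apply sum_n_ext. intros j. rewrite plus_IZR.
  unfold plus; simpl. ring.
Qed.

Lemma Omega_opp (a : R) : Om a -> Om (- a).
Proof.
intros (n & N & Hn & ->). exists (fun j => (- n j)%Z), N. split.
- intros j Hj. rewrite Hn by exact Hj. reflexivity.
- clear Hn. induction N as [| N IH].
  + rewrite !sum_O, opp_IZR. ring.
  + rewrite !sum_Sn, <- IH, opp_IZR. unfold plus; simpl. ring.
Qed.

(** A product of characters is a character with frequency in the group [Om], so subadditivity over
    the double sum replaces any convolution of coefficients. *)
Lemma trig_poly_mult_ball (c d : R -> C) (l l' : list R) :
  (forall x, In x l -> Om x) -> (forall x, In x l' -> Om x) ->
  ball (sumR (fun x => Cmod (c x)) l * sumR (fun x => Cmod (d x)) l')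
    (fun x => trig_poly c l x * trig_poly d l' x)%C.
Proof.
intros Hl Hl'. induction l as [| a l IH].
- apply (ball_ext _ (fun _ => 0%C)).
  + intros x. rewrite trig_poly_nil. ring.
  + apply ball_zero. rewrite !sumR_nil. lra.
- assert (Ha : ball (Cmod (c a) * sumR (fun x => Cmod (d x)) l')
     (fun x => (c a * cis (a * x)) * trig_poly d l' x)%C).
  { assert (Hla : Om a) by (apply Hl; left; reflexivity). clear IH Hl.
    induction l' as [| b l' IH].
    - apply (ball_ext _ (fun _ => 0%C)).
      + intros x. rewrite trig_poly_nil. ring.
      + apply ball_zero. rewrite !sumR_nil. lra.
    - apply (ball_mono (Cmod (c a * d b)%C + Cmod (c a) * sumR (fun x => Cmod (d x)) l')).
      + rewrite Cmod_mult, sumR_cons. lra.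
      + eapply ball_ext; [| apply (ball_plus _ _ _ _
          (ball_char (c a * d b)%C (a + b)
            (Omega_plus a b Hla (Hl' b (or_introl eq_refl))))
          (IH (fun x Hx => Hl' x (or_intror Hx))))].
        intros x. rewrite trig_poly_cons.
        replace ((a + b) * x) with (a * x + b * x) by ring. rewrite cis_plus. ring. }
  apply (ball_mono (Cmod (c a) * sumR (fun x => Cmod (d x)) l' +
    sumR (fun x => Cmod (c x)) l * sumR (fun x => Cmod (d x)) l')).
  + rewrite sumR_cons. lra.
  + eapply ball_ext; [| apply (ball_plus _ _ _ _ Ha
      (IH (fun x Hx => Hl x (or_intror Hx))))].
    intros x. rewrite trig_poly_cons. ring.
Qed.

(** The factors converge uniformly and are bounded, so the product of their partial sums converges
    uniformly while its norm stays below [r * s]. *)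
Lemma ball_mult (r s : R) (f g : R -> C) : ball r f -> ball s g ->
  ball (r * s) (fun x => f x * g x)%C.
Proof.
intros Hf Hg. apply ball_limit. intros eps He.
pose proof (ball_nonneg _ _ Hf) as Hr. pose proof (ball_nonneg _ _ Hg) as Hs0.
destruct (Rmult_bound_eps (s + r) eps ltac:(lra) He) as (e & He1 & He2).
destruct (ball_approx r e f Hf He1) as (l & Hl & Hlx & _).
destruct (ball_approx s e g Hg He1) as (l' & Hl' & Hlx' & _).
exists (fun x => trig_poly (fourier f) l x * trig_poly (fourier g) l' x)%C. split.
- apply (ball_mono (sumR (fun x => Cmod (fourier f x)) l * sumR (fun x => Cmod (fourier g x)) l')).
  + apply Rle_trans with (r * s); [| lra].
    apply A_ball_iff in Hf, Hg.
    apply Rmult_le_compat; [| | apply Hf, Hl | apply Hg, Hl'];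
      apply sumR_ge_0; intros; apply Cmod_ge_0.
  + apply trig_poly_mult_ball; [apply finite_subset_iff in Hl | apply finite_subset_iff in Hl'];
      tauto.
- intros x. eapply Rle_trans; [apply Cmod_mult_sub |].
  pose proof (ball_sup _ _ (trig_poly_fourier_ball r f l Hf Hl) x).
  pose proof (ball_sup _ _ Hg x).
  assert (Cmod (f x - trig_poly (fourier f) l x) * Cmod (g x) <= e * s)
    by (apply Rmult_le_compat; try apply Cmod_ge_0; auto).
  assert (Cmod (trig_poly (fourier f) l x) * Cmod (g x - trig_poly (fourier g) l' x) <= r * e)
    by (apply Rmult_le_compat; try apply Cmod_ge_0; auto).
  lra.
Qed.

Lemma ball_conj (r : R) (f : R -> C) : ball r f -> ball r (fun x => Cconj (f x)).
Proof.
intros Hf. apply ball_limit. intros eps He.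
destruct (ball_approx r eps f Hf He) as (l & Hl & Hlx & _).
exists (fun x => Cconj (trig_poly (fourier f) l x)). split.
- apply (ball_mono (sumR (fun x => Cmod (fourier f x)) l)).
  + apply A_ball_iff in Hf. pose proof (proj2 (proj2 Hf) l Hl). lra.
  + apply finite_subset_iff in Hl. destruct Hl as [_ Hl]. clear Hlx.
    induction l as [| a l IH].
    * apply (ball_ext _ (fun _ => 0%C)).
      -- intros x. rewrite trig_poly_nil. unfold Cconj, RtoC; simpl. f_equal. ring.
      -- apply ball_zero. simpl. apply Rle_refl.
    * apply (ball_mono (Cmod (Cconj (fourier f a)) + sumR (fun x => Cmod (fourier f x)) l)).
      -- rewrite Cmod_conj. simpl. apply Rle_refl.
      -- eapply ball_ext; [| apply (ball_plus _ _ _ _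
          (ball_char (Cconj (fourier f a)) (- a) (Omega_opp a (Hl a (or_introl eq_refl))))
          (IH (fun x Hx => Hl x (or_intror Hx))))].
         intros x. rewrite trig_poly_cons, Cplus_conj, Cmult_conj, cis_conj.
         replace (- (a * x)) with (- a * x) by ring. reflexivity.
- intros x. specialize (Hlx x). rewrite <- Cmod_conj in Hlx. rewrite Cminus_conj in Hlx. exact Hlx.
Qed.

End Wiener.

(** * The Schrodinger group and Duhamel integrals *)

Section Flow.
Context (omega : nat -> R).
Notation Om := (Omega omega).
Notation ball := (A_ball omega).
Notation sch := (schrodinger_group omega).

(** The norm itself, as a smallest radius. Integral estimates need it: the radius at one node has to
    be compared with the bounds at all neighbouring times. *)
Lemma ball_least (r : R) (f : R -> C) : ball r f ->
  exists nu, ball nu f /\ forall s, ball s f -> nu <= s.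
Proof.
intros Hf. pose proof (proj1 (A_ball_iff _ _ _) Hf) as (H1 & H2 & H3).
destruct (completeness (fun s => exists l, finite_subset Om l /\
  s = sumR (fun alpha => Cmod (fourier f alpha)) l)) as [m [Hub Hlub]].
- exists r. intros s (l & Hl & ->). apply H3, Hl.
- exists (sumR (fun alpha => Cmod (fourier f alpha)) nil), nil.
  split; [split; constructor | reflexivity].
- exists m. split.
  + apply A_ball_iff. split; [exact H1 | split; [exact H2 |]].
    intros l Hl. apply Hub. exists l. split; [exact Hl | reflexivity].
  + intros s Hs. apply Hlub. intros q (l & Hl & ->). apply A_ball_iff in Hs. apply Hs, Hl.
Qed.

Lemma sch_spec (t r : R) (f : R -> C) : ball r f ->
  ball r (sch t f) /\
  forall alpha, Om alpha -> fourier (sch t f) alpha = (fourier f alpha * cis (- alpha ^ 2 * t))%C.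
Proof.
intros Hf. apply A_ball_iff in Hf. destruct Hf as (_ & _ & H3).
apply (fourier_series_ball omega (fun alpha => (fourier f alpha * cis (- alpha ^ 2 * t))%C)).
intros l Hl. eapply Rle_trans; [| apply (H3 l Hl)]. apply sumR_le. intros x _.
rewrite Cmod_mult, Cmod_cis. lra.
Qed.

Lemma sch_ball (t r : R) (f : R -> C) : ball r f -> ball r (sch t f).
Proof. intros Hf. apply (sch_spec t r f Hf). Qed.

(** Additivity is verified on coefficients and transferred to values by uniqueness. *)
Lemma sch_minus (t r s : R) (f g : R -> C) (x : R) : ball r f -> ball s g ->
  sch t (fun y => f y - g y)%C x = (sch t f x - sch t g x)%C.
Proof.
intros Hf Hg.
destruct (sch_spec t _ _ Hf) as [Bf Ef]. destruct (sch_spec t _ _ Hg) as [Bg Eg].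
destruct (sch_spec t _ _ (ball_minus omega _ _ _ _ Hf Hg)) as [Bd Ed].
apply (ball_fourier_ext omega _ _ _ (fun x => sch t f x - sch t g x)%C Bd
  (ball_minus omega _ _ _ _ Bf Bg)).
intros alpha Ha.
pose proof (ball_ap omega _ _ Hf). pose proof (ball_ap omega _ _ Hg).
pose proof (ball_ap omega _ _ Bf). pose proof (ball_ap omega _ _ Bg).
rewrite Ed, !fourier_minus by assumption.
rewrite Ef, Eg by exact Ha. ring.
Qed.

Lemma sch_minus_ball (t r r1 r2 : R) (f g : R -> C) : ball r1 f -> ball r2 g ->
  ball r (fun x => f x - g x)%C -> ball r (fun x => sch t f x - sch t g x)%C.
Proof.
intros Hf Hg Hd. eapply ball_ext; [| apply (sch_ball t _ _ Hd)].
intros x. apply (sch_minus t r1 r2); assumption.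
Qed.

(** The frequencies are unbounded, so the flow need not be Lipschitz in time. A finite part of the
    spectrum is, with constant the sum of [|coefficient| * alpha^2], and the tail costs at most
    twice its norm, hence the [eps / 2]. *)
Lemma sch_time_modulus (r eps : R) (f : R -> C) : ball r f -> 0 < eps ->
  exists K, 0 <= K /\ forall a b,
    ball (eps + K * Rabs (a - b)) (fun x => sch a f x - sch b f x)%C.
Proof.
intros Hf He. pose proof (proj1 (A_ball_iff _ _ _) Hf) as (_ & _ & H3).
destruct (summable_tail Om _ r (eps / 2) H3 ltac:(lra)) as (l0 & Hl0 & Htail).
set (w := fun alpha => Cmod (fourier f alpha) * alpha ^ 2).
assert (Hw : forall x, 0 <= w x).
{ intros x. apply Rmult_le_pos; [apply Cmod_ge_0 | apply pow2_ge_0]. }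
exists (sumR w l0). split; [apply sumR_ge_0; intros; apply Hw |]. intros a b.
destruct (sch_spec a _ _ Hf) as [Ba Ea]. destruct (sch_spec b _ _ Hf) as [Bb Eb].
pose proof (ball_ap omega _ _ Ba) as Pa. pose proof (ball_ap omega _ _ Bb) as Pb.
assert (E : forall alpha, Om alpha -> fourier (fun x => sch a f x - sch b f x)%C alpha =
  (fourier f alpha * (cis (- alpha ^ 2 * a) - cis (- alpha ^ 2 * b)))%C).
{ intros alpha Ha. rewrite fourier_minus, Ea, Eb by assumption. ring. }
apply A_ball_iff. split; [apply ap_minus; assumption | split].
- intros alpha Ha. rewrite fourier_minus by assumption.
  apply A_ball_iff in Ba, Bb.
  rewrite (proj1 (proj2 Ba) alpha Ha), (proj1 (proj2 Bb) alpha Ha). ring.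
- intros l Hl. rewrite (finite_sum_inter _ l l0).
  pose proof (proj1 (finite_subset_iff _ _) Hl) as [Hnd Hin].
  pose proof (inter_list_subset _ l l0 Hl) as Hi.
  pose proof (diff_list_subset _ l l0 Hl) as Hd.
  assert (H1 : sumR (fun alpha => Cmod (fourier (fun x => sch a f x - sch b f x)%C alpha))
     (inter_list l l0) <= sumR w l0 * Rabs (a - b)).
  { apply Rle_trans with (sumR (fun x => Rabs (a - b) * w x) (inter_list l l0)).
    - apply sumR_le. intros x Hx. apply in_inter_list in Hx.
      rewrite E by (apply Hin, Hx). rewrite Cmod_mult.
      pose proof (cis_lip (- x ^ 2 * b) (- x ^ 2 * a)) as Hc.
      replace (- x ^ 2 * a - - x ^ 2 * b) with (- x ^ 2 * (a - b)) in Hc by ring.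
      rewrite Rabs_mult, Rabs_Ropp, (Rabs_pos_eq (x ^ 2)) in Hc by apply pow2_ge_0.
      unfold w. apply (Rmult_le_compat_l (Cmod (fourier f x))) in Hc; [| apply Cmod_ge_0].
      lra.
    - rewrite sumR_scal, Rmult_comm. apply Rmult_le_compat_r; [apply Rabs_pos |].
      apply sumR_incl; [apply Hi | apply Hl0 | | intros; apply Hw].
      intros x Hx. apply in_inter_list in Hx. apply Hx. }
  assert (H2 : sumR (fun alpha => Cmod (fourier (fun x => sch a f x - sch b f x)%C alpha))
     (diff_list l l0) <= eps).
  { apply Rle_trans with (sumR (fun x => 2 * Cmod (fourier f x)) (diff_list l l0)).
    - apply sumR_le. intros x Hx. apply in_diff_list in Hx.
      rewrite E by (apply Hin, Hx). rewrite Cmod_mult, Rmult_comm.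
      apply Rmult_le_compat_r; [apply Cmod_ge_0 |].
      pose proof (Cmod_triangle (cis (- x ^ 2 * a)) (- cis (- x ^ 2 * b))) as Hc.
      rewrite Cmod_opp, !Cmod_cis in Hc. unfold Cminus. lra.
    - rewrite sumR_scal.
      assert (sumR (fun x => Cmod (fourier f x)) (diff_list l l0) <= eps / 2); [| lra].
      apply Htail; [exact Hd |]. intros x Hx. apply in_diff_list in Hx. apply Hx. }
  apply Rle_trans with (sumR w l0 * Rabs (a - b) + eps); [apply Rplus_le_compat |]; lra.
Qed.

(** Continuity into the algebra at every real time, so that time integrals have continuous
    integrands everywhere; data on [[-T, T]] are brought to this form by [clamp]. *)
Definition cpath (G : R -> R -> C) : Prop :=
  (forall s, exists r, ball r (G s)) /\
  forall s eps, 0 < eps -> exists d, 0 < d /\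
    forall s', Rabs (s' - s) < d -> ball eps (fun x => G s' x - G s x)%C.

Lemma cpath_bounded (G : R -> R -> C) (a b : R) : cpath G ->
  exists M, 0 < M /\ forall s, a <= s <= b -> ball M (G s).
Proof.
intros [H1 H2].
destruct (compact_uniform a b (fun s M => ball M (G s))) as [M HM].
- intros t C C' HC. apply ball_mono, HC.
- intros t0 _. destruct (H1 t0) as [r Hr]. destruct (H2 t0 1 Rlt_0_1) as (d & Hd & Hs).
  exists d, (1 + r). split; [exact Hd |]. intros t _ Ht.
  eapply ball_ext; [| apply (ball_plus omega _ _ _ _ (Hs t Ht) Hr)].
  intros x. simpl. ring.
- exists (Rmax M 1). split; [eapply Rlt_le_trans; [apply Rlt_0_1 | apply Rmax_r] |].
  intros s Hs. eapply ball_mono; [apply Rmax_l | apply HM, Hs].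
Qed.

Lemma cpath_uniform (G : R -> R -> C) (a b eps : R) : cpath G -> 0 < eps ->
  exists d, 0 < d /\ forall s s', a <= s <= b -> Rabs (s' - s) < d ->
    ball eps (fun x => G s' x - G s x)%C.
Proof.
intros [H1 H2] He.
destruct (compact_uniform a b (fun x K => 0 < K /\ forall y, Rabs (y - x) * K < 1 ->
   ball eps (fun z => G y z - G x z)%C)) as [K HK].
- intros t C C' HC [Hc1 Hc2]. split; [lra |]. intros y Hy. apply Hc2.
  pose proof (Rabs_pos (y - t)). nra.
- intros t0 _.
  destruct (H2 t0 (eps / 2) ltac:(lra)) as (d & Hd & H).
  exists (d / 2), (2 / d). split; [lra |]. intros t _ Ht.
  assert (HK : 0 < 2 / d) by (apply Rdiv_lt_0_compat; lra).
  split; [exact HK |]. intros y Hy.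
  assert (Rabs (y - t) < d / 2).
  { apply (Rmult_lt_reg_r (2 / d)); [exact HK |]. field_simplify; lra. }
  assert (Rabs (y - t0) < d).
  { replace (y - t0) with ((y - t) + (t - t0)) by ring.
    pose proof (Rabs_triang (y - t) (t - t0)). lra. }
  apply (ball_mono omega (eps / 2 + eps / 2)); [lra |].
  apply (ball_sub_triangle omega _ _ _ (G t0)); [apply H; lra | apply ball_sub_sym, H; lra].
- destruct (Rlt_dec 0 K) as [HK0 | HK0].
  + exists (/ K). split; [apply Rinv_0_lt_compat, HK0 |].
    intros x y Hx Hy. apply (HK x Hx).
    apply (Rmult_lt_compat_r K) in Hy; [| exact HK0]. rewrite Rinv_l in Hy; lra.
  + exists 1. split; [lra |]. intros x y Hx. destruct (HK x Hx). lra.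
Qed.

Lemma cpath_contC (G : R -> R -> C) (x : R) : cpath G -> contC (fun s => G s x).
Proof.
intros [_ H] s. apply continuous_C_eps. intros eps He.
destruct (H s (eps / 2) ltac:(lra)) as (d & Hd & Hs). exists d. split; [exact Hd |].
intros y Hy. pose proof (ball_sup omega _ _ (Hs y Hy) x). simpl in H0. lra.
Qed.

(** The integral is approximated, uniformly in [x], by step sums, whose norm is controlled
    because the norm of [G] at a node is almost at most [g] on the whole cell. *)
Lemma ball_CInt_le (G : R -> R -> C) (g : R -> R) (a b : R) : cpath G -> a <= b ->
  (forall s, continuous g s) -> (forall s, a <= s <= b -> ball (g s) (G s)) ->
  ball (RInt g a b) (fun x => CInt (fun s => G s x) a b).
Proof.
intros HG Hab Hg Hb. apply ball_limit. intros eps He.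
destruct (Rmult_bound_eps (b - a) eps ltac:(lra) He) as (e & He1 & He2).
destruct (cpath_uniform G a b e HG He1) as (d & Hd & Hu).
destruct (nfloor_ex ((b - a) / d)) as [n Hn].
{ apply Rdiv_le_0_compat; lra. }
(* One cell more than the integer part of [(b - a) / d] makes the mesh strictly smaller than [d]. *)
set (N := S n). assert (HN : 0 < INR N) by (apply lt_0_INR; unfold N; lia).
set (h := (b - a) / INR N).
assert (Hh0 : 0 <= h) by (apply Rdiv_le_0_compat; lra).
assert (Hhd : h < d).
{ unfold h. apply Rlt_div_l; [exact HN |]. unfold N. rewrite S_INR.
  replace (b - a) with ((b - a) / d * d) by (field; lra). nra. }
assert (HNh : a + INR N * h = b) by (unfold h; field; lra).
assert (Hcont : forall x, contC (fun s => G s x)) by (intros; apply cpath_contC, HG).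
assert (Hgi : forall u v, ex_RInt g u v).
{ intros u v. apply (ex_RInt_continuous (V := R_CompleteNormedModule)). intros z _. apply Hg. }
assert (Hk : forall k, (k <= N)%nat -> exists Rk,
  ball (RInt g a (a + INR k * h) + INR k * (h * e)) Rk /\
  forall x, Cmod (CInt (fun s => G s x) a (a + INR k * h) - Rk x)%C <= INR k * (h * e)).
{ induction k as [| k IH]; intros HkN.
  - exists (fun _ => 0%C). simpl INR. rewrite !Rmult_0_l, !Rplus_0_r, RInt_point. split.
    + apply ball_zero. unfold zero; simpl. lra.
    + intros x. rewrite CInt_point. replace (0 - 0)%C with (RtoC 0) by ring.
      rewrite Cmod_0. lra.
  - destruct (IH ltac:(lia)) as (Rk & HRk & Hx).
    set (y := a + INR k * h) in *.
    replace (a + INR (S k) * h) with (y + h) by (rewrite S_INR; unfold y; ring).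
    assert (Hky : a <= y /\ y + h <= b).
    { unfold y. pose proof (pos_INR k). split; [nra |].
      apply le_INR in HkN. rewrite S_INR in HkN.
      replace (a + INR k * h + h) with (a + (INR k + 1) * h) by ring.
      rewrite <- HNh. apply Rplus_le_compat_l, Rmult_le_compat_r; assumption. }
    destruct (proj1 HG y) as [r Hr]. destruct (ball_least r (G y) Hr) as (nu & Hnu & Hleast).
    assert (Hnug : h * nu <= RInt g y (y + h) + h * e).
    { replace (h * nu) with (RInt (fun _ => nu) y (y + h))
        by (rewrite RInt_const; unfold scal; simpl; unfold mult; simpl; ring).
      replace (RInt g y (y + h) + h * e)
        with (RInt g y (y + h) + RInt (fun _ => e) y (y + h))
        by (rewrite RInt_const; unfold scal; simpl; unfold mult; simpl; ring).
      rewrite <- (RInt_plus (V := R_CompleteNormedModule)); [| apply Hgi | apply ex_RInt_const].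
      apply RInt_le; [lra | apply ex_RInt_const | |].
      - apply (ex_RInt_plus (V := R_NormedModule)); [apply Hgi | apply ex_RInt_const].
      - intros s Hs. apply Hleast.
        assert (H1 : ball (g s) (G s)) by (apply Hb; lra).
        assert (H2 : ball e (fun x => G s x - G y x)%C).
        { apply Hu; [lra |]. rewrite Rabs_pos_eq; lra. }
        eapply ball_ext; [| apply (ball_minus omega _ _ _ _ H1 H2)].
        intros x. simpl. ring. }
    exists (fun x => Rk x + RtoC h * G y x)%C. split.
    + apply (ball_mono omega ((RInt g a y + INR k * (h * e)) + Cmod (RtoC h) * nu)).
      * rewrite Cmod_R, Rabs_pos_eq by exact Hh0.
        rewrite <- (RInt_Chasles (V := R_CompleteNormedModule) g a y (y + h)) by apply Hgi.
        rewrite S_INR. unfold plus; simpl. lra.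
      * apply ball_plus; [exact HRk | apply ball_scal, Hnu].
    + intros x. rewrite (CInt_Chasles _ a y (y + h) (Hcont x)).
      assert (Hcell : Cmod (CInt (fun s => G s x) y (y + h) - RtoC h * G y x)%C <= h * e).
      { replace (RtoC h * G y x)%C with (CInt (fun _ => G y x) y (y + h))
          by (rewrite CInt_const; f_equal; f_equal; ring).
        rewrite <- (CInt_minus (fun s => G s x) (fun _ => G y x) y (y + h)
          (Hcont x) (contC_const _)).
        replace (h * e) with ((y + h - y) * e) by ring.
        apply CInt_bound; [| lra |].
        - intros s. apply (continuous_minus (V := C_R_NormedModule) (fun s => G s x));
            [apply Hcont | apply continuous_const].
        - intros s Hs. apply (ball_sup omega e (fun x => G s x - G y x)%C).
          apply Hu; [lra |]. rewrite Rabs_pos_eq; lra. }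
      replace (CInt (fun s => G s x) a y + CInt (fun s => G s x) y (y + h)
          - (Rk x + RtoC h * G y x))%C
        with ((CInt (fun s => G s x) a y - Rk x) +
          (CInt (fun s => G s x) y (y + h) - RtoC h * G y x))%C by ring.
      eapply Rle_trans; [apply Cmod_triangle |]. specialize (Hx x). rewrite S_INR. lra. }
destruct (Hk N (le_n _)) as (Rk & H1 & H2). rewrite HNh in *.
assert (Hsmall : INR N * (h * e) <= eps).
{ replace (INR N * (h * e)) with ((b - a) * e) by (unfold h; field; lra). lra. }
exists Rk. split.
- eapply ball_mono; [| exact H1]. lra.
- intros x. eapply Rle_trans; [apply H2 | exact Hsmall].
Qed.

(** A time-dependent bound [g] is allowed because the exponential weight in the uniqueness proof
    requires it; the absolute value covers negative times. *)
Lemma ball_CInt (G : R -> R -> C) (g : R -> R) (a b : R) : cpath G ->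
  (forall s, continuous g s) -> (forall s, Rmin a b <= s <= Rmax a b -> ball (g s) (G s)) ->
  ball (Rabs (RInt g a b)) (fun x => CInt (fun s => G s x) a b).
Proof.
intros HG Hg Hb. destruct (Rle_dec a b) as [H | H].
- rewrite Rmin_left, Rmax_right in Hb by exact H.
  eapply ball_mono; [apply Rle_abs | apply ball_CInt_le; assumption].
- rewrite Rmin_right, Rmax_left in Hb by lra.
  assert (E : RInt g a b = - RInt g b a).
  { symmetry. apply (opp_RInt_swap (V := R_CompleteNormedModule)).
    apply (ex_RInt_continuous (V := R_CompleteNormedModule)). intros z _. apply Hg. }
  rewrite E, Rabs_Ropp.
  eapply ball_ext; [| apply (ball_mono omega (Cmod (-1)%C * RInt g b a));
     [| apply ball_scal; apply (ball_CInt_le G g b a HG ltac:(lra) Hg Hb)]].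
  + intros x. simpl. rewrite (CInt_swap _ a b) by apply cpath_contC, HG. ring.
  + rewrite Cmod_minus_1, Rmult_1_l. apply Rle_abs.
Qed.

Lemma ball_CInt_const (G : R -> R -> C) (M a b : R) : cpath G -> 
  (forall s, Rmin a b <= s <= Rmax a b -> ball M (G s)) ->
  ball (Rabs (b - a) * M) (fun x => CInt (fun s => G s x) a b).
Proof.
intros HG Hb.
assert (HM : 0 <= M).
{ apply (ball_nonneg omega M (G a)), Hb. split; [apply Rmin_l | apply Rmax_l]. }
pose proof (ball_CInt G (fun _ => M) a b HG (fun s => continuous_const M s) Hb) as H.
rewrite RInt_const in H. unfold scal in H; simpl in H. unfold mult in H; simpl in H.
rewrite Rabs_mult, (Rabs_pos_eq M HM) in H. exact H.
Qed.

Lemma cpath_minus (F G : R -> R -> C) : cpath F -> cpath G ->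
  cpath (fun s x => F s x - G s x)%C.
Proof.
intros [F1 F2] [G1 G2]. split.
- intros s. destruct (F1 s) as [r Hr], (G1 s) as [q Hq]. exists (r + q). apply ball_minus; assumption.
- intros s eps He.
  destruct (F2 s (eps / 2) ltac:(lra)) as (d1 & Hd1 & H1).
  destruct (G2 s (eps / 2) ltac:(lra)) as (d2 & Hd2 & H2).
  exists (Rmin d1 d2). split; [apply Rmin_pos; assumption |]. intros s' Hs.
  pose proof (H1 s' (Rlt_le_trans _ _ _ Hs (Rmin_l _ _))) as K1.
  pose proof (H2 s' (Rlt_le_trans _ _ _ Hs (Rmin_r _ _))) as K2.
  apply (ball_mono omega (eps / 2 + eps / 2)); [lra |].
  eapply ball_ext; [| apply (ball_minus omega _ _ _ _ K1 K2)]. intros x. simpl. ring.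
Qed.

Lemma cpath_scal (c : C) (F : R -> R -> C) : cpath F -> cpath (fun s x => c * F s x)%C.
Proof.
intros [F1 F2]. split.
- intros s. destruct (F1 s) as [r Hr]. eexists. apply ball_scal, Hr.
- intros s eps He.
  destruct (Rmult_bound_eps (Cmod c) eps (Cmod_ge_0 c) He) as (e & He1 & He2).
  destruct (F2 s e He1) as (d & Hd & H). exists d. split; [exact Hd |]. intros s' Hs.
  apply (ball_mono omega (Cmod c * e)); [lra |].
  eapply ball_ext; [| apply (ball_scal omega c _ _ (H s' Hs))]. intros x. simpl. ring.
Qed.

Lemma cpath_comp (F : R -> R -> C) (k : R -> R) :
  (forall s s', Rabs (k s' - k s) <= Rabs (s' - s)) -> cpath F -> cpath (fun s => F (k s)).
Proof.
intros Hk [F1 F2]. split; [intros s; apply F1 |]. intros s eps He.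
destruct (F2 (k s) eps He) as (d & Hd & H). exists d. split; [exact Hd |]. intros s' Hs.
apply H. eapply Rle_lt_trans; [apply Hk | exact Hs].
Qed.

(** The increment is split as the flow at the new time applied to [F s' - F s], controlled by
    contractivity, plus the change of flow on the fixed function [F s]. *)
Lemma cpath_sch (F : R -> R -> C) (t : R) : cpath F -> cpath (fun s => sch (t - s) (F s)).
Proof.
intros [F1 F2]. split.
- intros s. destruct (F1 s) as [r Hr]. exists r. apply sch_ball, Hr.
- intros s eps He. destruct (F1 s) as [r Hr].
  destruct (F2 s (eps / 3) ltac:(lra)) as (d1 & Hd1 & H1).
  destruct (sch_time_modulus r (eps / 3) (F s) Hr ltac:(lra)) as (K & HK & HL).
  destruct (Rmult_bound_eps K (eps / 3) HK ltac:(lra)) as (d2 & Hd2 & HKd).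
  exists (Rmin d1 d2). split; [apply Rmin_pos; assumption |]. intros s' Hs.
  pose proof (Rlt_le_trans _ _ _ Hs (Rmin_l _ _)) as Hs1.
  pose proof (Rlt_le_trans _ _ _ Hs (Rmin_r _ _)) as Hs2.
  destruct (F1 s') as [r' Hr'].
  apply (ball_mono omega (eps / 3 + (eps / 3 + K * Rabs (t - s' - (t - s))))).
  + replace (t - s' - (t - s)) with (- (s' - s)) by ring. rewrite Rabs_Ropp.
    assert (K * Rabs (s' - s) <= K * d2) by (apply Rmult_le_compat_l; lra). lra.
  + apply (ball_sub_triangle omega _ _ _ (sch (t - s') (F s))); [| apply HL].
    apply (sch_minus_ball _ _ r' r); [exact Hr' | exact Hr | apply H1, Hs1].
Qed.

Lemma cpath_sch_const (f : R -> C) (r : R) : ball r f -> cpath (fun s => sch s f).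
Proof.
intros Hf. split; [intros s; exists r; apply sch_ball, Hf |]. intros s eps He.
destruct (sch_time_modulus r (eps / 2) f Hf ltac:(lra)) as (K & HK & HL).
destruct (Rmult_bound_eps K (eps / 2) HK ltac:(lra)) as (d & Hd & HKd).
exists d. split; [exact Hd |]. intros s' Hs.
eapply ball_mono; [| apply HL].
assert (K * Rabs (s' - s) <= K * d) by (apply Rmult_le_compat_l; lra). lra.
Qed.

Lemma duhamel_ball (F : R -> R -> C) (g : R -> R) (t : R) : cpath F ->
  (forall s, continuous g s) -> (forall s, Rmin 0 t <= s <= Rmax 0 t -> ball (g s) (F s)) ->
  ball (Rabs (RInt g 0 t)) (duhamel omega F t).
Proof.
intros HF Hg Hb. apply (ball_CInt (fun s => sch (t - s) (F s)) g 0 t); [| exact Hg |].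
- apply cpath_sch, HF.
- intros s Hs. apply sch_ball, Hb, Hs.
Qed.

Lemma duhamel_minus (F G : R -> R -> C) (t x : R) : cpath F -> cpath G ->
  duhamel omega (fun s y => F s y - G s y)%C t x
  = (duhamel omega F t x - duhamel omega G t x)%C.
Proof.
intros HF HG. unfold duhamel.
rewrite <- CInt_minus by (apply (cpath_contC (fun s => sch (t - s) _)); apply cpath_sch; assumption).
apply CInt_ext. intros s _. destruct (proj1 HF s) as [r Hr], (proj1 HG s) as [q Hq].
apply (sch_minus _ r q); assumption.
Qed.

(** The increment is an integral over [[t, t']], small because the interval is short, plus an
    integral over [[0, t]] of the change of flow on [F s], which needs a time modulus uniform in
    [s]. *)
Lemma cpath_duhamel (F : R -> R -> C) : cpath F -> cpath (duhamel omega F).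
Proof.
intros HF. split.
- intros t. destruct (cpath_bounded F (Rmin 0 t) (Rmax 0 t) HF) as (M & _ & HM).
  exists (Rabs (t - 0) * M). apply (ball_CInt_const (fun s => sch (t - s) (F s))).
  + apply cpath_sch, HF.
  + intros s Hs. apply sch_ball, HM, Hs.
- intros t eps He. set (W := Rabs t + 1).
  destruct (cpath_bounded F (- W) W HF) as (M & HMpos & HM).
  destruct (Rmult_bound_eps (Rabs t) (eps / 2) (Rabs_pos t) ltac:(lra)) as (e & He1 & He2).
  (* Near [s0] the modulus of [F s0] serves for [F s] too, as the flow does not enlarge
     [F s - F s0]; three thirds of [e] add up. *)
  destruct (compact_uniform (- W) W (fun s K => forall a b,
    ball (e + K * Rabs (a - b)) (fun x => sch a (F s) x - sch b (F s) x)%C)) as [K0 HK0].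
  { intros s C C' HC H a b. eapply ball_mono; [| apply H].
    pose proof (Rabs_pos (a - b)). nra. }
  { intros s0 _. destruct (proj1 HF s0) as [r Hr].
    destruct (sch_time_modulus r (e / 3) (F s0) Hr ltac:(lra)) as (K & HK & HL).
    destruct (proj2 HF s0 (e / 3) ltac:(lra)) as (d & Hd & Hs).
    exists d, K. split; [exact Hd |]. intros s _ Hss a b.
    destruct (proj1 HF s) as [q Hq]. specialize (Hs s Hss).
    apply (ball_mono omega (e / 3 + ((e / 3 + K * Rabs (a - b)) + e / 3))); [lra |].
    apply (ball_sub_triangle omega _ _ _ (sch a (F s0)));
      [apply (sch_minus_ball _ _ q r); assumption |].
    apply (ball_sub_triangle omega _ _ _ (sch b (F s0))); [apply HL |].
    apply ball_sub_sym, (sch_minus_ball _ _ q r); assumption. }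
  (* Compactness says nothing on the sign of its constant. *)
  set (K := Rmax K0 0).
  assert (HK : forall s, - W <= s <= W -> forall a b,
    ball (e + K * Rabs (a - b)) (fun x => sch a (F s) x - sch b (F s) x)%C).
  { intros s Hs a b. eapply ball_mono; [| apply (HK0 s Hs)].
    apply Rplus_le_compat_l, Rmult_le_compat_r; [apply Rabs_pos | apply Rmax_l]. }
  assert (HKpos : 0 <= K) by apply Rmax_r.
  pose proof (Rabs_pos t) as Htp.
  destruct (Rmult_bound_eps (M + Rabs t * K) (eps / 2) ltac:(nra) ltac:(lra))
    as (d & Hd & HKd).
  exists (Rmin d 1). split; [apply Rmin_pos; lra |]. intros t' Ht'.
  pose proof (Rlt_le_trans _ _ _ Ht' (Rmin_l _ _)) as Hd1.
  pose proof (Rlt_le_trans _ _ _ Ht' (Rmin_r _ _)) as Hd2.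
  assert (Ht'W : Rabs t' <= W).
  { replace t' with ((t' - t) + t) by ring. unfold W.
    pose proof (Rabs_triang (t' - t) t). lra. }
  assert (HtW : Rabs t <= W) by (unfold W; lra).
  apply Rabs_le_between in Ht'W. apply Rabs_le_between in HtW.
  assert (H1 : ball (Rabs (t' - t) * M) (fun x => CInt (fun s => sch (t' - s) (F s) x) t t')).
  { apply (ball_CInt_const (fun s => sch (t' - s) (F s))); [apply cpath_sch, HF |].
    intros s Hs. apply sch_ball, HM. revert Hs. unfold Rmin, Rmax.
    destruct (Rle_dec t t'); lra. }
  assert (H2 : ball (Rabs (t - 0) * (e + K * Rabs (t' - t)))
    (fun x => CInt (fun s => sch (t' - s) (F s) x - sch (t - s) (F s) x)%C 0 t)).
  { apply (ball_CInt_const (fun s x => sch (t' - s) (F s) x - sch (t - s) (F s) x)%C).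
    - apply cpath_minus; apply cpath_sch, HF.
    - intros s Hs. replace (t' - t) with ((t' - s) - (t - s)) by ring. apply HK.
      revert Hs. unfold Rmin, Rmax. destruct (Rle_dec 0 t); lra. }
  eapply ball_ext; [| eapply ball_mono; [| apply (ball_plus omega _ _ _ _ H1 H2)]].
  + intros x. simpl. unfold duhamel.
    assert (Hc : forall t, contC (fun s => sch (t - s) (F s) x))
      by (intros t0; apply (cpath_contC (fun s => sch (t0 - s) (F s))), cpath_sch, HF).
    rewrite CInt_minus by apply Hc.
    rewrite (CInt_Chasles (fun s => sch (t' - s) (F s) x) 0 t t') by apply Hc. ring.
  + rewrite Rminus_0_r.
    assert (Rabs (t' - t) * (M + Rabs t * K) <= d * (M + Rabs t * K))
      by (apply Rmult_le_compat_r; [nra | lra]).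
    lra.
Qed.

End Flow.

(** * Local Lipschitz bounds for the nonlinearity *)

Section Nonlinearity.
Context (omega : nat -> R).
Notation ball := (A_ball omega).

Lemma ball_one : ball 1 (fun _ => 1%C).
Proof.
pose proof (ball_char omega 1%C 0 (Omega_0 omega)) as H. rewrite Cmod_1 in H.
revert H. apply ball_ext. intros x. rewrite Rmult_0_l, cis_0. ring.
Qed.

Lemma ball_mult_diff (a b c d : R) (f g h k : R -> C) :
  ball a g -> ball b h -> ball c (fun x => f x - h x)%C -> ball d (fun x => g x - k x)%C ->
  ball (c * a + b * d) (fun x => f x * g x - h x * k x)%C.
Proof.
intros Hg Hh Hfh Hgk.
eapply ball_ext; [| apply (ball_plus omega _ _ _ _ (ball_mult omega _ _ _ _ Hfh Hg)
  (ball_mult omega _ _ _ _ Hh Hgk))]. intros x. simpl. ring.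
Qed.

Lemma ball_pow (M : R) (n : nat) (u : R -> C) : ball M u -> ball (M ^ n) (fun x => u x ^ n)%C.
Proof.
intros Hu. induction n as [| n IH]; simpl; [apply ball_one |].
apply (ball_mult omega _ _ u); assumption.
Qed.

(** Induction on [u^(n+1) - v^(n+1) = (u - v) u^n + v (u^n - v^n)]. *)
Lemma ball_pow_diff (M : R) (n : nat) : 0 <= M -> exists L, 0 <= L /\ forall u v D,
  ball M u -> ball M v -> ball D (fun x => u x - v x)%C ->
  ball (L * D) (fun x => u x ^ n - v x ^ n)%C.
Proof.
intros HM. induction n as [| n (L & HL & IH)].
- exists 0. split; [lra |]. intros u v D _ _ _. simpl. rewrite Rmult_0_l.
  apply (ball_ext omega _ (fun _ => 0%C)); [intros x; ring | apply ball_zero; lra].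
- exists (M ^ n + M * L). split.
  { pose proof (pow_le M n HM). nra. }
  intros u v D Hu Hv Hd. simpl.
  replace ((M ^ n + M * L) * D) with (D * M ^ n + M * (L * D)) by ring.
  apply ball_mult_diff; [apply ball_pow, Hu | exact Hv | exact Hd | apply IH; assumption].
Qed.

Lemma nonlinearity_ball (p k : nat) (M : R) : 0 <= M ->
  exists Q L, 0 < Q /\ 0 < L /\
    (forall u, ball M u -> ball Q (fun x => nonlinearity p k (u x))) /\
    (forall u v D, ball M u -> ball M v -> ball D (fun x => u x - v x)%C ->
       ball (L * D) (fun x => nonlinearity p k (u x) - nonlinearity p k (v x))%C).
Proof.
intros HM.
destruct (ball_pow_diff M k HM) as (L1 & HL1 & H1).
destruct (ball_pow_diff M (p - k) HM) as (L2 & HL2 & H2).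
pose proof (pow_le M k HM). pose proof (pow_le M (p - k) HM).
(* The added [1] makes both constants positive, as the existence time divides by them. *)
exists (M ^ k * M ^ (p - k) + 1), (L1 * M ^ (p - k) + M ^ k * L2 + 1).
assert (0 <= M ^ k * M ^ (p - k)) by (apply Rmult_le_pos; assumption).
assert (0 <= L1 * M ^ (p - k)) by (apply Rmult_le_pos; assumption).
assert (0 <= M ^ k * L2) by (apply Rmult_le_pos; assumption).
split; [lra | split; [lra | split]].
- intros u Hu. apply (ball_mono omega (M ^ k * M ^ (p - k))); [lra |].
  apply ball_mult; [apply ball_pow, Hu | apply (ball_pow M _ (fun x => Cconj (u x)))].
  apply ball_conj, Hu.
- intros u v D Hu Hv Hd.
  pose proof (ball_nonneg omega _ _ Hd).
  apply (ball_mono omega ((L1 * D) * M ^ (p - k) + M ^ k * (L2 * D))); [nra |].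
  apply ball_mult_diff.
  + apply (ball_pow M _ (fun x => Cconj (u x))), ball_conj, Hu.
  + apply ball_pow, Hv.
  + apply H1; assumption.
  + apply (H2 (fun x => Cconj (u x)) (fun x => Cconj (v x)));
      [apply ball_conj, Hu | apply ball_conj, Hv |].
    eapply ball_ext; [| apply (ball_conj omega _ _ Hd)]. intros x. apply Cminus_conj.
Qed.

Lemma cpath_nonlinearity (p k : nat) (u : R -> R -> C) : cpath omega u ->
  cpath omega (fun t x => nonlinearity p k (u t x)).
Proof.
intros [U1 U2]. split.
- intros s. destruct (U1 s) as [r Hr].
  destruct (nonlinearity_ball p k r (ball_nonneg omega _ _ Hr)) as (Q & L & _ & _ & HQ & _).
  exists Q. apply HQ, Hr.
- intros s eps He. destruct (U1 s) as [r Hr].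
  pose proof (ball_nonneg omega _ _ Hr) as Hr0.
  destruct (nonlinearity_ball p k (1 + r) ltac:(lra)) as (Q & L & _ & HL & _ & HD).
  destruct (Rmult_bound_eps L eps ltac:(lra) He) as (e & He1 & He2).
  destruct (U2 s e He1) as (d1 & Hd1 & H1). destruct (U2 s 1 Rlt_0_1) as (d2 & Hd2 & H2).
  exists (Rmin d1 d2). split; [apply Rmin_pos; assumption |]. intros s' Hs.
  apply (ball_mono omega (L * e)); [lra |]. apply HD.
  + eapply ball_ext; [| apply (ball_plus omega _ _ _ _
      (H2 s' (Rlt_le_trans _ _ _ Hs (Rmin_r _ _))) Hr)]. intros x. simpl. ring.
  + apply (ball_mono omega r); [lra | exact Hr].
  + apply H1, (Rlt_le_trans _ _ _ Hs (Rmin_l _ _)).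
Qed.

End Nonlinearity.

(** * The fixed point argument *)

Lemma half_pow_small (D eps : R) : 0 <= D -> 0 < eps ->
  exists n0, forall n, (n0 <= n)%nat -> D * (/ 2) ^ n < eps.
Proof.
intros HD He. destruct (Rmult_bound_eps D eps HD He) as (e & He1 & He2).
destruct (pow_lt_1_zero (/ 2) ltac:(rewrite Rabs_pos_eq; lra) e He1) as [n0 Hn0].
exists n0. intros n Hn. specialize (Hn0 n Hn).
pose proof (pow_le (/ 2) n ltac:(lra)). rewrite Rabs_pos_eq in Hn0 by assumption.
assert (D * (/ 2) ^ n <= D * e) by (apply Rmult_le_compat_l; lra). lra.
Qed.

(** The nearest-point projection onto [[-T, T]] for [0 <= T]; being 1-Lipschitz, it preserves
    continuity of paths. *)
Definition clamp (T t : R) : R := Rmax (- T) (Rmin t T).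

Lemma clamp_range (T t : R) : 0 <= T -> - T <= clamp T t <= T.
Proof.
intros HT. unfold clamp, Rmax, Rmin.
destruct (Rle_dec t T), (Rle_dec (- T) _); lra.
Qed.

Lemma clamp_id (T t : R) : - T <= t <= T -> clamp T t = t.
Proof.
intros HT. unfold clamp. rewrite Rmin_left, Rmax_right by lra. reflexivity.
Qed.

Lemma clamp_lip (T t t' : R) : Rabs (clamp T t' - clamp T t) <= Rabs (t' - t).
Proof.
unfold clamp, Rmax, Rmin.
destruct (Rle_dec t T), (Rle_dec t' T);
  repeat match goal with |- context [Rle_dec ?a ?b] => destruct (Rle_dec a b) end;
  unfold Rabs; repeat destruct Rcase_abs; lra.
Qed.

Section Cauchy.
Context (omega : nat -> R).
Notation ball := (A_ball omega).
Notation sch := (schrodinger_group omega).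

Lemma ball_small_zero (f : R -> C) (D : R) : 0 <= D ->
  (forall n, ball (D * (/ 2) ^ n) f) -> forall x, f x = 0%C.
Proof.
intros HD H x. apply Cmod_eq_0. apply Rle_antisym; [| apply Cmod_ge_0].
apply le_epsilon. intros eps He. destruct (half_pow_small D eps HD He) as [n Hn].
pose proof (ball_sup omega _ _ (H n) x). specialize (Hn n (le_n n)). lra.
Qed.

Lemma ball_limit_pow (f : R -> C) (r D : R) : 0 <= D ->
  (forall n, ball (r + D * (/ 2) ^ n) f) -> ball r f.
Proof.
intros HD H. apply ball_closed. intros eps He.
destruct (half_pow_small D eps HD He) as [n Hn]. specialize (Hn n (le_n n)).
eapply ball_mono; [| apply (H n)]. lra.
Qed.

(** Norm bounds dominate sup bounds, so the limit exists pointwise with uniform rate; [ball_limit]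
    then recovers the norm bound for the limit. *)
Lemma ball_complete (h : nat -> R -> C) (D : R) :
  (forall n, ball (D * (/ 2) ^ n) (fun x => h (S n) x - h n x)%C) ->
  exists hlim, forall n, ball (2 * D * (/ 2) ^ n) (fun x => hlim x - h n x)%C.
Proof.
intros H.
assert (HD : 0 <= D).
{ pose proof (ball_nonneg omega _ _ (H O)). simpl in H0. lra. }
assert (Hpow : forall n, 0 <= (/ 2) ^ n) by (intros; apply pow_le; lra).
(* The exact geometric partial sum is kept in the radius, since the bound without subtraction would
   not be inductive. *)
assert (Htel : forall n m,
  ball (2 * D * (/ 2) ^ n - 2 * D * (/ 2) ^ (n + m)) (fun x => h (n + m)%nat x - h n x)%C).
{ intros n m. induction m as [| m IH].
  - rewrite Nat.add_0_r. apply (ball_ext omega _ (fun _ => 0%C)); [intros x; ring |].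
    apply ball_zero. lra.
  - rewrite Nat.add_succ_r.
    eapply ball_mono; [| apply (ball_sub_triangle omega _ _ _ _ _ (H (n + m)%nat) IH)].
    simpl. lra. }
assert (Htel2 : forall n m, ball (2 * D * (/ 2) ^ n) (fun x => h (n + m)%nat x - h n x)%C).
{ intros n m. eapply ball_mono; [| apply Htel].
  pose proof (Rmult_le_pos D _ HD (Hpow (n + m)%nat)). lra. }
assert (Hlim : forall x, exists l : C, forall n, Cmod (l - h n x)%C <= 2 * D * (/ 2) ^ n).
{ intros x.
  destruct (proj1 (filterlim_locally_cauchy (U := C_R_CompleteNormedModule)
    (F := eventually) (fun n => h n x))) as [l Hl].
  - intros eps. destruct (half_pow_small (2 * D) (eps / 2)) as [n0 Hn0];
      [lra | destruct eps; simpl; lra |].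
    exists (fun n => (n0 <= n)%nat). split; [exists n0; auto |].
    intros u v Hu Hv. apply (norm_compat1 (V := C_R_NormedModule)). rewrite <- Cmod_norm.
    pose proof (ball_sup omega _ _ (Htel2 n0 (u - n0)%nat) x) as Bu.
    pose proof (ball_sup omega _ _ (Htel2 n0 (v - n0)%nat) x) as Bv.
    simpl in Bu, Bv.
    replace (n0 + (u - n0))%nat with u in Bu by lia.
    replace (n0 + (v - n0))%nat with v in Bv by lia.
    rewrite Cmod_sub_sym in Bu. specialize (Hn0 n0 (le_n n0)).
    pose proof (Cmod_sub_triangle (h v x) (h n0 x) (h u x)).
    apply Rle_lt_trans with (Cmod (h v x - h u x)%C); [apply Rle_refl | lra].
  - exists l. intros n. apply le_epsilon. intros eps He.
    destruct (proj1 (filterlim_C eventually (fun n => h n x) l) Hl eps He) as [N HN].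
    specialize (HN (n + N)%nat ltac:(lia)).
    pose proof (ball_sup omega _ _ (Htel2 n N) x) as B. simpl in B.
    rewrite Cmod_sub_sym in HN.
    pose proof (Cmod_sub_triangle l (h (n + N)%nat x) (h n x)). lra. }
exists (fun x => proj1_sig (constructive_indefinite_description _ (Hlim x))).
intros n. apply ball_limit. intros eps He.
destruct (half_pow_small (2 * D) eps ltac:(lra) He) as [m Hm].
exists (fun x => h (n + m)%nat x - h n x)%C. split.
- eapply ball_mono; [| apply Htel2]. lra.
- intros x. destruct (constructive_indefinite_description _ (Hlim x)) as [l Hl]. simpl.
  replace (l - h n x - (h (n + m)%nat x - h n x))%C with (l - h (n + m)%nat x)%C by ring.
  specialize (Hl (n + m)%nat). specialize (Hm (n + m)%nat ltac:(lia)). lra.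
Qed.

Lemma cpath_limit (U : nat -> R -> R -> C) (u : R -> R -> C) (D : R) : 0 <= D ->
  (forall n, cpath omega (U n)) ->
  (forall n t, ball (D * (/ 2) ^ n) (fun x => u t x - U n t x)%C) -> cpath omega u.
Proof.
intros HD HU Hu. split.
- intros t. destruct (proj1 (HU O) t) as [r Hr]. eexists.
  eapply ball_ext; [| apply (ball_plus omega _ _ _ _ (Hu O t) Hr)]. intros x. simpl. ring.
- intros t eps He. destruct (half_pow_small D (eps / 3) HD ltac:(lra)) as [n Hn].
  specialize (Hn n (le_n n)).
  destruct (proj2 (HU n) t (eps / 3) ltac:(lra)) as (d & Hd & H).
  exists d. split; [exact Hd |]. intros s Hs.
  apply (ball_mono omega (D * (/ 2) ^ n + (eps / 3 + D * (/ 2) ^ n))); [lra |].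
  apply (ball_sub_triangle omega _ _ _ (U n s)); [apply Hu |].
  apply (ball_sub_triangle omega _ _ _ (U n t)); [apply H, Hs | apply ball_sub_sym, Hu].
Qed.

End Cauchy.

Section Equation.
Context (omega : nat -> R) (p k : nat) (T : R) (HT : 0 < T).
Notation ball := (A_ball omega).
Notation sch := (schrodinger_group omega).
Notation cpath := (cpath omega).
Notation nonl u := (fun t x => nonlinearity p k (u t x)).

(** Outside [[-T, T]] the map is frozen at the end values, so its fixed points satisfy one equation
    at all times. *)
Definition picard (f : R -> C) (u : R -> R -> C) (t x : R) : C :=
  (sch (clamp T t) f x - Ci * duhamel omega (nonl u) (clamp T t) x)%C.

Lemma duhamel_ball_const (F : R -> R -> C) (M t : R) : cpath F ->
  (forall s, Rmin 0 t <= s <= Rmax 0 t -> ball M (F s)) ->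
  ball (Rabs t * M) (duhamel omega F t).
Proof.
intros HF Hb. rewrite <- (Rminus_0_r t) at 1.
apply (ball_CInt_const omega (fun s => sch (t - s) (F s))); [apply cpath_sch, HF |].
intros s Hs. apply sch_ball, Hb, Hs.
Qed.

Lemma ball_Ci (r : R) (f : R -> C) : ball r f -> ball r (fun x => Ci * f x)%C.
Proof.
intros H. apply (ball_scal omega Ci) in H. rewrite Cmod_Ci, Rmult_1_l in H. exact H.
Qed.

Lemma picard_cpath (f : R -> C) (r : R) (u : R -> R -> C) : ball r f -> cpath u ->
  cpath (picard f u).
Proof.
intros Hf Hu.
apply (cpath_minus omega (fun t => sch (clamp T t) f)
  (fun t x => Ci * duhamel omega (nonl u) (clamp T t) x)%C).
- apply (cpath_comp omega (fun t => sch t f)); [intros; apply clamp_lip |].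
  apply (cpath_sch_const omega f r Hf).
- apply (cpath_scal omega Ci (fun t => duhamel omega (nonl u) (clamp T t))).
  apply (cpath_comp omega (duhamel omega (nonl u))); [intros; apply clamp_lip |].
  apply cpath_duhamel, cpath_nonlinearity, Hu.
Qed.

Lemma between_clamp (t s : R) : - T <= t <= T -> Rmin 0 t <= s <= Rmax 0 t -> - T <= s <= T.
Proof. unfold Rmin, Rmax. destruct (Rle_dec 0 t); lra. Qed.

Lemma picard_ball (f : R -> C) (r Q : R) (u : R -> R -> C) (t : R) : ball r f -> cpath u ->
  (forall s, - T <= s <= T -> ball Q (nonl u s)) -> ball (r + T * Q) (picard f u t).
Proof.
intros Hf Hu HQ. pose proof (clamp_range T t ltac:(lra)) as Hc.
assert (H0 : 0 <= Q) by (apply (ball_nonneg omega Q (nonl u 0)), HQ; lra).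
apply ball_minus; [apply sch_ball, Hf |]. apply ball_Ci.
apply (ball_mono omega (Rabs (clamp T t) * Q)).
- apply Rmult_le_compat_r; [exact H0 |]. apply Rabs_le. lra.
- apply duhamel_ball_const; [apply cpath_nonlinearity, Hu |].
  intros s Hs. apply HQ, (between_clamp _ _ Hc Hs).
Qed.

(** The Duhamel bound is left as a hypothesis in order to serve both the contraction, with a
    constant bound, and uniqueness, with an exponential one. *)
Lemma picard_diff (f g : R -> C) (r q E B : R) (u v : R -> R -> C) (t : R) :
  ball r f -> ball q g -> ball E (fun x => f x - g x)%C -> cpath u -> cpath v ->
  ball B (duhamel omega (fun s x => nonl u s x - nonl v s x)%C (clamp T t)) ->
  ball (E + B) (fun x => picard f u t x - picard g v t x)%C.
Proof.
intros Hf Hg Hfg Hu Hv HB.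
eapply ball_ext; [| apply (ball_minus omega _ _ _ _
  (sch_minus_ball omega (clamp T t) _ _ _ _ _ Hf Hg Hfg) (ball_Ci _ _ HB))].
intros x. simpl. unfold picard.
rewrite (duhamel_minus omega (nonl u) (nonl v)) by (apply cpath_nonlinearity; assumption).
ring.
Qed.

Lemma picard_lipschitz (f g : R -> C) (r q E M L D : R) (u v : R -> R -> C) (t : R) :
  ball r f -> ball q g -> ball E (fun x => f x - g x)%C -> cpath u -> cpath v ->
  (forall s, - T <= s <= T -> ball M (u s)) -> (forall s, - T <= s <= T -> ball M (v s)) ->
  (forall u v D, ball M u -> ball M v -> ball D (fun x => u x - v x)%C ->
     ball (L * D) (fun x => nonlinearity p k (u x) - nonlinearity p k (v x))%C) ->
  (forall s, - T <= s <= T -> ball D (fun x => u s x - v s x)%C) ->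
  ball (E + T * (L * D)) (fun x => picard f u t x - picard g v t x)%C.
Proof.
intros Hf Hg Hfg Hu Hv HuM HvM HL HD. pose proof (clamp_range T t ltac:(lra)) as Hc.
assert (HLD : forall s, - T <= s <= T -> ball (L * D) (fun x => nonl u s x - nonl v s x)%C).
{ intros s Hs. apply HL; auto. }
assert (H0 : 0 <= L * D) by (eapply (ball_nonneg omega), (HLD 0); lra).
apply (picard_diff f g r q); try assumption.
apply (ball_mono omega (Rabs (clamp T t) * (L * D))).
- apply Rmult_le_compat_r; [exact H0 |]. apply Rabs_le. lra.
- apply duhamel_ball_const.
  + apply cpath_minus; apply cpath_nonlinearity; assumption.
  + intros s Hs. apply HLD, (between_clamp _ _ Hc Hs).
Qed.

Definition picard_solution (f : R -> C) (u : R -> R -> C) : Prop :=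
  cpath u /\ forall t x, u t x = picard f u t x.

(** [T * Q <= R0] keeps every iterate in the ball of radius [2 * R0]; [T * L <= / 2] halves
    successive differences. *)
Lemma picard_solution_exists (f : R -> C) (R0 Q L : R) : 0 < R0 -> ball R0 f ->
  (forall u, ball (2 * R0) u -> ball Q (fun x => nonlinearity p k (u x))) ->
  (forall u v D, ball (2 * R0) u -> ball (2 * R0) v -> ball D (fun x => u x - v x)%C ->
     ball (L * D) (fun x => nonlinearity p k (u x) - nonlinearity p k (v x))%C) ->
  T * Q <= R0 -> T * L <= / 2 ->
  exists u, picard_solution f u /\ forall t, ball (2 * R0) (u t).
Proof.
intros HR Hf HQ HL HTQ HTL.
(* Starting from the zero path makes the first difference an iterate, already bounded by
   [2 * R0]. *)
set (U := fun n => Nat.iter n (picard f) (fun _ _ => 0%C)).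
assert (HU : forall n, cpath (U n) /\ forall t, ball (2 * R0) (U n t)).
{ induction n as [| n [IH1 IH2]].
  - split; [split |].
    + intros s. exists 0. apply ball_zero. lra.
    + intros s eps He. exists 1. split; [lra |]. intros s' _.
      apply (ball_ext omega _ (fun _ => 0%C)); [intros x; simpl; ring | apply ball_zero; lra].
    + intros t. apply ball_zero. lra.
  - split.
    + apply (picard_cpath f R0 (U n) Hf IH1).
    + intros t. apply (ball_mono omega (R0 + T * Q)); [lra |].
      apply (picard_ball f R0 Q (U n) t Hf IH1). intros s _. apply HQ, IH2. }
assert (Hff : ball 0 (fun x => f x - f x)%C).
{ apply (ball_ext omega _ (fun _ => 0%C)); [intros x; ring | apply ball_zero; lra]. }
assert (Hstep : forall n t, ball (2 * R0 * (/ 2) ^ n) (fun x => U (S n) t x - U n t x)%C).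
{ induction n as [| n IH]; intros t.
  - simpl pow. rewrite Rmult_1_r.
    apply (ball_ext omega _ (U 1%nat t)); [intros x; simpl; ring | apply HU].
  - apply (ball_mono omega (0 + T * (L * (2 * R0 * (/ 2) ^ n)))).
    + assert (0 <= 2 * R0 * (/ 2) ^ n) by (apply Rmult_le_pos; [lra | apply pow_le; lra]).
      simpl. nra.
    + apply (picard_lipschitz f f R0 R0 0 (2 * R0) L _ (U (S n)) (U n) t Hf Hf Hff);
        [apply HU | apply HU | intros; apply HU | intros; apply HU | exact HL |
         intros s _; apply IH]. }
assert (Hlim : forall t, exists h, forall n,
  ball (2 * (2 * R0) * (/ 2) ^ n) (fun x => h x - U n t x)%C).
{ intros t. apply (ball_complete omega (fun n => U n t)). intros n. apply Hstep. }
set (u := fun t => proj1_sig (constructive_indefinite_description _ (Hlim t))).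
assert (Hu : forall n t, ball (4 * R0 * (/ 2) ^ n) (fun x => u t x - U n t x)%C).
{ intros n t. unfold u.
  destruct (constructive_indefinite_description _ (Hlim t)) as [h Hh]. simpl.
  eapply ball_mono; [| apply Hh]. lra. }
assert (Hcu : cpath u).
{ apply (cpath_limit omega U u (4 * R0)); [lra | intros; apply HU | exact Hu]. }
assert (Hbu : forall t, ball (2 * R0) (u t)).
{ intros t. apply (ball_limit_pow omega _ _ (4 * R0)); [lra |]. intros n.
  rewrite Rplus_comm.
  eapply ball_ext; [| apply (ball_plus omega _ _ _ _ (Hu n t) (proj2 (HU n) t))].
  intros x. simpl. ring. }
exists u. split; [| exact Hbu]. split; [exact Hcu |]. intros t x.
apply (proj2 (Ceq_minus _ _)).
apply (ball_small_zero omega (fun x => u t x - picard f u t x)%C (4 * R0)); [lra |].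
intros n.
(* The defect of [u] is measured through the next iterate: half of the bound comes from
   [u - U (S n)], the other half from the contraction applied to [U n - u]. *)
apply (ball_mono omega (4 * R0 * (/ 2) ^ S n + (0 + T * (L * (4 * R0 * (/ 2) ^ n))))).
- assert (0 <= 4 * R0 * (/ 2) ^ n) by (apply Rmult_le_pos; [lra | apply pow_le; lra]).
  simpl. nra.
- apply (ball_sub_triangle omega _ _ _ (U (S n) t)); [apply Hu |].
  apply (picard_lipschitz f f R0 R0 0 (2 * R0) L _ (U n) u t Hf Hf Hff);
    [apply HU | exact Hcu | intros; apply HU | intros; apply Hbu | exact HL |].
  intros s _. apply ball_sub_sym, Hu.
Qed.

(** A bound [D] valid at all times improves to [E + D / 2]. Iterating from the crude bound [2 * M]
    converges to [2 * E], with no supremum over time to be formed. *)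
Lemma picard_solution_lipschitz (f g : R -> C) (r q E M L : R) (u v : R -> R -> C) :
  ball r f -> ball q g -> ball E (fun x => f x - g x)%C ->
  picard_solution f u -> picard_solution g v ->
  (forall t, ball M (u t)) -> (forall t, ball M (v t)) ->
  (forall u v D, ball M u -> ball M v -> ball D (fun x => u x - v x)%C ->
     ball (L * D) (fun x => nonlinearity p k (u x) - nonlinearity p k (v x))%C) ->
  T * L <= / 2 -> forall t, ball (2 * E) (fun x => u t x - v t x)%C.
Proof.
intros Hf Hg Hfg [Hu Eu] [Hv Ev] HuM HvM HL HTL.
pose proof (ball_nonneg omega _ _ Hfg) as HE.
pose proof (ball_nonneg omega _ _ (HuM 0)) as HM.
assert (H : forall n t, ball (2 * E + 2 * M * (/ 2) ^ n) (fun x => u t x - v t x)%C).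
{ induction n as [| n IH]; intros t.
  - apply (ball_mono omega (M + M)); [simpl; lra |]. apply ball_minus; [apply HuM | apply HvM].
  - apply (ball_mono omega (E + T * (L * (2 * E + 2 * M * (/ 2) ^ n)))).
    + assert (0 <= 2 * E + 2 * M * (/ 2) ^ n).
      { assert (0 <= 2 * M * (/ 2) ^ n) by (apply Rmult_le_pos; [lra | apply pow_le; lra]). lra. }
      simpl. nra.
    + apply (ball_ext omega _ (fun x => picard f u t x - picard g v t x)%C);
        [intros x; rewrite <- Eu, <- Ev; reflexivity |].
      apply (picard_lipschitz f g r q E M L _ u v t); auto. }
intros t. apply (ball_limit_pow omega _ _ (2 * M)); [lra |]. intros n. apply H.
Qed.

Lemma RInt_exp_scal (c K a b : R) : K <> 0 ->
  RInt (fun s => c * exp (K * s)) a b = c / K * (exp (K * b) - exp (K * a)).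
Proof.
intros HK. apply is_RInt_unique.
replace (c / K * (exp (K * b) - exp (K * a)))
  with (minus (c / K * exp (K * b)) (c / K * exp (K * a)))
  by (unfold minus, plus, opp; simpl; ring).
apply (is_RInt_derive (V := R_CompleteNormedModule) (fun s => c / K * exp (K * s))).
- intros x _. auto_derive; [exact I |]. field. exact HK.
- intros x _. apply (ex_derive_continuous (V := R_NormedModule)). auto_derive. exact I.
Qed.

(** Gronwall through the weighted norm [sup_t exp (- 2 L |t|) |u t - v t|], for which the
    Duhamel term is a contraction whatever the length of the time interval. *)
Lemma picard_solution_unique (f : R -> C) (r : R) (u v : R -> R -> C) : ball r f ->
  picard_solution f u -> picard_solution f v ->
  forall t, - T <= t <= T -> forall x, u t x = v t x.
Proof.
intros Hf [Hu Eu] [Hv Ev].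
destruct (cpath_bounded omega u (- T) T Hu) as (M1 & HM1 & Hb1).
destruct (cpath_bounded omega v (- T) T Hv) as (M2 & HM2 & Hb2).
(* These bounds depend on the two solutions, so the Lipschitz constant [L] obtained from [M] bears
   no relation to [T]. *)
set (M := M1 + M2).
assert (HuM : forall s, - T <= s <= T -> ball M (u s)).
{ intros s Hs. apply (ball_mono omega M1); [unfold M; lra | auto]. }
assert (HvM : forall s, - T <= s <= T -> ball M (v s)).
{ intros s Hs. apply (ball_mono omega M2); [unfold M; lra | auto]. }
destruct (nonlinearity_ball omega p k M ltac:(unfold M; lra)) as (Q & L & _ & HL0 & _ & HL).
assert (Hff : ball 0 (fun x => f x - f x)%C).
{ apply (ball_ext omega _ (fun _ => 0%C)); [intros x; ring | apply ball_zero; lra]. }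
(* Each round halves the factor: the integral of [L * D * exp (2 L |s|)] from [0] to [t] has modulus
   [D / 2 * (exp (2 L |t|) - 1)]. *)
assert (H : forall n t, - T <= t <= T ->
  ball (2 * M * (/ 2) ^ n * exp (2 * L * Rabs t)) (fun x => u t x - v t x)%C).
{ induction n as [| n IH]; intros t Ht.
  - apply (ball_mono omega (M + M)); [| apply ball_minus; auto].
    assert (1 <= exp (2 * L * Rabs t)).
    { pose proof (exp_ineq1_le (2 * L * Rabs t)).
      assert (0 <= 2 * L * Rabs t) by (apply Rmult_le_pos; [lra | apply Rabs_pos]). lra. }
    simpl. unfold M in *. nra.
  - set (D := 2 * M * (/ 2) ^ n) in *.
    assert (HD : 0 <= D) by (apply Rmult_le_pos; [unfold M; lra | apply pow_le; lra]).
    apply (ball_ext omega _ (fun x => picard f u t x - picard f v t x)%C);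
      [intros x; rewrite <- Eu, <- Ev; reflexivity |].
    (* The sign of [t] turns [|s|] into a linear function between [0] and [t], so the weight becomes
       an exponential with an explicit primitive. *)
    assert (Hsig : exists sg, (sg = 1 \/ sg = -1) /\
      forall s, Rmin 0 t <= s <= Rmax 0 t -> Rabs s = sg * s).
    { destruct (Rle_dec 0 t) as [H0 | H0].
      - exists 1. split; [left; reflexivity |]. rewrite Rmin_left, Rmax_right by exact H0.
        intros s Hs. rewrite Rabs_pos_eq; lra.
      - exists (-1). split; [right; reflexivity |]. rewrite Rmin_right, Rmax_left by lra.
        intros s Hs. rewrite Rabs_left1; lra. }
    destruct Hsig as (sg & Hsg & Hs).
    assert (Hsg0 : 2 * L * sg <> 0) by (destruct Hsg as [-> | ->]; lra).
    set (g := fun s => L * D * exp (2 * L * sg * s)).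
    assert (HB : ball (Rabs (RInt g 0 t))
       (duhamel omega (fun s x => nonl u s x - nonl v s x)%C (clamp T t))).
    { rewrite (clamp_id T t Ht). apply duhamel_ball.
      - apply cpath_minus; apply cpath_nonlinearity; assumption.
      - intros s. apply (ex_derive_continuous (V := R_NormedModule)). unfold g.
        auto_derive. exact I.
      - intros s Hst. pose proof (between_clamp t s Ht Hst) as HsT. unfold g.
        replace (L * D * exp (2 * L * sg * s)) with (L * (D * exp (2 * L * Rabs s))).
        + apply HL; auto.
        + rewrite (Hs s Hst). rewrite <- (Rmult_assoc (2 * L) sg s). ring. }
    eapply ball_mono; [| apply (picard_diff f f r r 0 _ u v t Hf Hf Hff Hu Hv HB)].
    unfold g. rewrite RInt_exp_scal by exact Hsg0.
    rewrite Rmult_0_r, exp_0.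
    replace (2 * L * sg * t) with (2 * L * Rabs t).
    2:{ rewrite (Hs t); [ring |]. split; [apply Rmin_r | apply Rmax_r]. }
    assert (H1 : 1 <= exp (2 * L * Rabs t)).
    { pose proof (exp_ineq1_le (2 * L * Rabs t)).
      assert (0 <= 2 * L * Rabs t) by (apply Rmult_le_pos; [lra | apply Rabs_pos]). lra. }
    replace (L * D / (2 * L * sg)) with (D / 2 * / sg)
      by (field; destruct Hsg as [-> | ->]; lra).
    replace (Rabs (D / 2 * / sg * (exp (2 * L * Rabs t) - 1)))
      with (D / 2 * (exp (2 * L * Rabs t) - 1)).
    + unfold D. simpl. fold D. assert (0 <= (/ 2) ^ n) by (apply pow_le; lra).
      replace (2 * M * (/ 2 * (/ 2) ^ n)) with (D / 2) by (unfold D; field).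
      change (2 * M * (/ 2) ^ n) with D. nra.
    + rewrite !Rabs_mult, (Rabs_pos_eq (D / 2)), (Rabs_pos_eq (exp _ - 1)) by lra.
      destruct Hsg as [-> | ->].
      * rewrite Rinv_1, Rabs_R1. ring.
      * replace (/ -1) with (-1) by field. rewrite (Rabs_left (-1)) by lra. ring. }
intros t Ht x. apply (proj2 (Ceq_minus _ _)).
assert (HMe : 0 <= 2 * M * exp (2 * L * Rabs t)).
{ apply Rmult_le_pos; [unfold M; lra | apply Rlt_le, exp_pos]. }
apply (ball_small_zero omega (fun x => u t x - v t x)%C _ HMe).
intros n. eapply ball_mono; [| apply (H n t Ht)]. right. ring.
Qed.

Lemma picard_solution_is_solution (f : R -> C) (u : R -> R -> C) :
  picard_solution f u -> is_solution omega p k T f u.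
Proof.
intros [[H1 H2] E]. split; [split |].
- intros t _. destruct (H1 t) as [r Hr]. apply Hr.
- intros t Ht eps He. destruct (H2 t (eps / 2) ltac:(lra)) as (d & Hd & H).
  exists d. split; [exact Hd |]. intros s Hs Hst.
  apply (Rbar_le_lt_trans _ (Finite (eps / 2))); [apply (H s Hst) | simpl; lra].
- intros t Ht x. rewrite E. unfold picard. rewrite clamp_id by exact Ht. reflexivity.
Qed.

Lemma A_space_ball (f : R -> C) : A_space omega f ->
  exists r, A_norm omega f = Finite r /\ ball r f.
Proof.
intros H. pose proof H as [_ [_ Hlt]].
assert (H0 : Rbar_le 0 (A_norm omega f)).
{ apply (proj1 (Lub_Rbar_correct _)). exists nil. split; [split; constructor | reflexivity]. }
destruct (A_norm omega f) as [r | |] eqn:E; [| destruct Hlt | destruct H0].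
exists r. split; [reflexivity |]. split; [exact H |]. rewrite E. apply Rle_refl.
Qed.

(** Clamping extends a solution known on [[-T, T]] to a continuous path; the Duhamel integral up to
    a clamped time only visits times that [clamp] fixes. *)
Lemma is_solution_picard_solution (f : R -> C) (v : R -> R -> C) :
  is_solution omega p k T f v -> picard_solution f (fun t => v (clamp T t)).
Proof.
intros [[H1 H2] E]. assert (HT0 : 0 <= T) by lra. split; [split |].
- intros s. destruct (A_space_ball _ (H1 _ (clamp_range T s HT0))) as (r & _ & Hr).
  exists r. exact Hr.
- intros s eps He. destruct (H2 _ (clamp_range T s HT0) eps He) as (d & Hd & H).
  exists d. split; [exact Hd |]. intros s' Hs.
  specialize (H _ (clamp_range T s' HT0) (Rle_lt_trans _ _ _ (clamp_lip T s s') Hs)).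
  destruct (A_space_ball _ (H1 _ (clamp_range T s HT0))) as (r & _ & Hr).
  destruct (A_space_ball _ (H1 _ (clamp_range T s' HT0))) as (r' & _ & Hr').
  split; [apply (ball_minus omega _ _ _ _ Hr' Hr) |]. apply Rbar_lt_le, H.
- intros t x. pose proof (clamp_range T t HT0) as Hc.
  assert (Ed : duhamel omega (nonl v) (clamp T t) x
    = duhamel omega (nonl (fun s => v (clamp T s))) (clamp T t) x).
  { apply CInt_ext. intros s Hs.
    rewrite (clamp_id T s); [reflexivity |]. apply (between_clamp _ _ Hc). lra. }
  rewrite (E _ Hc), Ed. reflexivity.
Qed.

End Equation.

Theorem theorem1p7 (p k : nat) (hp : (1 <= p)%nat) (hk : (k <= p)%nat)
  (omega : nat -> R) :
  forall R0 : R, 0 < R0 ->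
  exists T : R, 0 < T /\
    (forall f : R -> C, A_ball omega R0 f ->
       exists u : R -> R -> C, is_solution omega p k T f u /\
         forall v : R -> R -> C, is_solution omega p k T f v ->
           forall t : R, - T <= t <= T -> forall x : R, v t x = u t x) /\
    (forall t : R, - T <= t <= T ->
       exists Phi : (R -> C) -> (R -> C),
         (forall (f : R -> C) (u : R -> R -> C),
            A_ball omega R0 f -> is_solution omega p k T f u ->
            forall x : R, Phi f x = u t x) /\
         locally_lipschitz_on omega (A_ball omega R0) Phi).
Proof.
intros R0 HR.
destruct (nonlinearity_ball omega p k (2 * R0) ltac:(lra)) as (Q & L & HQ0 & HL0 & HQ & HL).
(* The first bound gives stability of the ball of radius [2 * R0], the second the contraction factor
   [/ 2]. *)
set (T := Rmin (R0 / Q) (/ 2 / L)).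
assert (HT : 0 < T) by (apply Rmin_pos; apply Rdiv_lt_0_compat; lra).
assert (HTQ : T * Q <= R0) by (apply Rle_div_r; [lra | apply Rmin_l]).
assert (HTL : T * L <= / 2) by (apply Rle_div_r; [lra | apply Rmin_r]).
exists T. split; [exact HT |].
assert (Hex : forall f, A_ball omega R0 f -> exists u,
  picard_solution omega p k T f u /\ forall t, A_ball omega (2 * R0) (u t)).
{ intros f Hf. apply (picard_solution_exists omega p k T HT f R0 Q L); assumption. }
assert (Huniq : forall f u v, A_ball omega R0 f -> picard_solution omega p k T f u ->
  is_solution omega p k T f v -> forall t, - T <= t <= T -> forall x, v t x = u t x).
{ intros f u v Hf Hu Hv t Ht x.
  rewrite (picard_solution_unique omega p k T f R0 u (fun t => v (clamp T t)) Hf Hu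
    (is_solution_picard_solution omega p k T HT f v Hv) t Ht x).
  rewrite clamp_id by exact Ht. reflexivity. }
split.
- intros f Hf. destruct (Hex f Hf) as (u & Hu & _). exists u. split.
  + apply picard_solution_is_solution, Hu.
  + intros v Hv. apply (Huniq f u v Hf Hu Hv).
- intros t Ht.
  (* The map has to be one function of [f], so the value at time [t] of some solution is selected by
     choice; uniqueness makes the selection immaterial. [inhabits f] only witnesses that the type is
     nonempty. *)
  set (Phi := fun f : R -> C => epsilon (inhabits f) (fun h =>
    exists u, picard_solution omega p k T f u /\ forall x, h x = u t x)).
  assert (HPhi : forall f u, A_ball omega R0 f -> picard_solution omega p k T f u ->
    forall x, Phi f x = u t x).
  { intros f u Hf Hu x.
    destruct (epsilon_spec (inhabits f) (fun h =>
      exists u, picard_solution omega p k T f u /\ forall x, h x = u t x)) as (w & Hw & E).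
    - exists (u t), u. split; [exact Hu | reflexivity].
    - fold (Phi f) in E. rewrite E.
      apply (picard_solution_unique omega p k T f R0 w u Hf Hw Hu t Ht). }
  exists Phi. split.
  + intros f v Hf Hv x. destruct (Hex f Hf) as (u & Hu & _).
    rewrite (HPhi f u Hf Hu x). symmetry. apply (Huniq f u v Hf Hu Hv t Ht).
  (* The estimate holds on the whole ball with constant [2], so any radius serves. *)
  + intros f0 _. exists 1, 2. split; [lra | split; [lra |]]. intros f g Hf Hg _ _.
    destruct (Hex f Hf) as (u & Hu & HuM). destruct (Hex g Hg) as (v & Hv & HvM).
    (* [E] is exactly the norm of [f - g], now a real number, so that the product in extended reals
       becomes [2 * E]. *)
    destruct (A_space_ball omega _ (proj1 (ball_minus omega _ _ _ _ Hf Hg))) as (E & EE & HE).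
    unfold A_dist at 2. rewrite EE.
    apply (proj2 (ball_ext omega (2 * E) _ _ (fun x => f_equal2 Cminus
       (eq_sym (HPhi f u Hf Hu x)) (eq_sym (HPhi g v Hg Hv x)))
      (picard_solution_lipschitz omega p k T HT f g R0 R0 E (2 * R0) L u v
         Hf Hg HE Hu Hv HuM HvM HL HTL t))).
Qed.
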